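(* Let $\epsilon>0$ be a fixed constant. There is a polynomial-time algorithm which, given an instance $\langle I,S,I'\rangle$ of Steiner tree reoptimization in which $I=\langle G,c,R\rangle$ is an $\mathit{STP}$ instance, $S$ is a $\rho$-approximate Steiner tree of $I$ for some real $\rho\ge 1$, and $I'=\langle G,c,R\cup\{t\}\rangle$ for some Steiner vertex $t\in V(G)\setminus R$ (i.e., a single vertex changes its status from Steiner to terminal), computes a $(\rho+\epsilon)$-approximate Steiner tree of $I'$.
   Context: An instance of the Steiner tree problem ($\mathit{STP}$) is a triple $I=\langle G,c,R\rangle$ where $G$ is a connected undirected graph with $n$ vertices, $c:E(G)\to\mathbb{R}_{\ge 0}$ is an edge-cost function, and $R\subseteq V(G)$ is the set of terminals; vertices in $V(G)\setminus R$ are Steiner vertices. A Steiner tree of $I$ is a subtree of $G$ spanning $R$; its cost is the sum of its edge costs, and an optimal solution is a minimum-cost Steiner tree. A Steiner tree $S$ is $\rho$-approximate if $c(S)\le\rho\, c(\mathit{OPT})$ for an optimal Steiner tree $\mathit{OPT}$. In Steiner tree reoptimization one is given $\langle I,S,I'\rangle$ where $S$ is a $\rho$-approximate Steiner tree of $I$ and $I'$ is an $\mathit{STP}$ instance obtained from $I$ by a local modification, and one must compute a Steiner tree of $I'$. ''Polynomial time'' refers to the input size, for fixed $\epsilon$. *)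

(* Defs.v *)
From mathcomp Require Import all_boot all_order all_algebra.
From mathcomp Require Import reals.

Set Implicit Arguments.
Unset Strict Implicit.
Unset Printing Implicit Defensive.

Import Order.TTheory GRing.Theory Num.Theory.
Local Open Scope ring_scope.

(* ------------------------------------------------------------------------- *)
(* Programs are Jones' WHILE programs over binary trees, in point-free form, *)
(* with real numbers as additional leaves.  On a machine that stores trees   *)
(* as linked cells every construct is a bounded number of pointer operations *)
(* plus at most one real operation, so the step count below is, up to a      *)
(* constant factor depending on the program, the running time on a unit-cost *)
(* real RAM.  Real numbers can only be added and compared and no other       *)
(* constant than 0 is available: on rational inputs, k steps lengthen the    *)
(* numbers by O(k) bits once the inputs have a common denominator.  Hence    *)
(* polynomially many steps here imply polynomial time on a Turing machine.   *)
(* ------------------------------------------------------------------------- *)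

Inductive data (R : Type) : Type :=
  | Nil
  | Num of R
  | Cons of data R & data R.
Arguments Nil {R}.

Fixpoint data_size (R : Type) (d : data R) : nat :=
  if d is Cons a b then (data_size a + data_size b).+1 else 1%N.

Definition is_nil (R : Type) (d : data R) : bool :=
  if d is Nil then true else false.

Definition of_bool (R : Type) (b : bool) : data R :=
  if b then Cons Nil Nil else Nil.

Definition of_list (R : Type) (s : seq (data R)) : data R :=
  foldr (@Cons R) Nil s.

Inductive prim : Type := PId | PNil | PHead | PTail | PZero | PAdd | PLe.

(* Operations applied to an argument of the wrong shape return Nil. *)
Definition prim_eval (R : realType) (o : prim) (d : data R) : data R :=
  match o, d with
  | PId, _ => d
  | PHead, Cons a _ => a
  | PTail, Cons _ b => b
  | PZero, _ => Num 0
  | PAdd, Cons (Num a) (Num b) => Num (a + b)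
  | PLe, Cons (Num a) (Num b) => of_bool R (a <= b)
  | _, _ => Nil
  end.

Inductive prog : Type :=
  | Prim of prim
  | Seq of prog & prog
  | Pair of prog & prog
  | If of prog & prog & prog
  | While of prog & prog.

(* runs P x k y : started on x, the program P halts after k steps with       *)
(* result y.  Tests count as true when their value is not Nil, and leave     *)
(* the current value x unchanged.                                            *)
Inductive runs (R : realType) : prog -> data R -> nat -> data R -> Prop :=
  | RunPrim o x : runs (Prim o) x 1 (prim_eval o x)
  | RunSeq P Q x y z k l :
      runs P x k y -> runs Q y l z -> runs (Seq P Q) x (k + l).+1 z
  | RunPair P Q x y z k l :
      runs P x k y -> runs Q x l z -> runs (Pair P Q) x (k + l).+1 (Cons y z)
  | RunIf B P Q x b y k l :
      runs B x k b -> runs (if is_nil b then Q else P) x l y ->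
      runs (If B P Q) x (k + l).+1 y
  | RunWhileStop B P x b k :
      runs B x k b -> is_nil b -> runs (While B P) x k.+1 x
  | RunWhileStep B P x b y z k l m :
      runs B x k b -> ~~ is_nil b -> runs P x l y -> runs (While B P) y m z ->
      runs (While B P) x (k + l + m).+1 z.

Lemma runs_det (R : realType) (P : prog) (x : data R) (k k' : nat)
    (y y' : data R) :
  runs P x k y -> runs P x k' y' -> k = k' /\ y = y'.
Proof.
move=> r; elim: r k' y' => {P x k y}.
- by move=> o x k' y' r; inversion r.
- move=> P Q x y z k l _ IHP _ IHQ k' y' r; inversion r as [|? ? ? ? ? ? ? rP rQ| | | |].
  by case: (IHP _ _ rP) => <- ey; subst; case: (IHQ _ _ rQ) => <- <-.
- move=> P Q x y z k l _ IHP _ IHQ k' y' r; inversion r as [| |? ? ? ? ? ? ? rP rQ| | |].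
  by case: (IHP _ _ rP) => <- <-; case: (IHQ _ _ rQ) => <- <-.
- move=> B P Q x b y k l _ IHB _ IHP k' y' r; inversion r as [| | |? ? ? ? ? ? ? ? rB rP| |].
  by case: (IHB _ _ rB) => <- eb; subst; case: (IHP _ _ rP) => <- <-.
- move=> B P x b k _ IHB nb k' y' r.
  inversion r as [| | | |? ? ? ? ? rB _|? ? ? ? ? ? ? ? ? rB nb' _ _]; subst.
    by case: (IHB _ _ rB) => <- _.
  by case: (IHB _ _ rB) => _ eb; subst; rewrite nb in nb'.
- move=> B P x b y z k l m _ IHB nb _ IHP _ IHW k' y' r.
  inversion r as [| | | |? ? ? ? ? rB nb'|? ? ? ? ? ? ? ? ? rB _ rP rW]; subst.
    by case: (IHB _ _ rB) => _ eb; subst; rewrite nb' in nb.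
  case: (IHB _ _ rB) => <- _; case: (IHP _ _ rP) => <- ey; subst.
  by case: (IHW _ _ rW) => <- <-.
Qed.

Record graph (n : nat) : Type := Graph {
  verts : {set 'I_n};
  edges : {set {set 'I_n}} }.

Definition is_graph (n : nat) (H : graph n) : Prop :=
  forall e, e \in edges H -> #|e| = 2%N /\ e \subset verts H.

Definition adj (n : nat) (H : graph n) : rel 'I_n :=
  [rel x y | [set x; y] \in edges H].

Definition connected (n : nat) (H : graph n) : Prop :=
  verts H != set0 /\
  {in verts H &, forall x y, connect (adj H) x y}.

(* A simple graph has no cycle of length 1, and the cycles of length 2 in    *)
(* the sense of ucycle go back and forth along one edge.                     *)
Definition acyclic (n : nat) (H : graph n) : Prop :=
  forall p : seq 'I_n, ucycle (adj H) p -> (size p < 3)%N.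

Definition is_tree (n : nat) (H : graph n) : Prop :=
  [/\ is_graph H, connected H & acyclic H].

Definition subgraph (n : nat) (H G : graph n) : Prop :=
  verts H \subset verts G /\ edges H \subset edges G.

(* The instance graph has vertex set 'I_n (other elements of graph n serve   *)
(* as its subgraphs); values of ecost on non-edges are irrelevant.           *)
Record stp (R : realType) (n : nat) : Type := Stp {
  stp_graph : graph n;
  ecost : {set 'I_n} -> R;
  terminals : {set 'I_n};
  stp_verts : verts stp_graph = [set: 'I_n];
  stp_is_graph : is_graph stp_graph;
  stp_connected : connected stp_graph;
  ecost_ge0 : forall e, e \in edges stp_graph -> 0 <= ecost e }.

Definition add_terminal (R : realType) (n : nat) (I : stp R n) (t : 'I_n) :
    stp R n :=
  Stp (t |: terminals I) (stp_verts I) (stp_is_graph (s := I))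
    (stp_connected I) (ecost_ge0 (s := I)).

Definition steiner_tree (R : realType) (n : nat) (I : stp R n) (T : graph n) :
    Prop :=
  [/\ is_tree T, subgraph T (stp_graph I) & terminals I \subset verts T].

Definition cost (R : realType) (n : nat) (I : stp R n) (T : graph n) : R :=
  \sum_(e in edges T) ecost I e.

Definition optimal (R : realType) (n : nat) (I : stp R n) (T : graph n) :
    Prop :=
  steiner_tree I T /\ forall T', steiner_tree I T' -> cost I T <= cost I T'.

Definition approximate (R : realType) (n : nat) (rho : R) (I : stp R n)
    (T : graph n) : Prop :=
  steiner_tree I T /\
  exists OPT : graph n, optimal I OPT /\ cost I T <= rho * cost I OPT.

(* Vertex sets are encoded as bit lists and edges as n x n matrices, so the  *)
(* encodings contain no vertex names and have size Theta(n^2).               *)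
Definition enc_set (R : Type) (n : nat) (A : {set 'I_n}) : data R :=
  of_list [seq of_bool R (i \in A) | i <- enum 'I_n].

Definition enc_matrix (R : Type) (n : nat) (f : 'I_n -> 'I_n -> data R) :
    data R :=
  of_list [seq of_list [seq f i j | j <- enum 'I_n] | i <- enum 'I_n].

Definition enc_graph (R : Type) (n : nat) (H : graph n) : data R :=
  Cons (enc_set R (verts H)) (enc_matrix (fun i j => of_bool R (adj H i j))).

(* The cost matrix also encodes the graph: Nil stands for "no edge". *)
Definition enc_stp (R : realType) (n : nat) (I : stp R n) : data R :=
  Cons
    (enc_matrix (fun i j =>
       if adj (stp_graph I) i j then Num (ecost I [set i; j]) else Nil))
    (enc_set R (terminals I)).

Definition enc_reopt (R : realType) (n : nat) (I : stp R n) (S : graph n)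
    (I' : stp R n) : data R :=
  Cons (enc_stp I) (Cons (enc_graph R S) (enc_stp I')).

(* Main.v *)
(* Let U be the terminals of I together with t, and let T be an optimal tree
   for U.  Both S and T are cut, at a cost of a factor 1 + 1/r, into hyperedges
   with boundedly many terminals (Borchers and Du).  Starting from T, hyperedges
   Q of T are exchanged for hyperedges P of S in rounds: T - Q + P keeps spanning
   the old terminals, and S - P + Q together with boundedly many further
   hyperedges Q' of T spans U.  The sets Q' are disjoint, so one of a bounded
   number of rounds has c(Q') <= (eps/2) c(T).  Now c(S) <= rho c(OPT) and
   c(OPT) <= c(T) - c(Q) + c(P), so S - P + Q + Q' costs about
   c(S) - c(P) + c(Q) <= rho c(T) + (rho - 1) (c(P) - c(Q)) if c(P) <= c(Q), and
   about c(S) <= rho c(T) otherwise.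

   The hyperedges of Q and Q' consist of boundedly many shortest paths, and what
   is left of S is determined by the boundedly many edges of S on its boundary;
   hence exhaustive search over paths to add and edges to remove finds a tree
   that is at least as good.  Rounding S loses a multiple of rho, which is
   harmless for rho <= 2; for larger rho the minimum spanning tree of the metric
   closure of U is good enough. *)

Require Import Defs.
From mathcomp Require Import all_boot all_order all_algebra.
From mathcomp Require Import reals boolp zify ring lra.
From Stdlib Require Import Relations.
Set Implicit Arguments.
Unset Strict Implicit.
Unset Printing Implicit Defensive.
Import Order.TTheory GRing.Theory Num.Theory.
Local Open Scope ring_scope.

(** * Polynomial-time programs *)

(** The program knows neither [rho] nor any decomposition, and it cannot multiply. So [eps] enters
    only through the two numbers [n_added] and [n_removed], candidates are compared by their sums of
    costs, and both kinds of candidates are always tried.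

    The exchange runs in rounds because the two trees cannot be repaired at once: each repair of one
    damages the other. The process is stopped when the next repair is cheap.

    The main obstacle is to discard a part of S by few guesses, for a single hyperedge of S may
    consist of arbitrarily many edges. Only the edges on the boundary of that part are deleted; a
    spanning tree grown from [t] then never reaches the part and does not pay for it. To make the
    boundary small, S is thinned to an inclusion-minimal set of edges that spans the old terminals.
    Each of its edges then has old terminals on both sides and can be charged to a pair of
    attachment vertices. *)

Lemma leq_expn2 m n k : (m <= n)%N -> (m ^ k <= n ^ k)%N.
Proof. by move=> le; case: k => // k; rewrite leq_exp2r. Qed.

Section PolyTime.
Variable R : realType.

Class Enc (A : Type) := enc : A -> data R.
Hint Mode Enc ! : typeclass_instances.

#[export] Instance enc_real : Enc R := @Defs.Num R.
#[export] Instance enc_unit : Enc unit := fun _ => Defs.Nil.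
#[export] Instance enc_bool : Enc bool := of_bool R.
(** Unary: a vertex name has size linear in n, the successor is a pairing, and a counter has the
    same data as a list of units. *)
#[export] Instance enc_nat : Enc nat := fun n => of_list (nseq n Defs.Nil).
#[export] Instance enc_option : Enc (option R) :=
  fun o => if o is Some c then Defs.Num c else Defs.Nil.
#[export] Instance enc_pair A B `{Enc A} `{Enc B} : Enc (A * B) :=
  fun p => Defs.Cons (enc p.1) (enc p.2).
#[export] Instance enc_seq A `{Enc A} : Enc (seq A) :=
  fun s => of_list [seq enc x | x <- s].

Definition esz A `{Enc A} (a : A) : nat := data_size (enc a).

Lemma esz_gt0 A `{Enc A} (a : A) : (0 < esz a)%N.
Proof. by rewrite /esz; case: (enc a). Qed.

Lemma esz_pair A B `{Enc A} `{Enc B} (a : A) (b : B) :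
  esz (a, b) = (esz a + esz b).+1.
Proof. by []. Qed.

Lemma esz_cons A `{Enc A} (a : A) s : esz (a :: s) = (esz a + esz s).+1.
Proof. by []. Qed.

Lemma esz_nil A `{Enc A} : esz ([::] : seq A) = 1%N.
Proof. by []. Qed.

Lemma esz_real (c : R) : esz c = 1%N.
Proof. by []. Qed.

Lemma esz_nat n : esz n = n.*2.+1.
Proof. by rewrite /esz /enc /enc_nat; elim: n => //= n ->; rewrite add1n doubleS. Qed.

Lemma esz_cat A `{Enc A} (s t : seq A) : (esz (s ++ t) <= esz s + esz t)%N.
Proof.
elim: s => [|a s IHs] /=; first by rewrite leq_addl.
by rewrite !esz_cons addSn ltnS -addnA leq_add2l.
Qed.

Lemma size_le_esz A `{Enc A} (s : seq A) : (size s <= esz s)%N.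
Proof.
elim: s => // a s IHs; rewrite esz_cons /= ltnS.
by rewrite (leq_trans IHs) // leq_addl.
Qed.

Lemma esz_seq_le A `{Enc A} (s : seq A) b :
  (forall s1 x s2, s = s1 ++ x :: s2 -> esz x <= b)%N ->
  (esz s <= (size s * b.+1).+1)%N.
Proof.
elim: s => // a s IHs hb; rewrite esz_cons /= mulSn addSn !ltnS -addnS.
apply: leq_add; first exact: (hb [::] a s).
by apply: IHs => s1 x s2 es; apply: (hb (a :: s1) x s2); rewrite es.
Qed.

Lemma esz_mem_cat A `{Enc A} (s1 s2 : seq A) x : (esz x <= esz (s1 ++ x :: s2))%N.
Proof.
elim: s1 => [|a s IHs] /=; first by rewrite esz_cons -addnS leq_addr.
by rewrite esz_cons (leq_trans IHs) // -addSn leq_addl.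
Qed.

(** The base is at least 2, so sums and constants are absorbed by a larger exponent. *)
Definition poly_bounded A `{Enc A} (g : A -> nat) :=
  exists k, forall a, (g a <= (esz a).+1 ^ k)%N.

Section Pbd.
Context A `{Enc A}.
Implicit Types g h : A -> nat.

Lemma pbd_le g h : (forall a, g a <= h a)%N -> poly_bounded h -> poly_bounded g.
Proof. by move=> gh [k hk]; exists k => a; apply: leq_trans (gh a) (hk a). Qed.

Lemma pbd_const c : poly_bounded (fun _ : A => c).
Proof.
exists c => a; apply: leq_trans (ltnW (ssrnat.ltn_expl c (ltnSn 1))) _.
by rewrite leq_expn2 // ltnS esz_gt0.
Qed.

Lemma pbd_esz : poly_bounded (fun a : A => esz a).
Proof. by exists 1%N => a; rewrite expn1. Qed.

Lemma pbd_mul g h : poly_bounded g -> poly_bounded h -> poly_bounded (fun a => g a * h a)%N.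
Proof.
by move=> [k hk] [l hl]; exists (k + l)%N => a; rewrite expnD leq_mul.
Qed.

Lemma pbd_add g h : poly_bounded g -> poly_bounded h -> poly_bounded (fun a => g a + h a)%N.
Proof.
move=> [k hk] [l hl]; exists (k + l).+1 => a; rewrite expnS.
have e1 : (1 < (esz a).+1)%N by rewrite ltnS esz_gt0.
apply: leq_trans (leq_mul e1 (leqnn _)); rewrite mul2n -addnn.
by apply: leq_add; [apply: leq_trans (hk a) _ | apply: leq_trans (hl a) _];
  rewrite leq_exp2l // ?leq_addr ?leq_addl.
Qed.

Lemma pbd_exp g m : poly_bounded g -> poly_bounded (fun a => g a ^ m)%N.
Proof. by move=> [k hk]; exists (k * m)%N => a; rewrite expnM leq_expn2. Qed.

End Pbd.

Lemma pbd_comp A B `{Enc A} `{Enc B} (g : B -> nat) (f : A -> B) :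
  poly_bounded g -> poly_bounded (fun a => esz (f a)) -> poly_bounded (fun a => g (f a)).
Proof.
move=> [k hk] hf.
apply: (@pbd_le _ _ _ (fun a => (esz (f a) + 1) ^ k)%N).
  by move=> a; rewrite addn1.
by apply/pbd_exp/pbd_add/pbd_const.
Qed.

Definition runsle (P : prog) x (T : nat) y :=
  exists2 s, runs (R := R) P x s y & (s <= T)%N.

Lemma runsle_prim o x : runsle (Prim o) x 1 (prim_eval o x).
Proof. by exists 1%N => //; constructor. Qed.

Lemma runsle_seq P Q x y z k l :
  runsle P x k y -> runsle Q y l z -> runsle (Seq P Q) x (k + l).+1 z.
Proof.
move=> [s r hs] [t r' ht]; exists (s + t).+1; first exact: RunSeq r r'.
by rewrite ltnS leq_add.
Qed.

Lemma runsle_pair P Q x y z k l :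
  runsle P x k y -> runsle Q x l z -> runsle (Pair P Q) x (k + l).+1 (Defs.Cons y z).
Proof.
move=> [s r hs] [t r' ht]; exists (s + t).+1; first exact: RunPair r r'.
by rewrite ltnS leq_add.
Qed.

Lemma runsle_if B P Q x b y k l :
  runsle B x k b -> runsle (if is_nil b then Q else P) x l y ->
  runsle (If B P Q) x (k + l).+1 y.
Proof.
move=> [s r hs] [t r' ht]; exists (s + t).+1; first exact: RunIf r r'.
by rewrite ltnS leq_add.
Qed.

Lemma runsle_le P x T T' y : (T <= T')%N -> runsle P x T y -> runsle P x T' y.
Proof. by move=> le [s r hs]; exists s => //; apply: leq_trans le. Qed.

(* Sharing can double the size of a tree in one step, so a polynomial number of
   steps does not bound the size of the output. *)
Definition FP A B `{Enc A} `{Enc B} (f : A -> B) :=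
  exists P T, [/\ poly_bounded T, poly_bounded (fun a => esz (f a)) &
                  forall a, runsle P (enc a) (T a) (enc (f a))].

Lemma fp_runs A B `{Enc A} `{Enc B} (f : A -> B) : FP f ->
  exists P k, forall a, exists2 s, runs P (enc a) s (enc (f a)) & (s <= (esz a).+1 ^ k)%N.
Proof.
case=> P [T [[k hk] _ hr]]; exists P, k => a.
by case: (hr a) => s rs sT; exists s => //; apply: leq_trans (hk a).
Qed.

Lemma fp_size A B `{Enc A} `{Enc B} (f : A -> B) :
  FP f -> poly_bounded (fun a => esz (f a)).
Proof. by case=> P [T []]. Qed.

Lemma fp_ext A B `{Enc A} `{Enc B} (f g : A -> B) : f =1 g -> FP f -> FP g.
Proof.
move=> fg [P [T [hT hs hr]]]; exists P, T; split=> //.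
  by apply: pbd_le hs => a; rewrite fg.
by move=> a; rewrite -fg.
Qed.

Section Basic.
Context A `{Enc A}.

Lemma fp_prim B `{Enc B} (f : A -> B) o :
  (forall a, enc (f a) = prim_eval o (enc a)) ->
  (forall a, esz (f a) <= (esz a).+1)%N -> FP f.
Proof.
move=> hf hs; exists (Prim o), (fun _ => 1%N); split.
- exact: pbd_const.
- by exists 1%N => a; rewrite expn1.
- by move=> a; rewrite hf; apply: runsle_prim.
Qed.

Lemma fp_id : FP (fun a : A => a).
Proof. exact: (fp_prim (o := PId)). Qed.

Lemma fp_nil B `{Enc B} : FP (fun _ : A => [::] : seq B).
Proof. exact: (fp_prim (o := PNil)). Qed.

Lemma fp_tt : FP (fun _ : A => tt).
Proof. exact: (fp_prim (o := PNil)). Qed.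

Lemma fp_false : FP (fun _ : A => false).
Proof. exact: (fp_prim (o := PNil)). Qed.

Lemma fp_0 : FP (fun _ : A => 0%N).
Proof. exact: (fp_prim (o := PNil)). Qed.

Lemma fp_R0 : FP (fun _ : A => 0 : R).
Proof. exact: (fp_prim (o := PZero)). Qed.

Lemma fp_None : FP (fun _ : A => None : option R).
Proof. exact: (fp_prim (o := PNil)). Qed.

End Basic.

Lemma fp_comp A B C `{Enc A} `{Enc B} `{Enc C} (g : B -> C) (f : A -> B) :
  FP g -> FP f -> FP (fun a => g (f a)).
Proof.
move=> [P [T [hT hs hr]]] [P' [T' [hT' hs' hr']]].
exists (Seq P' P), (fun a => (T' a + T (f a)) + 1)%N; split.
- by apply/pbd_add/pbd_const/pbd_add => //; apply: pbd_comp.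
- exact: (pbd_comp hs).
- by move=> a; rewrite addn1; apply: runsle_seq (hr' a) (hr (f a)).
Qed.

Lemma fp_pair A B C `{Enc A} `{Enc B} `{Enc C} (f : A -> B) (g : A -> C) :
  FP f -> FP g -> FP (fun a => (f a, g a)).
Proof.
move=> [P [T [hT hs hr]]] [P' [T' [hT' hs' hr']]].
exists (Pair P P'), (fun a => (T a + T' a) + 1)%N; split.
- by apply/pbd_add/pbd_const/pbd_add.
- apply: (@pbd_le _ _ _ (fun a => esz (f a) + esz (g a) + 1)%N).
    by move=> a; rewrite esz_pair addn1.
  by apply/pbd_add/pbd_const/pbd_add.
- by move=> a; rewrite addn1; apply: runsle_pair (hr a) (hr' a).
Qed.

Lemma fp_fst A B C `{Enc A} `{Enc B} `{Enc C} (f : A -> B * C) :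
  FP f -> FP (fun a => (f a).1).
Proof.
apply: fp_comp; apply: (fp_prim (o := PHead)) => // -[b c].
by rewrite esz_pair /= -!addnS leq_addr.
Qed.

Lemma fp_snd A B C `{Enc A} `{Enc B} `{Enc C} (f : A -> B * C) :
  FP f -> FP (fun a => (f a).2).
Proof.
apply: fp_comp; apply: (fp_prim (o := PTail)) => // -[b c].
by rewrite esz_pair /= -!addSn leq_addl.
Qed.

Lemma fp_cast A B C `{Enc A} `{Enc B} `{Enc C} (f : A -> B) (g : A -> C) :
  (forall a, enc (f a) = enc (g a)) -> FP f -> FP g.
Proof.
move=> e [P [T [hT hs hr]]]; exists P, T; split=> //.
  by apply: pbd_le hs => a; rewrite /esz e.
by move=> a; rewrite -e.
Qed.

Lemma fp_cons A B `{Enc A} `{Enc B} (f : A -> B) (g : A -> seq B) :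
  FP f -> FP g -> FP (fun a => f a :: g a).
Proof. by move=> hf hg; apply: fp_cast (fp_pair hf hg). Qed.

Lemma fp_S A `{Enc A} (f : A -> nat) : FP f -> FP (fun a => (f a).+1).
Proof. by move=> hf; apply: fp_cast (fp_pair (fp_tt (A := A)) hf). Qed.

Lemma fp_true A `{Enc A} : FP (fun _ : A => true).
Proof. exact: fp_cast (fp_pair (fp_tt (A := A)) (fp_tt (A := A))). Qed.

Lemma fp_pred A `{Enc A} (f : A -> nat) : FP f -> FP (fun a => (f a).-1).
Proof.
apply: fp_comp; apply: (fp_prim (o := PTail)) => -[|n] //.
by rewrite !esz_nat /= doubleS !ltnS leqW // leqW.
Qed.

Lemma fp_behead A B `{Enc A} `{Enc B} (f : A -> seq B) :
  FP f -> FP (fun a => behead (f a)).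
Proof.
apply: fp_comp; apply: (fp_prim (o := PTail)) => -[|b s] //=.
by rewrite esz_cons leqW // leqW // leq_addl.
Qed.

Lemma fp_radd A `{Enc A} (f g : A -> R) :
  FP f -> FP g -> FP (fun a => f a + g a).
Proof.
move=> hf hg; have := fp_pair hf hg.
by apply: (@fp_comp _ _ _ _ _ _ (fun p : R * R => p.1 + p.2));
  apply: (fp_prim (o := PAdd)).
Qed.

Lemma fp_rle A `{Enc A} (f g : A -> R) :
  FP f -> FP g -> FP (fun a => f a <= g a).
Proof.
move=> hf hg; have := fp_pair hf hg.
apply: (@fp_comp _ _ _ _ _ _ (fun p : R * R => p.1 <= p.2)).
by apply: (fp_prim (o := PLe)) => // -[x y] /=; case: (x <= y).
Qed.

Lemma fp_test A B D `{Enc A} `{Enc B} `{Enc D} (b : A -> D) (f g h : A -> B) :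
  FP b -> FP f -> FP g ->
  (forall a, h a = if is_nil (enc (b a)) then g a else f a) -> FP h.
Proof.
move=> [P [T [hT hs hr]]] [P' [T' [hT' hs' hr']]] [Q [U [hU hz hq]]] e.
exists (If P P' Q), (fun a => T a + (T' a + U a) + 1)%N; split.
- by apply/pbd_add/pbd_const/pbd_add => //; apply: pbd_add.
- apply: (@pbd_le _ _ _ (fun a => esz (f a) + esz (g a))%N).
    by move=> a; rewrite e; case: ifP; rewrite ?leq_addl ?leq_addr.
  exact: pbd_add.
- move=> a; rewrite addn1; apply: runsle_if (hr a) _; rewrite e.
  by case: ifP => _; [apply: runsle_le (hq a) | apply: runsle_le (hr' a)];
    rewrite ?leq_addl ?leq_addr.
Qed.

Lemma fp_if A B `{Enc A} `{Enc B} (b : A -> bool) (f g : A -> B) :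
  FP b -> FP f -> FP g -> FP (fun a => if b a then f a else g a).
Proof. by move=> hb hf hg; apply: (fp_test hb hf hg) => a; case: (b a). Qed.

Lemma fp_if0 A B `{Enc A} `{Enc B} (b : A -> nat) (f g : A -> B) :
  FP b -> FP f -> FP g -> FP (fun a => if b a == 0%N then g a else f a).
Proof. by move=> hb hf hg; apply: (fp_test hb hf hg) => a; case: (b a). Qed.

(* The branch receives, as [c], the data that was tested; this covers both the
   non-empty lists and the options that are present. *)
Lemma fp_test_dep A B C D `{Enc A} `{Enc B} `{Enc C} `{Enc D} (b : A -> D)
    (g : A * C -> B) (f h : A -> B) :
  FP b -> FP g -> FP f ->
  (forall a, if is_nil (enc (b a)) then h a = f a
             else exists2 c, enc (b a) = enc c & h a = g (a, c)) -> FP h.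
Proof.
move=> [P [T [[k hk] [l hl] hr]]] [P' [T' [[k' hk'] [l' hl'] hr']]].
move=> [Q [U [hU hz hq]]] e.
pose (N := fun a : A => ((esz a + esz (b a)).+2)%N).
have pN : poly_bounded N.
  apply: (@pbd_le _ _ _ (fun a => esz a + esz (b a) + 2)%N).
    by move=> a; rewrite /N addn2.
  by apply/pbd_add/pbd_const/pbd_add; [exact: pbd_esz | exists l].
exists (If P (Seq (Pair (Prim PId) P) P') Q).
exists (fun a => T a + (1 + T a + N a ^ k' + U a + 2) + 1)%N; split.
- apply/pbd_add/pbd_const/pbd_add; first by exists k.
  apply/pbd_add/pbd_const/pbd_add => //; apply/pbd_add; last exact: pbd_exp.
  by apply/pbd_add; [exact: pbd_const | exists k].
- apply: (@pbd_le _ _ _ (fun a => N a ^ l' + esz (f a))%N); last first.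
    by apply: pbd_add => //; apply: pbd_exp.
  move=> a; move: (e a); case: ifP => _ => [->|[c ec ->]]; first exact: leq_addl.
  apply: leq_trans (hl' _) (leq_trans _ (leq_addr _ _)).
  by rewrite leq_expn2 // esz_pair /N [esz c]/esz -ec.
- move=> a; rewrite addn1; apply: runsle_if (hr a) _.
  move: (e a); case: ifP => _ => [->|[c ec ->]].
    by apply: runsle_le (hq a); rewrite addnAC leq_addl.
  apply: (@runsle_le _ _ ((1 + T a).+1 + T' (a, c)).+1).
    have le : (T' (a, c) <= N a ^ k')%N.
      by apply: leq_trans (hk' _) _; rewrite leq_expn2 // esz_pair /N [esz c]/esz -ec.
    lia.
  apply: runsle_seq (hr' (a, c)); apply: runsle_pair; first exact: runsle_prim.
  by rewrite /= -ec; apply: hr.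
Qed.

Lemma fp_case A B C `{Enc A} `{Enc B} `{Enc C} (l : A -> seq C)
    (g : A -> C -> seq C -> B) (f : A -> B) :
  FP l -> FP (fun p : A * (C * seq C) => g p.1 p.2.1 p.2.2) -> FP f ->
  FP (fun a => if l a is c :: s then g a c s else f a).
Proof.
move=> hl hg hf; apply: (fp_test_dep hl hg hf) => a.
by case: (l a) => [|c s] //=; exists (c, s).
Qed.

Lemma fp_case_option A B `{Enc A} `{Enc B} (o : A -> option R)
    (g : A -> R -> B) (f : A -> B) :
  FP o -> FP (fun p : A * R => g p.1 p.2) -> FP f ->
  FP (fun a => if o a is Some c then g a c else f a).
Proof.
move=> ho hg hf; apply: (fp_test_dep ho hg hf) => a.
by case: (o a) => [c|] //=; exists c.
Qed.

Section Fold.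
Context A B C `{Enc A} `{Enc B} `{Enc C}.
Variables (g : A -> B -> C -> B) (i : A -> B) (l : A -> seq C).

(** The loop state consists of the parameter, the accumulator and the remaining list, and the
    remaining list is the loop test. [bound] has to cover the accumulator after every prefix, since
    the time of a round depends on its size. *)
Lemma fp_foldl (bound : A -> nat) :
  FP (fun p : A * B * C => g p.1.1 p.1.2 p.2) -> FP i -> FP l ->
  poly_bounded bound ->
  (forall a s1 s2, l a = s1 ++ s2 -> esz (foldl (g a) (i a) s1) <= bound a)%N ->
  FP (fun a => foldl (g a) (i a) (l a)).
Proof.
move=> [P [T [[k hk] _ hr]]] [P' [T' [hT' _ hr']]] [Q [U [hU hz hq]]] pb hb.
pose (N := fun a : A => (esz a + bound a + esz (l a) + 3)%N).
have pN : poly_bounded N by apply/pbd_add/pbd_const/pbd_add => //; apply/pbd_add/pb/pbd_esz.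
pose acc := Seq (Prim PTail) (Prim PHead).
pose lst := Seq (Prim PTail) (Prim PTail).
pose body := Pair (Prim PHead)
  (Pair (Seq (Pair (Pair (Prim PHead) acc) (Seq lst (Prim PHead))) P)
        (Seq lst (Prim PTail))).
pose (W := fun a : A => (N a ^ k + 30)%N).
have loop a s1 s2 : l a = s1 ++ s2 ->
    runsle (While lst body)
      (enc (a, (foldl (g a) (i a) s1, s2))) ((size s2 * W a) + 5)%N
      (enc (a, (foldl (g a) (i a) (l a), [::] : seq C))).
  elim: s2 s1 => [|c s IHs] s1 e.
    have [r hrr hle] : runsle lst (enc (a, (foldl (g a) (i a) s1, [::] : seq C))) 3 Defs.Nil.
      exact: (runsle_seq (runsle_prim PTail _) (runsle_prim PTail _)).
    exists r.+1; last by rewrite mul0n add0n ltnS (leq_trans hle).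
    by rewrite e cats0; apply: RunWhileStop hrr _.
  set b := foldl (g a) (i a) s1.
  have [r1 hr1 hle1] : runsle lst (enc (a, (b, c :: s))) 3 (enc (c :: s)).
    exact: (runsle_seq (runsle_prim PTail _) (runsle_prim PTail _)).
  have [r2 hr2 hle2] : runsle body (enc (a, (b, c :: s))) (T (a, b, c) + 20)%N
      (enc (a, (g a b c, s))).
    apply: (@runsle_le _ _ (1 + ((((1 + (1 + 1).+1).+1 + ((1 + 1).+1 + 1).+1).+1
        + T (a, b, c)).+1 + ((1 + 1).+1 + 1).+1).+1).+1); first by lia.
    have rl o : runsle (Seq lst (Prim o)) (enc (a, (b, c :: s))) ((1 + 1).+1 + 1).+1
        (prim_eval o (enc (c :: s))).
      by apply: runsle_seq (runsle_prim _ _);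
         apply: runsle_seq (runsle_prim PTail _) (runsle_prim PTail _).
    apply: runsle_pair (runsle_prim _ _) (runsle_pair _ (rl PTail)).
    apply: runsle_seq (hr (a, b, c)); apply: runsle_pair (rl PHead).
    apply: runsle_pair (runsle_prim _ _) _.
    exact: (runsle_seq (runsle_prim PTail _) (runsle_prim PHead _)).
  have [|r3 hr3 hle3] := IHs (rcons s1 c); first by rewrite cat_rcons.
  rewrite foldl_rcons -/b in hr3.
  exists (r1 + r2 + r3).+1; first exact: RunWhileStep hr1 _ hr2 hr3.
  have hT : (T (a, b, c) <= N a ^ k)%N.
    apply: leq_trans (hk _) _; rewrite leq_expn2 // !esz_pair /N.
    have := hb a s1 _ e; have : (esz c <= esz (l a))%N by rewrite e esz_mem_cat.
    by rewrite -/b; lia.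
  by rewrite /= mulSn; move: hle1 hle2 hle3 hT; rewrite /W; lia.
exists (Seq (Pair (Prim PId) (Pair P' Q)) (Seq (While lst body) acc)).
exists (fun a => (1 + (T' a + U a) + (esz (l a) * W a + 5) + 20))%N; split.
- apply/pbd_add/pbd_const/pbd_add.
    by apply/pbd_add; [apply: pbd_const | apply: pbd_add].
  apply/pbd_add/pbd_const/pbd_mul => //.
  by apply/pbd_add/pbd_const/pbd_exp.
- by apply: pbd_le pb => a; apply: (hb a (l a) [::]); rewrite cats0.
- move=> a; apply: (@runsle_le _ _
    ((1 + (T' a + U a).+1).+1 + ((size (l a) * W a + 5) + (1 + 1).+1).+1).+1).
    have hxy : (size (l a) * W a <= esz (l a) * W a)%N by rewrite leq_mul // size_le_esz.
    by move: (size (l a) * W a)%N (esz (l a) * W a)%N hxy => x y hxy; lia.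
  apply: runsle_seq; first apply: runsle_pair (runsle_prim PId _) (runsle_pair (hr' a) (hq a)).
  apply: runsle_seq (loop a [::] (l a) (erefl _)) _.
  exact: (runsle_seq (runsle_prim PTail _) (runsle_prim PHead _)).
Qed.

(** Additive growth, by an amount that does not depend on the accumulator, excludes repeated
    doubling. *)
Lemma fp_foldl_add (q : A -> nat) :
  FP (fun p : A * B * C => g p.1.1 p.1.2 p.2) -> FP i -> FP l -> poly_bounded q ->
  (forall a b c s1 s2, l a = s1 ++ c :: s2 -> esz (g a b c) <= esz b + q a)%N ->
  FP (fun a => foldl (g a) (i a) (l a)).
Proof.
move=> hg hi hl pq hq.
apply: (@fp_foldl (fun a => esz (i a) + esz (l a) * q a)%N) => //.
  by apply/pbd_add/pbd_mul => //; apply: fp_size.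
move=> a s1 s2 e; apply: (@leq_trans (esz (i a) + size s1 * q a)%N); last first.
  rewrite leq_add2l leq_mul // (leq_trans _ (size_le_esz _)) //.
  by rewrite e size_cat leq_addr.
elim/last_ind: s1 s2 e => [|s1 c IHs] s2 e; first by rewrite leq_addr.
rewrite foldl_rcons size_rcons mulSn addnCA addnC; rewrite cat_rcons in e.
by apply: leq_trans (hq a _ c s1 s2 e) _; rewrite leq_add2r (IHs _ e).
Qed.

End Fold.

End PolyTime.
#[export] Hint Mode Enc - ! : typeclass_instances.

Definition pickmin (R : realType) (X : Type) (s : seq (R * X)) : seq (R * X) :=
  foldl (fun acc x => if acc is y :: _ then if y.1 <= x.1 then acc else [:: x]
                      else [:: x]) [::] s.

(** * Programs on lists and unary numbers *)

Section ListProgs.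
Variable R : realType.
Local Notation Enc := (Enc R).
Local Notation esz := (@esz R _ _).
Lemma fp_arg1 A B C `{Enc A} `{Enc B} `{Enc C} (f : A -> C) :
  FP f -> FP (fun p : A * B => f p.1).
Proof.
by move=> hf; apply: (fp_comp (g := f) (f := fun p : A * B => p.1)) => //;
  apply/fp_fst/fp_id.
Qed.

Lemma fp_comp2 Z A B C `{Enc Z} `{Enc A} `{Enc B} `{Enc C} (g : A -> B -> C)
    (u : Z -> A) (v : Z -> B) :
  FP (fun p : A * B => g p.1 p.2) -> FP u -> FP v -> FP (fun z => g (u z) (v z)).
Proof.
move=> hg hu hv.
by apply: (fp_comp (g := fun p : A * B => g p.1 p.2) (f := fun z => (u z, v z))) => //;
  apply: fp_pair.
Qed.

Lemma pbd_in A `{Enc A} B C `{Enc B} `{Enc C} (g : A -> C -> B) (l : A -> seq C) :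
  FP (fun p : A * C => g p.1 p.2) -> FP l ->
  exists2 q : A -> nat, poly_bounded q &
    forall a s1 c s2, l a = s1 ++ c :: s2 -> (esz (g a c) <= q a)%N.
Proof.
move=> /fp_size [k hk] hl; exists (fun a => (esz a + esz (l a) + 2) ^ k)%N.
  by apply/pbd_exp/pbd_add/pbd_const/pbd_add; [exact: pbd_esz | exact: fp_size].
move=> a s1 c s2 e; apply: leq_trans (hk (a, c)) _.
rewrite leq_expn2 // esz_pair.
have : (esz c <= esz (l a))%N by rewrite e esz_mem_cat.
by move=> ?; lia.
Qed.

Lemma fp_and A `{Enc A} (f g : A -> bool) : FP f -> FP g -> FP (fun a => f a && g a).
Proof. by move=> hf hg; rewrite /andb; apply: fp_if => //; apply: fp_false. Qed.

Lemma fp_or A `{Enc A} (f g : A -> bool) : FP f -> FP g -> FP (fun a => f a || g a).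
Proof. by move=> hf hg; rewrite /orb; apply: fp_if => //; apply: fp_true. Qed.

Lemma fp_not A `{Enc A} (f : A -> bool) : FP f -> FP (fun a => ~~ f a).
Proof. by move=> hf; rewrite /negb; apply: fp_if => //; [apply: fp_false | apply: fp_true]. Qed.

Lemma fp_rev A `{Enc A} B `{Enc B} (l : A -> seq B) : FP l -> FP (fun a => rev (l a)).
Proof.
move=> hl; apply: (@fp_ext _ _ _ _ _ (fun a => foldl (fun acc x => x :: acc) [::] (l a))).
  by move=> a; rewrite -[rev _]cats0 -catrevE; elim: (l a) [::] => //=.
apply: (fp_foldl_add (g := fun _ acc x => x :: acc) (q := fun a => (esz (l a)).+1)) => //.
- by apply: fp_cons; [apply/fp_snd/fp_id | apply/fp_snd/fp_fst/fp_id].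
- exact: fp_nil.
- apply: (@pbd_le _ _ _ _ (fun a => esz (l a) + 1)%N) => [a|]; first by rewrite addn1.
  by apply/pbd_add/pbd_const/fp_size.
- move=> a b c s1 s2 e; rewrite esz_cons addnS ltnS addnC leq_add2l.
  by rewrite e esz_mem_cat.
Qed.

Lemma fp_cat A `{Enc A} B `{Enc B} (l1 l2 : A -> seq B) :
  FP l1 -> FP l2 -> FP (fun a => l1 a ++ l2 a).
Proof.
move=> h1 h2.
apply: (@fp_ext _ _ _ _ _ (fun a => foldl (fun acc x => x :: acc) (l2 a) (rev (l1 a)))).
  move=> a; rewrite -{2}[l1 a]revK -catrevE.
  by elim: (rev _) (l2 a) => //=.
have h1r := fp_rev h1.
apply: (fp_foldl_add (g := fun _ acc x => x :: acc) (q := fun a => (esz (rev (l1 a))).+1)) => //.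
- by apply: fp_cons; [apply/fp_snd/fp_id | apply/fp_snd/fp_fst/fp_id].
- apply: (@pbd_le _ _ _ _ (fun a => esz (rev (l1 a)) + 1)%N) => [a|]; first by rewrite addn1.
  by apply/pbd_add/pbd_const/fp_size.
- move=> a b c s1 s2 e; rewrite esz_cons addnS ltnS addnC leq_add2l.
  by rewrite e esz_mem_cat.
Qed.

Lemma fp_map A `{Enc A} B C `{Enc B} `{Enc C} (g : A -> C -> B) (l : A -> seq C) :
  FP (fun p : A * C => g p.1 p.2) -> FP l -> FP (fun a => [seq g a x | x <- l a]).
Proof.
move=> hg hl; have [q pq hq] := pbd_in hg hl.
apply: (@fp_ext _ _ _ _ _
    (fun a => rev (foldl (fun acc x => g a x :: acc) [::] (l a)))).
  move=> a; apply: (can_inj revK); rewrite revK -map_rev -[RHS]cats0.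
  rewrite map_rev -catrevE.
  by elim: (l a) [::] => //= c s IHs acc.
apply: fp_rev.
apply: (fp_foldl_add (g := fun a acc x => g a x :: acc) (q := fun a => q a + 1)%N) => //.
- apply: fp_cons; last by apply/fp_snd/fp_fst/fp_id.
  apply: (fp_comp (g := fun p : A * C => g p.1 p.2) (f := fun p => (p.1.1, p.2))) => //.
  by apply: fp_pair; [apply/fp_fst/fp_fst/fp_id | apply/fp_snd/fp_id].
- exact: fp_nil.
- by apply/pbd_add/pbd_const.
- move=> a b c s1 s2 e; rewrite esz_cons addn1 addnS ltnS addnC leq_add2l.
  exact: hq e.
Qed.

Lemma fp_flatten A `{Enc A} B `{Enc B} (l : A -> seq (seq B)) :
  FP l -> FP (fun a => flatten (l a)).
Proof.
move=> hl; apply: (@fp_ext _ _ _ _ _ (fun a => foldl (fun acc x => acc ++ x) [::] (l a))).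
  move=> a; rewrite -[flatten _]cat0s.
  by elim: (l a) [::] => [|s ss IHs] acc /=; rewrite ?cats0 // IHs catA.
apply: (fp_foldl_add (g := fun _ acc x => acc ++ x) (q := fun a => esz (l a))) => //.
- by apply: fp_cat; [apply/fp_snd/fp_fst/fp_id | apply/fp_snd/fp_id].
- exact: fp_nil.
- exact: fp_size.
- move=> a b c s1 s2 e; apply: leq_trans (esz_cat _ _) _.
  by rewrite leq_add2l e esz_mem_cat.
Qed.

Lemma fp_filter A `{Enc A} B `{Enc B} (p : A -> B -> bool) (l : A -> seq B) :
  FP (fun q : A * B => p q.1 q.2) -> FP l -> FP (fun a => [seq x <- l a | p a x]).
Proof.
move=> hp hl; apply: (@fp_ext _ _ _ _ _
    (fun a => flatten [seq if p a x then [:: x] else [::] | x <- l a])).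
  by move=> a; elim: (l a) => //= x s ->; case: (p a x).
apply/fp_flatten/fp_map => //; apply: fp_if => //; last exact: fp_nil.
by apply: fp_cons; [apply/fp_snd/fp_id | apply: fp_nil].
Qed.

Lemma fp_has A `{Enc A} B `{Enc B} (p : A -> B -> bool) (l : A -> seq B) :
  FP (fun q : A * B => p q.1 q.2) -> FP l -> FP (fun a => has (p a) (l a)).
Proof.
move=> hp hl; apply: (@fp_ext _ _ _ _ _
    (fun a => if [seq x <- l a | p a x] is _ :: _ then true else false)).
  by move=> a /=; elim: (l a) => //= x s; case: (p a x).
by apply: fp_case; [apply: fp_filter | apply: fp_true | apply: fp_false].
Qed.

Lemma fp_all A `{Enc A} B `{Enc B} (p : A -> B -> bool) (l : A -> seq B) :
  FP (fun q : A * B => p q.1 q.2) -> FP l -> FP (fun a => all (p a) (l a)).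
Proof.
move=> hp hl; apply: (@fp_ext _ _ _ _ _ (fun a => ~~ has (predC (p a)) (l a))).
  by move=> a; rewrite has_predC negbK.
by apply: fp_not; apply: fp_has => //; apply: fp_not.
Qed.

Lemma fp_iter A `{Enc A} B `{Enc B} (m : A -> nat) (g : A -> B -> B) (i : A -> B) (bound : A
  -> nat) :
  FP (fun p : A * B => g p.1 p.2) -> FP i -> FP m -> poly_bounded bound ->
  (forall a j, (j <= m a)%N -> (esz (iter j (g a) (i a)) <= bound a)%N) ->
  FP (fun a => iter (m a) (g a) (i a)).
Proof.
move=> hg hi hm pb hb.
have foldE a j : foldl (fun b (_ : unit) => g a b) (i a) (nseq j tt) = iter j (g a) (i a).
  by elim: j (i a) => //= j IHj b; rewrite IHj -iterSr.
apply: (@fp_ext _ _ _ _ _ (fun a => foldl (fun b (_ : unit) => g a b) (i a) (nseq (m a) tt))).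
  by move=> a; rewrite foldE.
apply: (fp_foldl (g := fun a b _ => g a b) (bound := bound)) => //.
- by apply: fp_comp hg _; apply: fp_pair; [apply/fp_fst/fp_fst/fp_id | apply/fp_snd/fp_fst/fp_id].
(* The number of rounds and the list of units have the same encoding. *)
- by apply: fp_cast hm => a; rewrite /enc /enc_nat /enc_seq map_nseq.
- move=> a s1 s2 e.
  have -> : s1 = nseq (size s1) tt by elim: s1 {e} => //= -[] s1 {1}->.
  by rewrite foldE; apply: hb; rewrite -(size_nseq (m a) tt) e size_cat leq_addr.
Qed.

Lemma fp_sub A `{Enc A} (f g : A -> nat) : FP f -> FP g -> FP (fun a => f a - g a)%N.
Proof.
move=> hf hg; have sE a j : iter j predn (f a) = (f a - j)%N.
  by elim: j => [|j /= ->]; rewrite ?subn0 ?subnS.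
apply: (@fp_ext _ _ _ _ _ (fun a => iter (g a) predn (f a))).
  by move=> a; rewrite sE.
apply: (fp_iter (g := fun _ => predn) (bound := fun a => esz (f a))) => //.
- by apply/fp_pred/fp_snd/fp_id.
- exact: fp_size.
- by move=> a j _; rewrite sE !esz_nat ltnS leq_double leq_subr.
Qed.

(** Two truncated subtractions replace the equality test that the language does not offer. *)
Lemma fp_eqn A `{Enc A} (f g : A -> nat) : FP f -> FP g -> FP (fun a => f a == g a).
Proof.
move=> hf hg; apply: (@fp_ext _ _ _ _ _
  (fun a => if (f a - g a)%N == 0%N then
              if (g a - f a)%N == 0%N then true else false else false)).
  move=> a /=; rewrite [RHS]eqn_leq -[(f a <= _)%N]subn_eq0 -[(g a <= _)%N]subn_eq0.
  by do 2!case: (_ == 0)%N.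
apply: fp_if0; first by apply: fp_sub.
  exact: fp_false.
by apply: fp_if0; [apply: fp_sub | exact: fp_false | exact: fp_true].
Qed.

Lemma fp_mem A `{Enc A} (f : A -> nat) (l : A -> seq nat) :
  FP f -> FP l -> FP (fun a => f a \in l a).
Proof.
move=> hf hl; apply: (@fp_ext _ _ _ _ _ (fun a => has (fun x => x == f a) (l a))).
  by move=> a; rewrite has_pred1.
apply: fp_has => //; apply: fp_eqn; first by apply/fp_snd/fp_id.
exact: fp_arg1.
Qed.

Lemma fp_mem2 A `{Enc A} (f : A -> nat * nat) (l : A -> seq (nat * nat)) :
  FP f -> FP l -> FP (fun a => f a \in l a).
Proof.
move=> hf hl; apply: (@fp_ext _ _ _ _ _
    (fun a => has (fun x => (x.1 == (f a).1) && (x.2 == (f a).2)) (l a))).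
  by move=> a; rewrite -[_ \in _]has_pred1; apply: eq_has => -[x y].
have hf1 : FP (fun p : A * (nat * nat) => f p.1) := fp_arg1 hf.
apply: fp_has => //; apply: fp_and; apply: fp_eqn.
- by apply/fp_fst/fp_snd/fp_id.
- by apply: fp_fst; apply: hf1.
- by apply/fp_snd/fp_snd/fp_id.
- by apply: fp_snd; apply: hf1.
Qed.

Lemma fp_nth A `{Enc A} B `{Enc B} (d : A -> B) (s : A -> seq B) (i : A -> nat) :
  FP d -> FP s -> FP i -> FP (fun a => nth (d a) (s a) (i a)).
Proof.
move=> hd hs hi; have dE a j : iter j behead (s a) = drop j (s a).
  by elim: j => [|j /= ->]; rewrite ?drop0 // -drop1 drop_drop.
apply: (@fp_ext _ _ _ _ _
    (fun a => if iter (i a) behead (s a) is x :: _ then x else d a)).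
  by move=> a; rewrite dE -[i a in RHS]addn0 -nth_drop; case: (drop _ _).
apply: fp_case => //; last by apply/fp_fst/fp_snd/fp_id.
apply: (fp_iter (g := fun _ => behead) (bound := fun a => esz (s a))) => //.
- by apply/fp_behead/fp_snd/fp_id.
- exact: fp_size.
- move=> a j _; rewrite dE; elim: j => [|j]; first by rewrite drop0.
  apply: leq_trans; rewrite -addn1 addnC -drop_drop drop1.
  by case: (drop j _) => // b t; rewrite esz_cons leqW // leq_addl.
Qed.

Lemma fp_iota A `{Enc A} (m : A -> nat) : FP m -> FP (fun a => iota 0 (m a)).
Proof.
move=> hm; pose st (p : nat * seq nat) := (p.1.+1, p.1 :: p.2).
have sE j : iter j st (0%N, [::]) = (j, rev (iota 0 j)).
  elim: j => // j IHj; rewrite iterS IHj /st -[in iota _ _.+1]addn1 iotaD rev_cat.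
  by rewrite add0n.
apply: (@fp_ext _ _ _ _ _ (fun a => rev (iter (m a) st (0%N, [::])).2)).
  by move=> a; rewrite sE revK.
apply/fp_rev/fp_snd.
apply: (fp_iter (g := fun _ => st) (bound := fun a =>
  esz (m a) + (esz (m a) * (esz (m a) + 1) + 1) + 1)%N) => //.
- apply: fp_pair; first by apply/fp_S/fp_fst/fp_snd/fp_id.
  by apply: fp_cons; [apply/fp_fst/fp_snd/fp_id | apply/fp_snd/fp_snd/fp_id].
- by apply: fp_pair; [apply: fp_0 | apply: fp_nil].
- have ps := fp_size hm.
  by repeat first [exact: ps | exact: pbd_const | apply: pbd_add | apply: pbd_mul].
- move=> a j hj; rewrite sE esz_pair -addn1 leq_add2r.
  apply: leq_add; first by rewrite !esz_nat ltnS leq_double.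
  apply: leq_trans (esz_seq_le (b := esz (m a)) _) _.
    move=> s1 x s2 e; have : x \in rev (iota 0 j) by rewrite e mem_cat in_cons eqxx orbT.
    rewrite mem_rev mem_iota add0n => /andP[_ xj].
    by rewrite !esz_nat ltnS leq_double (leq_trans (ltnW xj)).
  have hjm : (j <= esz (m a))%N by rewrite esz_nat (leq_trans hj) // leqW // -addnn leq_addl.
  by rewrite size_rev size_iota !addn1 ltnS leq_mul.
Qed.

Lemma fp_pickmin A `{Enc A} B `{Enc B} (l : A -> seq (R * B)) :
  FP l -> FP (fun a => pickmin (l a)).
Proof.
move=> hl; rewrite /pickmin.
pose g (acc : seq (R * B)) (x : R * B) :=
  if acc is y :: _ then if y.1 <= x.1 then acc else [:: x] else [:: x].
apply: (fp_foldl_add (g := fun _ => g) (q := fun a => (esz (l a) + 2)%N)) => //.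
- have hx : FP (fun p : A * seq (R * B) * (R * B) => [:: p.2]).
    by apply: fp_cons; [apply/fp_snd/fp_id | apply: fp_nil].
  apply: fp_case => //; first by apply/fp_snd/fp_fst/fp_id.
  apply: fp_if.
  + apply: fp_rle; first by apply/fp_fst/fp_fst/fp_snd/fp_id.
    by apply/fp_fst/fp_snd/fp_fst/fp_id.
  + by apply/fp_snd/fp_fst/fp_fst/fp_id.
  + by apply: fp_comp hx _; apply/fp_fst/fp_id.
- exact: fp_nil.
- by apply/pbd_add/pbd_const/fp_size.
- move=> a b c s1 s2 e.
  have h1 : (esz c <= esz (l a))%N by rewrite e esz_mem_cat.
  have h2 : (esz [:: c] <= esz (l a) + 2)%N.
    by rewrite esz_cons addnC addn2 ltnS.
  have h3 : (esz [:: c] <= esz b + (esz (l a) + 2))%N by rewrite (leq_trans h2) ?leq_addl.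
  by rewrite /g; case: b h3 => // y t h3; case: ifP => // _; rewrite leq_addr.
Qed.

Lemma fp_sumr A `{Enc A} B `{Enc B} (f : A -> B -> R) (l : A -> seq B) :
  FP (fun p : A * B => f p.1 p.2) -> FP l -> FP (fun a => \sum_(x <- l a) f a x).
Proof.
move=> hf hl; apply: (@fp_ext _ _ _ _ _ (fun a => foldl (fun acc x => acc + f a x) 0 (l a))).
  move=> a; rewrite -[RHS]add0r; move: {1 2}(0 : R) => acc.
  elim: (l a) acc => [|x s IHs] acc /=; first by rewrite big_nil addr0.
  by rewrite big_cons IHs addrA.
apply: (fp_foldl_add (g := fun a acc x => acc + f a x) (q := fun _ => 1%N)) => //.
- apply: fp_radd; first by apply/fp_snd/fp_fst/fp_id.
  by apply: fp_comp2 hf _ _; [apply/fp_fst/fp_fst/fp_id | apply/fp_snd/fp_id].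
- exact: fp_R0.
- exact: pbd_const.
Qed.

End ListProgs.

(** * The algorithm *)

(* Cost, end points and payload.  The payload of a path is its list of edges. *)
Notation gedge R X := (Real.sort R * (nat * nat * X))%type.
Notation edge R := (gedge R unit).

Section Algorithm.
Variable R : realType.
Local Notation gedge X := (gedge R X).
Local Notation edge := (edge R).

Section Gedge.
Context {X : Type}.
Implicit Types (e : gedge X) (L : seq (gedge X)).

Definition src e : nat := e.2.1.1.
Definition dst e : nat := e.2.1.2.
Definition pay e : X := e.2.2.
Definition mkedge (c : R) (u v : nat) (x : X) : gedge X := (c, (u, v, x)).

(** One end of the chosen edge is already in the vertex list, so vertices are repeated; only
    membership matters. *)
Definition prim_step L (st : seq nat * seq (gedge X)) :=
  if pickmin [seq e <- L | (src e \in st.1) (+) (dst e \in st.1)] is e :: _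
  then (src e :: dst e :: st.1, e :: st.2) else st.

Definition prim L (r n : nat) := iter n (prim_step L) ([:: r], [::]).

End Gedge.
Arguments src {X} e.
Arguments dst {X} e.
Arguments pay {X} e.

(** The payload grows at its head and so lists the path backwards; only the connection that its
    edges provide and their cost are used later. *)
Definition join (p : gedge (seq edge)) (e : edge) : gedge (seq edge) :=
  mkedge (p.1 + e.1) (src p) (dst e) (e :: pay p).

Definition extend (E : seq edge) (P : seq (gedge (seq edge))) :=
  P ++ [seq join p e | p <- P, e <- [seq e <- E | dst p == src e]].

(** A round of the Bellman-Ford method for all pairs. Keeping one cheapest path for each pair stops
    the list from growing, and since [extend] contains the old paths no distance increases. *)
Definition relax (E : seq edge) (V : seq nat) (P : seq (gedge (seq edge))) :=
  flatten [seq flatten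
    [seq pickmin [seq p <- extend E P | (src p == u) && (dst p == v)] | v <- V]
    | u <- V].

Definition paths (E : seq edge) (V : seq nat) (n : nat) :=
  iter n (relax E V) [seq mkedge 0 u u [::] | u <- V].

(* The first tree spans the end points of the entries of [L], and only the edges
   of the chosen entries matter for the second one. *)
Definition finish (r n : nat) (Z : seq nat) (L : seq (gedge (seq edge))) :=
  let T := prim (flatten [seq pay e | e <- (prim L r n).2]) r n in
  if all (fun z => z \in T.1) Z then [:: (\sum_(e <- T.2) e.1, T)] else [::].

(** The length is exact; shorter selections are padded by a trivial path at the new terminal and by
    pairs that are no edges. *)
Fixpoint tuples (A : Type) (s : seq A) (m : nat) : seq (seq A) :=
  if m is m'.+1 then [seq x :: w | x <- s, w <- tuples s m'] else [:: [::]].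

Local Notation input := ((seq (seq (option R)) * seq bool) *
   ((seq bool * seq (seq bool)) * (seq (seq (option R)) * seq bool)))%type.

Implicit Type x : input.

Definition in_n x := size x.2.2.2.
Definition in_verts x := iota 0 (in_n x).
Definition in_terms x := [seq u <- in_verts x | nth false x.2.2.2 u].
Definition in_new x :=
  if [seq u <- in_terms x | ~~ nth false x.1.2 u] is t :: _ then t else 0%N.
(** The cost matrix of an instance is symmetric, so every edge appears in both orientations. *)
Definition in_edges x : seq edge :=
  flatten [seq flatten [seq
    (if nth None (nth [::] x.1.1 u) v is Some c then [:: mkedge c u v tt] else [::])
    | v <- in_verts x] | u <- in_verts x].
Definition in_tree x :=
  [seq e <- in_edges x | nth false (nth [::] x.2.1.2 (src e)) (dst e)].
Definition in_pairs x := [seq (u, v) | u <- in_verts x, v <- in_verts x].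
Definition in_paths x := paths (in_edges x) (in_verts x) (in_n x).

Definition mst_cand x :=
  finish (in_new x) (in_n x) (in_terms x)
    [seq p <- in_paths x | (src p \in in_terms x) && (dst p \in in_terms x)].

Definition swap_cand x (A : seq (gedge (seq edge))) (D : seq (nat * nat)) :=
  finish (in_new x) (in_n x) (in_terms x)
    (A ++ [seq mkedge e.1 (src e) (dst e) [:: e]
          | e <- [seq e <- in_tree x | (src e, dst e) \notin D]]).

Definition best a d x :=
  pickmin (mst_cand x ++
    flatten [seq flatten [seq swap_cand x A D | D <- tuples (in_pairs x) d]
            | A <- tuples (in_paths x) a]).

Definition out_tree x (T : seq nat * seq edge) : seq bool * seq (seq bool) :=
  let F := [seq (src e, dst e) | e <- T.2] in
  ([seq u \in T.1 | u <- in_verts x],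
   [seq [seq ((u, v) \in F) || ((v, u) \in F) | v <- in_verts x] | u <- in_verts x]).

Definition algo a d x : seq bool * seq (seq bool) :=
  if best a d x is c :: _ then out_tree x c.2 else ([::], [::]).

End Algorithm.
Arguments src {R X} e.
Arguments dst {R X} e.
Arguments pay {R X} e.

Opaque FP.

(** * Running time of the algorithm *)

Section AlgorithmTime.
Variable R : realType.
Local Notation Enc := (Enc R).
Local Notation esz := (@esz R _ _).
Local Notation gedge X := (gedge R X).
Local Notation edge := (edge R).

Lemma fp_size_seq A B `{Enc A} `{Enc B} (l : A -> seq B) :
  FP l -> FP (fun a => size (l a)).
Proof.
move=> hl; apply: (@fp_ext _ _ _ _ _ (fun a => foldl (fun k (_ : B) => k.+1) 0%N (l a))).
  move=> a; rewrite -[RHS]addn0; elim: (l a) 0%N => //= _ s IHs k.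
  by rewrite IHs addnS.
apply: (fp_foldl_add (g := fun _ k (_ : B) => k.+1) (q := fun _ => 2%N)) => //.
- by apply/fp_S/fp_snd/fp_fst/fp_id.
- exact: fp_0.
- exact: pbd_const.
- by move=> a b c _ _ _; rewrite !esz_nat doubleS addn2.
Qed.

Lemma fp_xor A `{Enc A} (f g : A -> bool) :
  FP f -> FP g -> FP (fun a => f a (+) g a).
Proof.
move=> hf hg; apply: (@fp_ext _ _ _ _ _ (fun a => if f a then ~~ g a else g a)).
  by move=> a; case: (f a).
by apply: fp_if => //; apply: fp_not.
Qed.

Section FPgedge.
Context A X `{Enc A} `{Enc X}.

Lemma fp_src (e : A -> gedge X) : FP e -> FP (fun a => src (e a)).
Proof. by move=> he; apply/fp_fst/fp_fst/fp_snd. Qed.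

Lemma fp_dst (e : A -> gedge X) : FP e -> FP (fun a => dst (e a)).
Proof. by move=> he; apply/fp_snd/fp_fst/fp_snd. Qed.

Lemma fp_pay (e : A -> gedge X) : FP e -> FP (fun a => pay (e a)).
Proof. by move=> he; apply/fp_snd/fp_snd. Qed.

Lemma fp_mkedge (c : A -> R) (u v : A -> nat) (p : A -> X) :
  FP c -> FP u -> FP v -> FP p -> FP (fun a => mkedge (c a) (u a) (v a) (p a)).
Proof. by move=> hc hu hv hp; apply: fp_pair => //; apply: fp_pair => //; apply: fp_pair. Qed.

End FPgedge.

Lemma pickmin_cases X (s : seq (R * X)) :
  pickmin s = [::] \/ exists s1 e s2, s = s1 ++ e :: s2 /\ pickmin s = [:: e].
Proof.
rewrite /pickmin; elim/last_ind: s => [|s e IHs]; first by left.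
right; rewrite foldl_rcons.
case: IHs => [->|[s1 [f [s2 [-> ->]]]]].
  by exists s, e, [::]; rewrite cats1.
case: ifP => _; last by exists (s1 ++ f :: s2), e, [::]; rewrite cats1.
by exists s1, f, (rcons s2 e); rewrite rcons_cat.
Qed.

Ltac fp_hyp :=
  match goal with
  | h : FP ?f |- FP (fun z => ?f (@?u z)) => apply (fp_comp (g := f) (f := u) h)
  end.

Ltac fp_step :=
  lazymatch goal with
  | |- FP id => exact: fp_id
  | |- FP (fun a => a) => exact: fp_id
  | |- FP fst => refine (fp_fst (f := fun a => a) _)
  | |- FP snd => refine (fp_snd (f := fun a => a) _)
  | |- FP (fun _ => [::]) => exact: fp_nil
  | |- FP (fun _ => 0%N) => exact: fp_0
  | |- FP (fun _ => GRing.zero) => exact: fp_R0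
  | |- FP (fun _ => tt) => exact: fp_tt
  | |- FP (fun _ => None) => exact: fp_None
  | |- FP (fun _ => false) => exact: fp_false
  | |- FP (fun a => fst _) => refine (fp_fst _)
  | |- FP (fun a => snd _) => refine (fp_snd _)
  | |- FP (fun a => src _) => refine (fp_src _)
  | |- FP (fun a => dst _) => refine (fp_dst _)
  | |- FP (fun a => pay _) => refine (fp_pay _)
  | |- FP (fun a => mkedge _ _ _ _) => refine (fp_mkedge _ _ _ _)
  | |- FP (fun a => (_, _)) => refine (fp_pair _ _)
  | |- FP (fun a => _ :: _) => refine (fp_cons _ _)
  | |- FP (fun a => _ ++ _) => refine (fp_cat _ _)
  | |- FP (fun a => _ (+) _) => refine (fp_xor _ _)
  | |- FP (fun a => _ && _) => refine (fp_and _ _)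
  | |- FP (fun a => _ || _) => refine (fp_or _ _)
  | |- FP (fun a => ~~ _) => refine (fp_not _)
  | |- FP (fun a => nth _ _ _) => refine (fp_nth _ _ _)
  | |- FP (fun a => _ + _) => refine (fp_radd _ _)
  | |- FP (fun a => (_, _) \in _) => refine (fp_mem2 _ _)
  | |- FP (fun a => _ \in _) => refine (fp_mem _ _)
  | |- FP (fun a => _ == _) => refine (fp_eqn _ _)
  end.

Ltac fp := repeat first [ assumption | fp_hyp | fp_step ].

Lemma esz_filter B `{Enc B} (p : B -> bool) (s : seq B) :
  (esz (filter p s) <= esz s)%N.
Proof.
elim: s => //= b s IHs; rewrite esz_cons; case: (p b);
  last by rewrite leqW // (leq_trans IHs) // leq_addl.
by rewrite esz_cons ltnS leq_add2l.
Qed.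

Lemma fp_prim_tree A X `{Enc A} `{Enc X} (L : A -> seq (gedge X)) (r n : A -> nat) :
  FP L -> FP r -> FP n -> FP (fun a => prim (L a) (r a) (n a)).
Proof.
move=> hL hr hn.
(* A round adds at most one entry of the list and the names of its two ends, whence the term
   [2 * esz (L a) + 5]. *)
apply: (fp_iter (g := fun a => prim_step (L a)) (bound := fun a =>
  ((esz (r a) + 4) + esz (n a) * (2 * esz (L a) + 5))%N)) => //.
- rewrite /prim_step; apply: fp_case.
  + apply: fp_pickmin; apply: fp_filter; last by apply: fp_arg1.
    apply: fp_xor; apply: fp_mem;
    by repeat first [exact: fp_id | apply: fp_fst | apply: fp_src | apply: fp_dst | apply:
      fp_snd].
  + apply: fp_pair; repeat first [exact: fp_id | apply: fp_cons | apply: fp_src | apply: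
    fp_dst |apply: fp_fst | apply: fp_snd].
  + by apply/fp_snd/fp_id.
- apply: fp_pair; last exact: fp_nil.
  by apply: fp_cons => //; apply: fp_nil.
- have pL := fp_size hL; have pr := fp_size hr; have pn := fp_size hn.
  by repeat first [done | exact: pbd_const | apply: pbd_add | apply: pbd_mul].
- move=> a j hj; apply: (@leq_trans (esz (r a) + 4 + j * (2 * esz (L a) + 5))%N); last first.
    by rewrite leq_add2l leq_mul // (leq_trans hj) // esz_nat leqW // -addnn leq_addl.
  elim: j {hj} => [|j IHj]; first by rewrite mul0n addn0 esz_pair esz_cons !esz_nil; lia.
  rewrite iterS {1}/prim_step.
  set S := [seq _ <- _ | _].
  case: (pickmin_cases S) => [->|[s1 [e [s2 [es ->]]]]].
    by apply: leq_trans IHj _; rewrite leq_add2l leq_mul.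
  have : (esz e <= esz (L a))%N.
    apply: (@leq_trans (esz S)); first by rewrite es; apply: esz_mem_cat.
    exact: esz_filter.
  case: (iter j _ _) IHj {es} => C F IHj he.
  rewrite !esz_pair !esz_cons /= in IHj *.
  have e1 : (esz (src e) + esz (dst e) < esz e)%N.
    by case: e {he} => c [[u v] y]; rewrite !esz_pair /src /dst /=; lia.
  by rewrite mulSn; lia.
Qed.

Lemma size_flatten_le (B C : eqType) (f : B -> seq C) s b :
  (forall x, x \in s -> size (f x) <= b)%N ->
  (size (flatten [seq f x | x <- s]) <= size s * b)%N.
Proof.
elim: s => //= x s IHs h; rewrite size_cat mulSn leq_add ?h ?mem_head //.
by apply: IHs => y ys; rewrite h // in_cons ys orbT.
Qed.

Lemma esz_mem (B : eqType) `{Enc B} (s : seq B) y : y \in s -> (esz y <= esz s)%N.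
Proof. by case/splitPr=> s1 s2; apply: esz_mem_cat. Qed.

Lemma mem_pickmin (X : eqType) (s : seq (R * X)) e : e \in pickmin s -> e \in s.
Proof.
by case: (pickmin_cases s) => [->//|[s1 [f [s2 [-> ->]]]]]; rewrite inE mem_cat => /eqP->;
  rewrite mem_head orbT.
Qed.

Lemma mem_relax (E : seq edge) V P p : p \in relax E V P ->
  p \in P \/ exists q e, [/\ q \in P, e \in E, dst q = src e & p = join q e].
Proof.
case/flattenP=> _ /mapP[u _ ->] /flattenP[_ /mapP[v _ ->]] /mem_pickmin.
rewrite mem_filter mem_cat => /andP[_ /orP[|]]; first by left.
case/allpairsPdep=> q [e [hq]]; rewrite mem_filter => /andP[/eqP qe he] ->.
by right; exists q, e.
Qed.

Lemma fp_paths A `{Enc A} (E : A -> seq edge) (V : A -> seq nat) (n : A -> nat) :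
  FP E -> FP V -> FP n -> FP (fun a => paths (E a) (V a) (n a)).
Proof.
move=> hE hV hn.
(* [len] bounds the number of stored paths, at most one for each pair of vertices after the first
   round; [wid] bounds the size of a single path, which gains at most one edge in each round. *)
pose (len := fun a : A => (esz (V a) * esz (V a) + esz (V a))%N).
pose (wid := fun a : A => (esz (V a) * 2 + 10 + esz (n a) * (2 * esz (E a) + 10))%N).
apply: (fp_iter (g := fun a => relax (E a) (V a)) (bound := fun a =>
  (len a * (wid a + 1) + 1)%N)) => //.
- have hQ : FP (fun q : A * seq (gedge (seq edge)) => extend (E q.1) q.2).
    apply: fp_cat; first by apply/fp_snd/fp_id.
    apply: fp_flatten; apply: fp_map; last by apply/fp_snd/fp_id.
    apply: fp_map; first by rewrite /join; fp.
    by apply: fp_filter; fp.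
  apply: fp_flatten; apply: fp_map; last by fp.
  apply: fp_flatten; apply: fp_map; last by fp.
  apply: fp_pickmin; apply: fp_filter; first by fp.
  by apply: (fp_comp2 (g := fun a b => extend (E a) b) hQ); fp.
- by apply: (fp_map (g := fun _ u => mkedge 0 u u [::])) => //; fp.
- have pE := fp_size hE; have pV := fp_size hV; have pn := fp_size hn.
  by rewrite /len /wid; repeat first [done | exact: pbd_const | apply: pbd_add | apply: pbd_mul].
- move=> a j hj.
  set P0 := [seq mkedge _ _ _ _ | u <- _].
  have szP : (size (iter j (relax (E a) (V a)) P0) <= len a)%N.
    have hV1 : (size (V a) <= esz (V a))%N by apply: size_le_esz.
    case: j {hj} => [|j] /=; first by rewrite size_map (leq_trans hV1) // leq_addl.
    apply: leq_trans (leq_addr _ _).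
    apply: leq_trans (size_flatten_le (b := esz (V a)) _) _; last by rewrite leq_mul.
    move=> u _; apply: leq_trans (size_flatten_le (b := 1) _) _; last by rewrite muln1.
    move=> v _; set S := [seq _ <- _ | _].
    by case: (pickmin_cases S) => [->//|[s1 [f [s2 [_ ->]]]]].
  have wP p : p \in iter j (relax (E a) (V a)) P0 ->
      (esz p <= esz (V a) * 2 + 10 + j * (2 * esz (E a) + 10))%N.
    elim: j {hj szP} p => [|j IHj] p /=.
      case/mapP=> u uV ->; have uz : (esz u <= esz (V a))%N by apply: esz_mem.
      move: uz => /=; rewrite /mkedge !esz_pair !esz_nil !esz_real mul0n. lia.
    case/mem_relax => [/IHj h|[q [e [/IHj hq eE _ ->]]]].
      by rewrite (leq_trans h) // leq_add2l leq_mul.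
    have he : (esz e <= esz (E a))%N by apply: esz_mem.
    case: q hq => c [[u v] y] hq; case: e {eE} he => d [[w z] []] he.
    move: hq he => /=; rewrite /join /mkedge !esz_pair !esz_cons /src /dst /pay /= !esz_pair.
    rewrite !esz_real mulSn; lia.
  rewrite addn1 /=; apply: leq_trans (esz_seq_le (b := wid a) _) _.
    move=> s1 p s2 es; apply: leq_trans (wP p _) _; first by rewrite es mem_cat mem_head orbT.
    by rewrite leq_add2l leq_mul // (leq_trans hj) // esz_nat leqW // -addnn leq_addl.
  by rewrite ltnS addn1 leq_mul.
Qed.

Lemma fp_finish A `{Enc A} (r n : A -> nat) (Z : A -> seq nat)
    (L : A -> seq (gedge (seq edge))) :
  FP r -> FP n -> FP Z -> FP L -> FP (fun a => finish (r a) (n a) (Z a) (L a)).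
Proof.
move=> hr hn hZ hL.
pose (T := fun a : A =>
  prim (flatten [seq pay e | e <- (prim (L a) (r a) (n a)).2]) (r a) (n a)).
have hT : FP T.
  apply: fp_prim_tree => //; apply: fp_flatten; apply: fp_map; first by fp.
  by apply: fp_snd; apply: fp_prim_tree.
rewrite /finish -/T; apply: fp_if; last by fp.
  by apply: (fp_all (p := fun a z => z \in (T a).1)) => //; fp.
apply: fp_cons; last by fp.
apply: fp_pair => //; apply: fp_sumr; last by fp.
by fp.
Qed.

Lemma fp_tuples A B `{Enc A} `{Enc B} (s : A -> seq B) m :
  FP s -> FP (fun a => tuples (s a) m).
Proof.
move=> hs; elim: m => [|m IHm] /=; first by fp.
apply: fp_flatten; apply: fp_map => //; apply: fp_map; first by fp.
exact: (fp_arg1 (f := fun a => tuples (s a) m)).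
Qed.

Lemma fp_in_n : FP (@in_n R).
Proof. by apply: fp_size_seq; fp. Qed.

Lemma fp_in_verts : FP (@in_verts R).
Proof. by apply: fp_iota; apply: fp_in_n. Qed.

Lemma fp_in_terms : FP (@in_terms R).
Proof. by apply: fp_filter; [fp | exact: fp_in_verts]. Qed.

Lemma fp_in_new : FP (@in_new R).
Proof.
apply: fp_case; last by fp.
  by apply: fp_filter; [fp | exact: fp_in_terms].
by fp.
Qed.

Lemma fp_in_edges : FP (@in_edges R).
Proof.
have hV := fp_in_verts.
apply: fp_flatten; apply: fp_map; last by fp.
apply: fp_flatten; apply: fp_map; last by fp.
apply: fp_case_option; last by fp.
  by fp.
by fp; exact: fp_tt.
Qed.

Lemma fp_in_tree : FP (@in_tree R).
Proof. by apply: fp_filter; [fp | exact: fp_in_edges]. Qed.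

Lemma fp_in_pairs : FP (@in_pairs R).
Proof.
have hV := fp_in_verts.
by apply: fp_flatten; apply: fp_map => //; apply: fp_map; fp.
Qed.

Lemma fp_in_paths : FP (@in_paths R).
Proof. by apply: fp_paths; [exact: fp_in_edges | exact: fp_in_verts | exact: fp_in_n]. Qed.

Lemma fp_mst_cand : FP (@mst_cand R).
Proof.
have hT := fp_in_terms.
apply: fp_finish => //; [exact: fp_in_new | exact: fp_in_n |].
by apply: fp_filter; [fp | exact: fp_in_paths].
Qed.

Lemma fp_best a d : FP (@best R a d).
Proof.
have hT := fp_in_terms; have hn := fp_in_n; have ht := fp_in_new.
have hs := fp_in_tree; have hp := fp_in_paths; have hq := fp_in_pairs.
apply: fp_pickmin; apply: fp_cat; first exact: fp_mst_cand.
apply: fp_flatten; apply: fp_map; last exact: fp_tuples.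
apply: fp_flatten; apply: fp_map; last first.
  by apply: (fp_arg1 (f := fun x => tuples (in_pairs x) d)); apply: fp_tuples.
apply: fp_finish; [fp | fp | fp |].
apply: fp_cat; first by fp.
apply: fp_map; first by fp.
by apply: fp_filter; [fp | fp].
Qed.

Lemma fp_ends B `{Enc B} (F : B -> seq edge) :
  FP F -> FP (fun b => [seq (src e, dst e) | e <- F b]).
Proof. by move=> hF; apply: fp_map; fp. Qed.

Lemma fp_algo a d : FP (@algo R a d).
Proof.
have hV := fp_in_verts.
apply: fp_case; [exact: fp_best | | by fp].
apply: fp_pair; first by apply: fp_map; fp.
apply: fp_map; last by fp.
apply: fp_map; last by fp.
by apply: fp_or; apply: fp_mem2; fp; apply: fp_ends; fp.
Qed.

End AlgorithmTime.

(** * Minimum spanning trees and shortest paths *)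

Notation con := (clos_refl_sym_trans nat).

Section Connectivity.
Implicit Types (E : nat -> nat -> Prop) (P : nat -> Prop).

Lemma con_sub E E' x y : (forall a b, E a b -> con E' a b) -> con E x y -> con E' x y.
Proof.
move=> h; elim=> {x y} [x y /h//|x|x y _|x y z _ h1 _ h2]; first exact: rst_refl.
  exact: rst_sym.
exact: rst_trans h1 h2.
Qed.

(** Used in place of induction along a path: [P] is chosen as one side of a cut, and single steps
    are inspected. *)
Lemma con_closed E P x y :
  (forall a b, E a b -> (P a <-> P b)) -> con E x y -> P x -> P y.
Proof.
move=> h; suff: con E x y -> (P x <-> P y) by move=> hc /hc[].
by elim=> {x y} [x y /h//|x//|x y _ []//|x y z _ h1 _ h2]; split; move/h1/h2 || move/h2/h1.
Qed.

Lemma con_mono E E' x y : (forall a b, E a b -> E' a b) -> con E x y -> con E' x y.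
Proof. by move=> h; apply: con_sub => a b /h; apply: rst_step. Qed.

End Connectivity.

Section Edges.
Variable R : realType.
Local Notation gedge X := (gedge R X).
Local Notation edge := (edge R).

Section Lists.
Variable X : eqType.
Implicit Types (L F : seq (gedge X)) (e : gedge X).

Definition lrel L (x y : nat) : Prop :=
  exists2 e, e \in L & src e = x /\ dst e = y.

Definition lcon L := con (lrel L).

Definition lcost L : R := \sum_(e <- L) e.1.

Lemma lcon_edge L e : e \in L -> lcon L (src e) (dst e).
Proof. by move=> eL; apply: rst_step; exists e. Qed.

Lemma lcon_sub L F x y : {subset L <= F} -> lcon L x y -> lcon F x y.
Proof. by move=> s; apply: con_mono => a b [e /s eF h]; exists e. Qed.

Lemma lcost_cons e L : lcost (e :: L) = e.1 + lcost L.
Proof. by rewrite /lcost big_cons. Qed.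

Lemma lcost_nil : lcost [::] = 0.
Proof. by rewrite /lcost big_nil. Qed.

Lemma lcost_cat L F : lcost (L ++ F) = lcost L + lcost F.
Proof. by rewrite /lcost big_cat. Qed.

Lemma lcost_ge0 L : (forall e, e \in L -> 0 <= e.1) -> 0 <= lcost L.
Proof. by move=> h; rewrite /lcost big_seq sumr_ge0. Qed.

Lemma perm_lcost L F : perm_eq L F -> lcost L = lcost F.
Proof. exact: perm_big. Qed.

Lemma pickminP (s : seq (R * X)) :
  (s = [::] /\ pickmin s = [::]) \/
  exists y, [/\ pickmin s = [:: y], y \in s & forall z, z \in s -> y.1 <= z.1].
Proof.
rewrite /pickmin; elim/last_ind: s => [|s y IHs]; first by left.
right; rewrite foldl_rcons.
case: IHs => [[-> ->]|[f [-> fs fmin]]].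
  by exists y; split=> //; [rewrite mem_head | move=> f; rewrite inE => /eqP->].
case: leP => ef; [exists f | exists y]; split=> //;
  rewrite ?mem_rcons ?in_cons ?fs ?eqxx ?orbT //;
  move=> g; rewrite mem_rcons inE => /orP[/eqP->|/fmin] //.
by move/(le_trans (ltW ef)).
Qed.

End Lists.

(** * Prim's algorithm *)

Section Prim.
Variables (X : eqType) (L : seq (gedge X)) (r : nat).

Inductive ptree : seq nat -> seq (gedge X) -> Prop :=
  | ptree_root : ptree [:: r] [::]
  | ptree_grow C F e : ptree C F -> (src e \in C) (+) (dst e \in C) ->
      ptree (src e :: dst e :: C) (e :: F).

Lemma ptree_lcon C F x : ptree C F -> x \in C -> lcon F r x.
Proof.
move=> h; elim: h x => {C F} [|C F e _ IHC exC] x.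
  by rewrite inE => /eqP->; apply: rst_refl.
have sF : {subset F <= e :: F} by move=> f fF; rewrite inE fF orbT.
have he : lcon (e :: F) (src e) (dst e) by apply: lcon_edge; rewrite mem_head.
have hin y : y \in C -> lcon (e :: F) r y by move=> /IHC; apply: lcon_sub.
have [hs hd] : lcon (e :: F) r (src e) /\ lcon (e :: F) r (dst e).
  case: (boolP (src e \in C)) exC => [/hin sC _|_ /= /hin dC]; split=> //.
    exact: rst_trans sC he.
  exact: rst_trans dC (rst_sym _ _ _ _ he).
by rewrite !inE => /or3P[/eqP->|/eqP->|/hin].
Qed.

Lemma ptree_root_in C F : ptree C F -> r \in C.
Proof. by elim=> [|{}C {}F e _ rC _]; rewrite !inE ?eqxx // rC !orbT. Qed.

Definition pstate k := iter k (prim_step L) ([:: r], [::]).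

Lemma pstateS k :
  ((forall e, e \in L -> (src e \in (pstate k).1) = (dst e \in (pstate k).1)) /\
   pstate k.+1 = pstate k) \/
  exists e, [/\ e \in L, (src e \in (pstate k).1) (+) (dst e \in (pstate k).1),
    forall f, f \in L -> (src f \in (pstate k).1) (+) (dst f \in (pstate k).1) ->
              e.1 <= f.1 &
    pstate k.+1 = (src e :: dst e :: (pstate k).1, e :: (pstate k).2)].
Proof.
rewrite (_ : pstate k.+1 = prim_step L (pstate k)) // /prim_step.
set S := [seq _ <- _ | _].
case: (pickminP S) => [[es ->]|[e [-> ein emin]]]; [left | right].
  split=> // e eL.
  have := in_nil e; rewrite -es mem_filter eL andbT.
  by case: (_ \in _); case: (_ \in _).
move: ein; rewrite mem_filter => /andP[ex eL]; exists e; split=> // f fL fx.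
by apply: emin; rewrite mem_filter fx.
Qed.

Lemma pstate_ptree k : ptree (pstate k).1 (pstate k).2 /\ {subset (pstate k).2 <= L}.
Proof.
elim: k => [|k [hp hL]]; first by split=> //; apply: ptree_root.
case: (pstateS k) => [[_ ->]|[e [eL ex _ ->]]] //; split; first exact: ptree_grow.
by move=> f; rewrite inE => /orP[/eqP->|/hL].
Qed.

Lemma pstate_closed n : (r < n)%N ->
  (forall e, e \in L -> (src e < n)%N && (dst e < n)%N) ->
  forall e, e \in L -> (src e \in (pstate n).1) = (dst e \in (pstate n).1).
Proof.
move=> rn Ln.
have closedS k : (forall e, e \in L -> (src e \in (pstate k).1) = (dst e \in (pstate k).1)) ->
    pstate k.+1 = pstate k.
  by move=> h; case: (pstateS k) => [[]//|[e [eL]]]; rewrite h // addbb.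
(* As long as some edge leaves the tree, each step adds a new vertex, and there are only [n] of
   them. *)
have step k : (forall e, e \in L -> (src e \in (pstate k).1) = (dst e \in (pstate k).1)) \/
    (k < size (undup (pstate k).1))%N.
  elim: k => [|k IHk]; first by right.
  case: (pstateS k) => [[h e]|[e [eL ex _ es]]]; first by left; rewrite e.
  case: IHk => [h|hk]; first by left; rewrite (closedS k h).
  right; rewrite es; set C := (pstate k).1 in ex hk *.
  have [y yC yC'] : exists2 y, y \notin C & y \in src e :: dst e :: C.
    case: (boolP (src e \in C)) ex => sC /= dC; [exists (dst e) | exists (src e)] => //;
    by rewrite !inE eqxx ?orbT.
  apply: (@leq_trans (size (y :: undup C))) => //; apply: uniq_leq_size.
    by rewrite /= mem_undup yC undup_uniq.
  move=> z; rewrite mem_undup inE mem_undup => /orP[/eqP->//|zC].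
  by rewrite !inE zC !orbT.
have bnd k x : x \in (pstate k).1 -> (x < n)%N.
  elim: k x => [|k IHk] x; first by rewrite /pstate /= inE => /eqP->.
  case: (pstateS k) => [[_ ->]|[e [eL _ _ ->]]]; first exact: IHk.
  by have /andP[sn dn] := Ln e eL; rewrite !inE => /or3P[/eqP->|/eqP->|/IHk].
case: (step n) => // hn; exfalso.
have : (size (undup (pstate n).1) <= size (iota 0 n))%N.
  by apply: uniq_leq_size (undup_uniq _) _ => x; rewrite mem_undup mem_iota => /bnd.
by rewrite size_iota leqNgt hn.
Qed.

Lemma prim_reach n x : (r < n)%N ->
  (forall e, e \in L -> (src e < n)%N && (dst e < n)%N) ->
  lcon L r x -> x \in (prim L r n).1.
Proof.
move=> rn Ln rx; apply: (con_closed (P := fun x => x \in (prim L r n).1) _ rx).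
  by move=> _ _ [e eL [<- <-]]; have := pstate_closed rn Ln eL;
    rewrite /pstate -/(prim L r n) => ->.
by have [hp _] := pstate_ptree n; apply: ptree_root_in hp.
Qed.

(* The exchange argument for minimum spanning trees, with the part [C] that is
   already covered contracted to a point. *)
Lemma prim_le k (F : seq (gedge X)) :
  (forall e, e \in L -> 0 <= e.1) ->
  {subset F <= L} -> (forall x, lcon L r x -> lcon F r x) ->
  lcost (pstate k).2 <= lcost F.
Proof.
move=> L0 FL FL'.
pose rel (C : seq nat) (F : seq (gedge X)) x y := lrel F x y \/ (x \in C /\ y \in C).
(* [Fk] is what remains of [F] when each chosen edge has replaced an edge that is at least as
   expensive. *)
suff: exists2 Fk : seq (gedge X), {subset Fk <= L} & lcost (pstate k).2 + lcost Fk <= lcost F /\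
    forall x, lcon L r x -> con (rel (pstate k).1 Fk) r x.
  case=> Fk FkL [le _]; apply: le_trans le; rewrite lerDl.
  by apply: lcost_ge0 => e /FkL/L0.
elim: k => [|k [Fk FkL [le hcon]]].
  exists F => //; split=> [|x /FL']; first by rewrite {1}/lcost big_nil add0r.
  by apply: con_mono => a b; left.
case: (pstateS k) => [[_ ->]|[e [eL ex emin ->]]]; first by exists Fk.
have [hp hL] := pstate_ptree k.
set C := (pstate k).1 in hcon ex emin hp *; set T := (pstate k).2 in le hp hL *.
have rC : r \in C := ptree_root_in hp.
have reach x : x \in C -> lcon L r x by move=> /(ptree_lcon hp); apply: lcon_sub.
pose v := if src e \in C then dst e else src e.
have vC : v \notin C by rewrite /v; case: ifP ex => //= ->.
have rv : lcon L r v.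
  have he := lcon_edge eL; rewrite /v; case: ifP ex => /= [/reach h _|_ /reach h].
    exact: rst_trans h he.
  exact: rst_trans h (rst_sym _ _ _ _ he).
(* [W] is what is reached from the new vertex [v] without touching [C]. Some [f] of [Fk] joins [W]
   to [C], for otherwise [v] would be cut off from the root; this [f] is given up in exchange for
   [e]. *)
pose N a b := exists2 f, f \in Fk & [/\ src f = a, dst f = b, a \notin C & b \notin C].
pose W y := con N y v.
have WC y : W y -> y \notin C.
  move=> yv.
  apply: (con_closed (P := fun y => y \notin C) _ (rst_sym _ _ _ _ yv) vC).
  by move=> a b [f _ [_ _ aC bC]]; split.
have [f fF [x [y [xC yW fxy]]]] : exists2 f, f \in Fk & exists x y, [/\ x \in C, W y &
    (src f = x /\ dst f = y) \/ (src f = y /\ dst f = x)].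
  case: (pselect (exists2 f, f \in Fk & exists x y, [/\ x \in C, W y &
    (src f = x /\ dst f = y) \/ (src f = y /\ dst f = x)])) => // nf; exfalso.
  have vr : con (rel C Fk) v r by apply/rst_sym/hcon.
  suff : W r by move/WC; rewrite rC.
  apply: (con_closed (P := W) _ vr); last exact: rst_refl.
  have side a b : lrel Fk a b -> (a \in C) = false -> (b \in C) = false -> W a <-> W b.
    move=> [f fF [sf df]] /negbT aC /negbT bC.
    have nab : con N a b by apply: rst_step; exists f.
    by split=> [h|]; [apply: rst_trans h; apply: rst_sym | apply: rst_trans].
  move=> a b [ab|[aC bC]]; last by split=> /WC; rewrite ?aC ?bC.
  have [f fF [sf df]] := ab.
  case aC: (a \in C); case bC: (b \in C); last exact: side.
  - by split=> /WC; rewrite ?aC ?bC.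
  - split=> [/WC|bW]; first by rewrite aC.
    by case: nf; exists f => //; exists a, b; split=> //; left.
  - split=> [aW|/WC]; last by rewrite bC.
    by case: nf; exists f => //; exists b, a; split=> //; right.
exists (rem f Fk); first by move=> g /mem_rem/FkL.
have perm := perm_to_rem fF.
have yC := WC _ yW.
have fx : (src f \in C) (+) (dst f \in C).
  by case: fxy => -[-> ->]; rewrite xC (negbTE yC).
split.
  have := emin f (FkL _ fF) fx.
  by move: le; rewrite lcost_cons (perm_lcost perm) lcost_cons; lra.
move=> z /hcon; apply: con_sub => a b [[g gF [sg dg]]|[aC bC]]; last first.
  by apply: rst_step; right; rewrite !inE aC bC !orbT.
have inC' u : u \in C -> u \in src e :: dst e :: C by move=> uC; rewrite !inE uC !orbT.
have vC' : v \in src e :: dst e :: C by rewrite /v; case: ifP; rewrite !inE eqxx ?orbT.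
(* The link from [y] to [v] stays outside [C] and hence avoids [f]; as [v] now belongs to the
   contracted part, the ends of [f] remain connected. *)
have yv : con (rel (src e :: dst e :: C) (rem f Fk)) y v.
  apply: con_mono yW => c d [h hF [sh dh cC dC]]; left; exists h => //.
  move: hF; rewrite (perm_mem perm) inE => /orP[/eqP hf|//].
  by case: fxy => -[ssf ddf]; move: cC dC; rewrite -sh -dh hf ssf ddf xC.
have xy : con (rel (src e :: dst e :: C) (rem f Fk)) x y.
  apply: rst_trans (rst_sym _ _ _ _ yv); apply: rst_step; right; split=> //.
  exact: inC'.
move: gF; rewrite (perm_mem perm) inE => /orP[/eqP gf|gF]; last first.
  by apply: rst_step; left; exists g.
rewrite -sg -dg gf; case: fxy => -[-> ->] //.
exact: rst_sym.
Qed.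

End Prim.

(** * Walks and shortest paths *)

Fixpoint walk (u : nat) (w : seq edge) (v : nat) : bool :=
  if w is e :: w' then (src e == u) && walk (dst e) w' v else u == v.

Lemma walk_cat u w w' v : walk u (w ++ w') v ->
  exists2 x, walk u w x & walk x w' v.
Proof.
elim: w u => [|e w IHw] u /=; first by exists u.
by case/andP=> -> /IHw[x ? ?]; exists x.
Qed.

Lemma cat_walk u w w' x v : walk u w x -> walk x w' v -> walk u (w ++ w') v.
Proof. by elim: w u => [|e w IHw] u /= => [/eqP->//|/andP[-> /IHw h]]. Qed.

Lemma walk_lcon u w v : walk u w v -> lcon w u v.
Proof.
elim: w u => [|e w IHw] u /= => [/eqP->|/andP[/eqP<- /IHw h]]; first exact: rst_refl.
apply: rst_trans (lcon_edge (mem_head e w)) _; apply: lcon_sub h => f fw.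
by rewrite inE fw orbT.
Qed.

(** Closed parts can be cut out because costs are nonnegative. Distinct vertices bound the number of
    edges, so [n] rounds of [relax] suffice. *)
Lemma walk_shorten u w v :
  (forall e, e \in w -> 0 <= e.1) -> walk u w v ->
  exists w', [/\ walk u w' v, {subset w' <= w}, lcost w' <= lcost w
               & uniq (u :: map dst w')].
Proof.
elim: w u => [|e w IHw] u w0 /=; first by move=> h; exists [::].
case/andP=> /eqP eu /IHw [|w1 [h1 s1 c1 u1]].
  by move=> f fw; apply: w0; rewrite inE fw orbT.
have s1' : {subset e :: w1 <= e :: w}.
  by move=> f; rewrite !inE => /orP[->//|/s1->]; rewrite orbT.
have c1' : lcost (e :: w1) <= lcost (e :: w) by rewrite !lcost_cons lerD2l.
have h1' : walk u (e :: w1) v by rewrite /= eu eqxx.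
have u1' : uniq (map dst (e :: w1)) by [].
case: (boolP (u \in map dst (e :: w1))) => [/mapP[f fw uf]|uw]; last first.
  by exists (e :: w1); split=> //; rewrite cons_uniq uw.
have w10 g : g \in e :: w1 -> 0 <= g.1 by move/s1'/w0.
(* The start is visited again, and everything before that visit is dropped. *)
case/splitPr: fw h1' s1' c1' w10 u1' => a b.
rewrite -cat_rcons => /walk_cat[x xa xb] s1' c1' w10.
rewrite cat_rcons map_cat cat_uniq => /and3P[_ _ ub].
have xu : x = u by move: xa; rewrite -cats1 => /walk_cat[y _] /andP[_ /eqP <-].
exists b; split.
- by rewrite -xu.
- by move=> g gb; apply: s1'; rewrite mem_cat gb orbT.
- apply: le_trans c1'; rewrite lcost_cat lerDr; apply: lcost_ge0 => g ga.
  by apply: w10; rewrite cat_rcons -cat_rcons mem_cat ga.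
- by rewrite uf.
Qed.


Definition valid (E : seq edge) (p : gedge (seq edge)) : Prop :=
  [/\ lcon (pay p) (src p) (dst p), lcost (pay p) <= p.1 & {subset pay p <= E}].

Section Paths.
Variables (E : seq edge) (V : seq nat).
Hypothesis EV : forall e, e \in E -> (src e \in V) && (dst e \in V).
Let P0 : seq (gedge (seq edge)) := [seq mkedge 0 u u [::] | u <- V].

Lemma paths_valid k p : p \in iter k (relax E V) P0 ->
  [/\ valid E p, src p \in V & dst p \in V].
Proof.
elim: k p => [|k IHk] p /=.
  case/mapP=> u uV ->; split=> //; split=> //; first exact: rst_refl.
  by rewrite /lcost big_nil.
case/mem_relax => [/IHk//|[q [e [/IHk[[qc qw qE] sq dq] eE qe ->]]]].
have /andP[se de] := EV eE; split=> //; split.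
- apply: (rst_trans _ _ _ (src e)).
    by rewrite -qe; apply: lcon_sub qc => f fq; rewrite inE fq orbT.
  by apply: lcon_edge; rewrite mem_head.
- by rewrite lcost_cons addrC lerD2r.
- by move=> f; rewrite inE => /orP[/eqP->|/qE].
Qed.

Lemma relax_le P q : q \in extend E P -> src q \in V -> dst q \in V ->
  exists p, [/\ p \in relax E V P, src p = src q, dst p = dst q & p.1 <= q.1].
Proof.
move=> qQ sq dq; set S := [seq p <- extend E P | (src p == src q) && (dst p == dst q)].
have qS : q \in S by rewrite mem_filter !eqxx.
case: (pickminP S) => [[S0 _]|[p [pp pS pmin]]]; first by rewrite S0 in qS.
have := pS; rewrite mem_filter => /andP[/andP[/eqP e1 /eqP e2] _].
exists p; split=> //; last exact: pmin.
apply/flattenP; exists (flatten [seq pickmin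
  [seq p <- extend E P | (src p == src q) && (dst p == v)] | v <- V]).
  by apply/mapP; exists (src q).
apply/flattenP; exists (pickmin S); last by rewrite pp mem_head.
by apply/mapP; exists (dst q).
Qed.

Lemma paths_le k w u v : {subset w <= E} -> u \in V -> (size w <= k)%N -> walk u w v ->
  exists p, [/\ p \in iter k (relax E V) P0, src p = u, dst p = v & p.1 <= lcost w].
Proof.
elim: k w v => [|k IHk] w v wE uV.
  case: w wE => // _ _ /eqP <-; exists (mkedge 0 u u [::]); split=> //.
    by apply/mapP; exists u.
  by rewrite /lcost big_nil.
have keep q : q \in iter k (relax E V) P0 -> src q = u -> dst q = v -> q.1 <= lcost w ->
    exists p, [/\ p \in iter k.+1 (relax E V) P0, src p = u, dst p = v & p.1 <= lcost w].
  move=> qP sq dq qw; have [_ sV dV] := paths_valid qP.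
  have [|p [pP sp dp pq]] := @relax_le (iter k (relax E V) P0) q _ sV dV.
    by rewrite mem_cat qP.
  by exists p; split=> //; [rewrite sp | rewrite dp | apply: le_trans qw].
case/lastP: w wE keep => [|w e] wE keep.
  by move=> _ /(IHk [::] v wE uV (leq0n k))[q [*]]; apply: (keep q).
rewrite size_rcons ltnS -cats1 => wk /walk_cat[x wx] /andP[/eqP xe /eqP ev].
have [|q [qP sq dq qw]] := IHk w x _ uV wk wx.
  by move=> f fw; apply: wE; rewrite mem_rcons inE fw orbT.
have eE : e \in E by apply: wE; rewrite mem_rcons mem_head.
have [|||p [pP sp dp pq]] := @relax_le (iter k (relax E V) P0) (join q e) _ _ _.
- rewrite mem_cat; apply/orP; right; apply/allpairsPdep; exists q, e; split=> //.
  by rewrite mem_filter eE dq xe eqxx.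
- by rewrite -sq in uV.
- by case/andP: (EV eE).
exists p; split=> //; first by rewrite sp.
  by rewrite dp -ev.
by apply: le_trans pq _; rewrite lcost_cat lcost_cons {2}/lcost big_nil addr0 lerD2r.
Qed.

Lemma in_paths_le n w u v : (forall e, e \in E -> 0 <= e.1) -> V =i iota 0 n ->
  {subset w <= E} -> u \in V -> walk u w v ->
  exists p, [/\ p \in paths E V n, src p = u, dst p = v & p.1 <= lcost w].
Proof.
move=> E0 Vn wE uV /walk_shorten[|w' [h s c uw]]; first by move=> e /wE/E0.
have w'E : {subset w' <= E} by move=> e /s/wE.
have [|p [pP sp dp pc]] := @paths_le n w' u v w'E uV _ h.
  have : (size (u :: map dst w') <= size (iota 0 n))%N.
    apply: uniq_leq_size uw _ => x; rewrite inE -Vn => /orP[/eqP->//|/mapP[e /w'E eE ->]].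
    by case/andP: (EV eE).
  by rewrite size_iota /= size_map => /ltnW.
by exists p; split=> //; apply: le_trans c.
Qed.

End Paths.

(** [F] competes with the first tree. The edges under the chosen entries cost at most as much as
    these entries and connect all that they connect, so the second tree is not more expensive. It is
    needed because the chosen paths may overlap and then do not form a tree of the graph. *)
Lemma finishP (E : seq edge) n r Z (L F : seq (gedge (seq edge))) :
  (r < n)%N -> (forall e, e \in E -> [/\ 0 <= e.1, (src e < n)%N & (dst e < n)%N]) ->
  (forall p, p \in L -> [/\ valid E p, (src p < n)%N & (dst p < n)%N]) ->
  {subset F <= L} -> (forall x, lcon L r x -> lcon F r x) ->
  (forall z, z \in Z -> lcon L r z) ->
  exists T, [/\ finish r n Z L = [:: (lcost T.2, T)], ptree r T.1 T.2,
    {subset T.2 <= E}, {subset Z <= T.1} & lcost T.2 <= lcost F].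
Proof.
move=> rn En Ln FL LF LZ.
have L0 p : p \in L -> 0 <= p.1.
  case/Ln=> -[_ le pE] _ _; apply: le_trans le; apply: lcost_ge0 => e /pE/En[].
  by [].
set K := (prim L r n).2; set D := flatten [seq pay e | e <- K].
have [hK KL] := pstate_ptree L r n; rewrite /pstate -/(prim L r n) -/K in hK KL.
have DE : {subset D <= E}.
  by move=> e /flattenP[_ /mapP[p /KL/Ln[[_ _ pE] _ _] ->] /pE].
have Dn e : e \in D -> (src e < n)%N && (dst e < n)%N by move=> /DE/En[_ -> ->].
have [hT TD] := pstate_ptree D r n; rewrite /pstate -/(prim D r n) in hT TD.
have Dc : lcost D <= lcost K.
  rewrite /D; elim: {hK} K KL {D DE Dn hT TD} => [|p K IHK] KL /=;
    first by rewrite /lcost !big_nil.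
  rewrite lcost_cat lcost_cons lerD //; first by case: (Ln p (KL _ (mem_head _ _))) => -[].
  by apply: IHK => q qK; apply: KL; rewrite inE qK orbT.
have Kc : lcost K <= lcost F by apply: prim_le.
have Tc : lcost (prim D r n).2 <= lcost D.
  by apply: prim_le => // e /DE/En[].
have Zin : {subset Z <= (prim D r n).1}.
  move=> z /LZ rz; apply: prim_reach => //.
  have zK : z \in (prim L r n).1.
    by apply: prim_reach => // p /Ln[_ -> ->].
  have := ptree_lcon hK zK; apply: con_sub => _ _ [p pK [<- <-]].
  have [[pc _ _] _ _] := Ln p (KL p pK); apply: lcon_sub pc => e ep.
  by apply/flattenP; exists (pay p) => //; apply/mapP; exists p.
exists (prim D r n); split=> //.
- rewrite /finish -/K -/D ifT //; exact/allP.
- by move=> e /TD/DE.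
- exact: le_trans Tc (le_trans Dc Kc).
Qed.

End Edges.

(** * Binary trees and the theorem of Borchers and Du *)

Section BinaryTrees.
Variable R : realType.
Local Notation gedge X := (gedge R X).
Local Notation edge := (edge R).

Definition flip (e : edge) : edge := mkedge e.1 (dst e) (src e) tt.

Lemma flipK : involutive flip.
Proof. by case=> c [[u v] []]. Qed.

Definition unoriented (L : seq edge) : seq edge := L ++ map flip L.

Lemma mem_unoriented L e : (e \in unoriented L) = (e \in L) || (flip e \in L).
Proof.
rewrite mem_cat; congr (_ || _).
by rewrite -{1}[e]flipK mem_map //; apply: can_inj flipK.
Qed.

Lemma unoriented_sub L L' : {subset L <= L'} -> {subset unoriented L <= unoriented L'}.
Proof. by move=> s e; rewrite !mem_unoriented => /orP[/s->//|/s->]; rewrite orbT. Qed.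

(* A rooted tree with its vertices of degree two suppressed: the edges carry
   walks, and the leaves are the terminals. *)
Inductive bt := Lf of nat | Br of nat & seq edge & bt & seq edge & bt.

Definition root b := match b with Lf v => v | Br x _ _ _ _ => x end.

Fixpoint wf b :=
  if b is Br x w a w' c
  then [&& walk x w (root a), walk x w' (root c), wf a & wf c] else true.

Fixpoint leaves b :=
  match b with Lf v => [:: v] | Br _ _ a _ c => leaves a ++ leaves c end.

Fixpoint bedges b : seq edge :=
  if b is Br _ w a w' c then w ++ bedges a ++ w' ++ bedges c else [::].

(** Edges at the current vertex [x] are consumed one at a time, and what is left is again rooted at
    [x]. So a vertex of large degree turns into several branchings joined by empty walks, and a
    terminal inside the tree into a leaf on an empty walk. The first alternative, a part without
    terminals, is what prunes useless branches and suppresses vertices of degree two. [L] may have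
    cycles; an edge that closes one is dropped. *)
Lemma bt_of_edges (L : seq edge) (Z : seq nat) x :
  (forall e, e \in L -> 0 <= e.1) ->
  (forall z, z \in Z -> ~ lcon L x z) \/
  exists w b, [/\ walk x w (root b) && wf b, {subset leaves b <= Z},
    (forall z, z \in Z -> lcon L x z -> z \in leaves b),
    lcost (w ++ bedges b) <= lcost L &
    {subset w ++ bedges b <= unoriented L}].
Proof.
have [m] := ubnP (size L); elim: m L x => // m IHm L x szL L0.
case: (pselect (exists2 e, e \in L & src e = x \/ dst e = x)) => [[e eL ex]|noe]; last first.
  have onlyx z : lcon L x z -> z = x.
    move=> xz; apply: (con_closed (P := fun z => z = x) _ xz) => // a b [e eL [sa db]].
    by split=> h; case: noe; exists e => //; [left | right]; rewrite ?sa ?db.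
  case: (boolP (x \in Z)) => xZ; last first.
    by left=> z zZ /onlyx ez; rewrite -ez zZ in xZ.
  right; exists [::], (Lf x); split=> /= [|z|z _ /onlyx->||] //.
  - by rewrite eqxx.
  - by rewrite inE => /eqP->.
  - by rewrite mem_head.
  - by rewrite {1}/lcost big_nil lcost_ge0.
pose e0 := if src e == x then e else flip e.
pose y := dst e0.
have e0c : e0.1 = e.1 by rewrite /e0; case: ifP.
have e0L : e0 \in unoriented L.
  by rewrite mem_unoriented /e0; case: ifP => _; rewrite ?flipK eL ?orbT.
have e0s : src e0 = x by rewrite /e0; case: eqP => // h; case: ex => // ->.
set L' := rem e L; have perm := perm_to_rem eL.
have L'L : {subset L' <= L} by move=> f /mem_rem.
have szL' : (size L' < m)%N.
  by rewrite size_rem // -ltnS (leq_trans _ szL) // ltnS prednK //; case: (L) eL.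
have cL : lcost L = e.1 + lcost L' by rewrite (perm_lcost perm) lcost_cons.
have e0' : 0 <= e.1 by apply: L0.
have L'0 f : f \in L' -> 0 <= f.1 by move=> /L'L/L0.
have exy : (src e = x /\ dst e = y) \/ (src e = y /\ dst e = x).
  rewrite /y /e0; case: eqP => [->|h]; first by left.
  by right; split=> //; case: ex.
have splitL z : lcon L x z -> lcon L' x z \/ lcon L' y z.
  move=> xz; apply: (con_closed (P := fun z => lcon L' x z \/ lcon L' y z) _ xz);
    last by left; apply: rst_refl.
  move=> a b [f]; rewrite (perm_mem perm) inE => /orP[/eqP-> [<- <-]|fL' [fa fb]].
    case: exy => -[-> ->].
      by split=> _; [right | left]; apply: rst_refl.
    by split=> _; [left | right]; apply: rst_refl.
  have ab : lcon L' a b by apply: rst_step; exists f.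
  by split=> -[h|h]; [left|right|left|right]; (apply: rst_trans h _; try exact: ab);
    apply: rst_sym.
have [xy|nxy] := pselect (lcon L' x y).
  have LL' z : lcon L x z -> lcon L' x z.
    by case/splitL=> //; apply: rst_trans.
  case: (IHm L' x szL' L'0) => [h|[w [b [h1 h3 h4 h5 h6]]]]; [left|right].
    by move=> z zZ /LL'; apply: h.
  exists w, b; split=> //; first by move=> z zZ /LL'; apply: h4.
    by rewrite cL (le_trans h5) // lerDr.
  by move=> f /h6; apply: unoriented_sub.
(* The edge [e] is a bridge here: [L1] is the component behind it, and [L2] stays with [x]. *)
pose p (f : edge) := `[< lcon L' y (src f) >].
have L1L q : {subset [seq f <- L' | q f] <= L'} by move=> f; rewrite mem_filter => /andP[].
have sz q : (size [seq f <- L' | q f] < m)%N.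
  by apply: leq_ltn_trans szL'; rewrite size_filter count_size.
set L1 := [seq f <- L' | p f]; set L2 := [seq f <- L' | predC p f].
have y1 z : lcon L' y z -> lcon L1 y z.
  move=> yz; apply: (proj2 (A := lcon L' y z)).
  apply: (con_closed (P := fun z => lcon L' y z /\ lcon L1 y z) _ yz); last by split;
    apply: rst_refl.
  move=> a b [f fL' [fa fb]]; have ab : lcon L' a b by apply: rst_step; exists f.
  have key : lcon L' y a -> lcon L1 a b.
    by move=> ya; apply: rst_step; exists f => //; rewrite mem_filter fL' andbT;
      apply/asboolP; rewrite fa.
  split=> -[ya ya1].
    by split; [apply: rst_trans ya ab | apply: rst_trans ya1 (key ya)].
  have ya' := rst_trans _ _ _ _ _ ya (rst_sym _ _ _ _ ab).
  by split=> //; apply: rst_trans ya1 (rst_sym _ _ _ _ (key ya')).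
have x2 z : lcon L' x z -> lcon L2 x z.
  move=> xz; apply: (proj2 (A := lcon L' x z)).
  apply: (con_closed (P := fun z => lcon L' x z /\ lcon L2 x z) _ xz); last by split;
    apply: rst_refl.
  move=> a b [f fL' [fa fb]]; have ab : lcon L' a b by apply: rst_step; exists f.
  have key : lcon L' x a -> lcon L2 a b.
    move=> ya; apply: rst_step; exists f => //; rewrite mem_filter fL' andbT.
    apply/asboolP; rewrite fa => h; apply: nxy.
    exact: rst_trans ya (rst_sym _ _ _ _ h).
  split=> -[ya ya1].
    by split; [apply: rst_trans ya ab | apply: rst_trans ya1 (key ya)].
  have ya' := rst_trans _ _ _ _ _ ya (rst_sym _ _ _ _ ab).
  by split=> //; apply: rst_trans ya1 (rst_sym _ _ _ _ (key ya')).
have c12 : lcost L1 + lcost L2 = lcost L'.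
  by rewrite -lcost_cat; apply: perm_lcost; rewrite perm_filterC.
have Lp q f : f \in [seq f <- L' | q f] -> 0 <= f.1 by move=> /L1L/L'0.
have L1u q : {subset unoriented [seq f <- L' | q f] <= unoriented L}.
  by apply: unoriented_sub => f /L1L/L'L.
have C1 : 0 <= lcost L1 by apply: lcost_ge0 (Lp _).
have C2 : 0 <= lcost L2 by apply: lcost_ge0 (Lp _).
have hL1 := IHm L1 y (sz p) (Lp p); have hL2 := IHm L2 x (sz _) (Lp _).
case: hL1 => [n1|[w1 [b1 [/andP[a1 a2] a3 a4 a5 a6]]]].
  case: hL2 => [n2|[w2 [b2 [/andP[g1 g2] g3 g4 g5 g6]]]].
    by left=> z zZ /splitL[/x2|/y1]; [apply: n2 | apply: n1].
  right; exists w2, b2; split=> //; [by rewrite g1 | | |by move=> f /g6/L1u].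
    by move=> z zZ /splitL[/x2|/y1 /n1]; [apply: g4 | case].
  by move: c12 cL g5; lra.
have ew1 : walk x (e0 :: w1) (root b1) by rewrite /= e0s eqxx.
have ec : lcost (e0 :: w1 ++ bedges b1) <= e.1 + lcost L1 by rewrite lcost_cons e0c lerD2l.
have eu : {subset e0 :: w1 ++ bedges b1 <= unoriented L}.
  by move=> f; rewrite inE => /orP[/eqP->//|/a6/L1u].
right; case: hL2 => [n2|[w2 [b2 [/andP[g1 g2] g3 g4 g5 g6]]]].
  exists (e0 :: w1), b1; split=> //; first by rewrite ew1.
    by move=> z zZ /splitL[/x2 /n2|/y1]; [case | apply: a4].
  by apply: le_trans ec _; move: c12 cL; lra.
exists [::], (Br x (e0 :: w1) b1 w2 b2); split=> //.
- by rewrite /= e0s !eqxx a1 a2 g1 g2.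
- by move=> z; rewrite mem_cat => /orP[/a3|/g3].
- move=> z zZ /splitL[/x2 /(g4 z zZ)|/y1 /(a4 z zZ)] h; rewrite /= mem_cat h ?orbT //.
- rewrite cat0s /= -cat_cons catA lcost_cat; move: ec g5.
  by move: c12 cL; lra.
- move=> f; rewrite cat0s /= -cat_cons catA mem_cat => /orP[/eu//|/g6/L1u//].
Qed.

Fixpoint lpath b : seq edge := if b is Br _ w a _ _ then w ++ lpath a else [::].
Fixpoint lleaf b := match b with Lf v => v | Br _ _ a _ _ => lleaf a end.
Fixpoint rpath b : seq edge := if b is Br _ _ _ w c then w ++ rpath c else [::].
Fixpoint rleaf b := match b with Lf v => v | Br _ _ _ _ c => rleaf c end.

Lemma lpathP b : wf b -> walk (root b) (lpath b) (lleaf b).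
Proof.
by elim: b => //= x w a IHa w' c _ /and4P[h _ /IHa ha _]; apply: cat_walk ha.
Qed.

Lemma rpathP b : wf b -> walk (root b) (rpath b) (rleaf b).
Proof.
by elim: b => //= x w a _ w' c IHc /and4P[_ h _ /IHc hc]; apply: cat_walk hc.
Qed.

Lemma lleaf_in b : lleaf b \in leaves b.
Proof. by elim: b => /= [v|x w a IHa w' c _]; rewrite ?mem_head // mem_cat IHa. Qed.

Lemma rleaf_in b : rleaf b \in leaves b.
Proof. by elim: b => /= [v|x w a _ w' c IHc]; rewrite ?mem_head // mem_cat IHc orbT. Qed.

Lemma lpath_sub b : {subset lpath b <= bedges b}.
Proof.
elim: b => //= x w a IHa w' c _ f; rewrite !mem_cat.
by case/orP=> [->//|/IHa->]; rewrite orbT.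
Qed.

Lemma rpath_sub b : {subset rpath b <= bedges b}.
Proof.
elim: b => //= x w a _ w' c IHc f; rewrite !mem_cat.
by case/orP=> [->|/IHc->]; rewrite !orbT.
Qed.

Definition rwalk (w : seq edge) := rev (map flip w).

Lemma rwalkP u w v : walk u w v -> walk v (rwalk w) u.
Proof.
elim: w u => [|e w IHw] u /= => [/eqP->//|/andP[/eqP eu /IHw h]].
rewrite /rwalk /= rev_cons -cats1; apply: cat_walk h _.
by rewrite /= -eu /src /dst /= !eqxx.
Qed.

Lemma rwalk_cost w : lcost (rwalk w) = lcost w.
Proof.
rewrite /rwalk (perm_lcost (F := map flip w)) ?perm_rev //.
by rewrite /lcost big_map.
Qed.

Lemma rwalk_sub w : {subset rwalk w <= unoriented w}.
Proof. by move=> f; rewrite mem_rev mem_cat => ->; rewrite orbT. Qed.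

Definition wedge (u : nat) (w : seq edge) (v : nat) : gedge (seq edge) :=
  mkedge (lcost w) u v w.

Definition is_walk (L : seq edge) (p : gedge (seq edge)) : Prop :=
  [/\ walk (src p) (pay p) (dst p), p.1 = lcost (pay p) & {subset pay p <= L}].

Lemma is_walk_sub L L' p : {subset L <= L'} -> is_walk L p -> is_walk L' p.
Proof. by move=> s [h1 h2 h3]; split=> // e /h3/s. Qed.

Lemma wedgeP L u w v : walk u w v -> {subset w <= L} -> is_walk L (wedge u w v).
Proof. by []. Qed.

(* The tour of the leaves in their order uses every edge twice, except for the
   two paths that would close it at the root. *)
Lemma tour b : wf b -> exists W, [/\
  forall p, p \in W -> [/\ is_walk (unoriented (bedges b)) p,
                           src p \in leaves b & dst p \in leaves b],
  forall z, z \in leaves b -> lcon W (lleaf b) z &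
  lcost W + lcost (lpath b) + lcost (rpath b) = lcost (bedges b) *+ 2].
Proof.
elim: b => [v _|x w a IHa w' c IHc].
  exists [::]; split=> // [z|]; last by rewrite /lcost !big_nil; lra.
  by rewrite inE => /eqP->; apply: rst_refl.
case/and4P=> hw hw' wa wc.
have [Wa [pa la ca]] := IHa wa; have [Wc [pc lc cc]] := IHc wc.
pose q := wedge (rleaf a) (rwalk (w ++ rpath a) ++ w' ++ lpath c) (lleaf c).
have subA : {subset unoriented (bedges a) <= unoriented (bedges (Br x w a w' c))}.
  by apply: unoriented_sub => f; rewrite /= !mem_cat => ->; rewrite !orbT.
have subC : {subset unoriented (bedges c) <= unoriented (bedges (Br x w a w' c))}.
  by apply: unoriented_sub => f; rewrite /= !mem_cat => ->; rewrite !orbT.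
exists (q :: Wa ++ Wc); split.
- move=> p; rewrite inE mem_cat => /orP[/eqP->|/orP[/pa[h s d]|/pc[h s d]]].
  + split; rewrite /= ?mem_cat ?rleaf_in ?lleaf_in ?orbT //; apply: wedgeP.
      apply: (cat_walk (x := x)).
        by apply: rwalkP; apply: cat_walk hw (rpathP wa).
      exact: cat_walk hw' (lpathP wc).
    move=> f; rewrite mem_cat => /orP[/rwalk_sub|].
      apply: unoriented_sub => g /=; rewrite !mem_cat => /orP[->//|/rpath_sub->].
      by rewrite orbT.
    rewrite mem_unoriented /= !mem_cat => /orP[->|/lpath_sub->]; by rewrite !orbT.
  + by split; rewrite ?mem_cat ?s ?d //; apply: is_walk_sub h.
  + by split; rewrite ?mem_cat ?s ?d ?orbT //; apply: is_walk_sub h.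
- have hA z : z \in leaves a -> lcon (q :: Wa ++ Wc) (lleaf a) z.
    by move=> /la; apply: lcon_sub => p pW; rewrite inE mem_cat pW orbT.
  have hC z : z \in leaves c -> lcon (q :: Wa ++ Wc) (lleaf c) z.
    by move=> /lc; apply: lcon_sub => p pW; rewrite inE mem_cat pW !orbT.
  move=> z /=; rewrite mem_cat => /orP[/hA//|/hC h].
  apply: rst_trans h; apply: rst_trans (hA _ (rleaf_in a)) _.
  exact: lcon_edge (mem_head q _).
- have -> : lcost (q :: Wa ++ Wc) = lcost w + lcost (rpath a) + lcost w' + lcost (lpath c)
      + lcost Wa + lcost Wc.
    by rewrite lcost_cons lcost_cat /q /wedge /= !lcost_cat rwalk_cost !lcost_cat; lra.
  rewrite /= !lcost_cat; move: ca cc; rewrite !mulr2n; lra.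
Qed.

(** The terminals of a hyperedge, and the walks that connect them. *)
Notation hyper := (seq nat * seq (gedge (seq edge)))%type.

Definition hrel (D : seq hyper) (x y : nat) : Prop :=
  exists2 h, h \in D & x \in h.1 /\ y \in h.1.

Definition hcost (D : seq hyper) : R := \sum_(h <- D) lcost h.2.

(* The tree is cut at every internal node whose depth is [i] modulo [r.+1].
   A node that is cut is replaced, in the piece above it, by the leaf at the end
   of its path [w' ++ lpath c]; these paths are disjoint for distinct nodes, so
   that for some [i] they cost little altogether. *)
Fixpoint cut (r i : nat) (b : bt) : hyper * seq hyper :=
  match b with
  | Lf v => (([:: v], [::]), [::])
  | Br x w a w' c =>
    let j := if i is i'.+1 then i' else r in
    let A := cut r j a in let C := cut r j c in
    let P := (A.1.1 ++ C.1.1,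
      wedge x w (root a) :: wedge x w' (root c) :: A.1.2 ++ C.1.2) in
    if i is 0 then (([:: lleaf c], [:: wedge x (w' ++ lpath c) (lleaf c)]), P :: A.2 ++ C.2)
    else (P, A.2 ++ C.2)
  end.

Fixpoint cut_extra (r i : nat) (b : bt) : R :=
  if b is Br x w a w' c then
    let j := if i is i'.+1 then i' else r in
    (if i is 0 then lcost (w' ++ lpath c) else 0) + cut_extra r j a + cut_extra r j c
  else 0.

Fixpoint paths_cost (b : bt) : R :=
  if b is Br x w a w' c then lcost (w' ++ lpath c) + paths_cost a + paths_cost c else 0.

(** An edge outside the leftmost path lies on exactly one path that enters a right child and then
    always turns left. *)
Lemma paths_costE b : paths_cost b + lcost (lpath b) = lcost (bedges b).
Proof.
elim: b => /= [v|x w a IHa w' c IHc]; first by rewrite /lcost big_nil addr0.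
by rewrite !lcost_cat -IHa -IHc; lra.
Qed.

(** Each internal node is cut for exactly one of the [r.+1] offsets, since passing to the children
    merely rotates the offsets. *)
Lemma cut_extra_sum r b : \sum_(i < r.+1) cut_extra r i b = paths_cost b.
Proof.
elim: b => [v|x w a IHa w' c IHc]; first by rewrite big1.
rewrite big_ord_recl /= -IHa -IHc !big_ord_recr /=.
under eq_bigr => i _ do rewrite /= add0r.
by rewrite big_split /=; lra.
Qed.

Lemma cut_cost r i b :
  lcost (cut r i b).1.2 + hcost (cut r i b).2 = lcost (bedges b) + cut_extra r i b.
Proof.
rewrite /hcost; elim: b i => [v i|x w a IHa w' c IHc i]; first by rewrite /lcost !big_nil.
have := IHa (if i is i'.+1 then i' else r); have := IHc (if i is i'.+1 then i' else r).
case: i => [|i] /= hc ha.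
  rewrite big_cons big_cat /= !lcost_cons !lcost_cat /= !lcost_cat lcost_nil; lra.
rewrite big_cat /= !lcost_cons !lcost_cat /=; lra.
Qed.

Definition good_hyper K b (h : hyper) : Prop :=
  [/\ {subset h.1 <= leaves b}, (size h.1 <= K)%N, (size h.2 <= K)%N,
      forall z z', z \in h.1 -> z' \in h.1 -> lcon h.2 z z' &
      forall p, p \in h.2 -> is_walk (bedges b) p].

(** The piece at the root has at most [i] levels of branchings, whence the powers of two; a finished
    piece has one level more than offset [r] allows, whence [2 ^ r.+1]. The slack [.+2] makes the
    count of walks inductive: two pieces of at most [3 * 2 ^ j - 2] walks and the two walks above
    them give at most [3 * 2 ^ j.+1 - 2]. *)
Lemma cutP r i b : wf b ->
  [/\ [/\ (size (cut r i b).1.1 <= 2 ^ i)%N, ((size (cut r i b).1.2).+2 <= 3 * 2 ^ i)%N &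
      forall p, p \in (cut r i b).1.2 -> is_walk (bedges b) p],
    forall z, z \in (cut r i b).1.1 -> z \in leaves b /\ lcon (cut r i b).1.2 (root b) z,
    forall h, h \in (cut r i b).2 -> good_hyper (3 * 2 ^ r.+1) b h &
    forall l, l \in leaves b -> exists2 z, z \in (cut r i b).1.1 & con (hrel (cut r i b).2) l z].
Proof.
elim: b i => [v i _|x w a IHa w' c IHc i].
  split=> //=; first split=> //; first by rewrite expn_gt0.
  - by rewrite (leq_trans _ (leq_mul (leqnn 3) (_ : (1 <= 2 ^ i)%N))) // expn_gt0.
  - by move=> z; rewrite inE => /eqP->; split; rewrite ?mem_head //; apply: rst_refl.
  - by move=> l; rewrite inE => /eqP->; exists v; rewrite ?mem_head //; apply: rst_refl.
case/and4P=> hw hw' wa wc; set b := Br x w a w' c.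
set j := if i is i'.+1 then i' else r.
have [[za sa pa] ra ga la] := IHa j wa; have [[zc sc pc] rc gc lc] := IHc j wc.
set A := cut r j a in za sa pa ra ga la *; set C := cut r j c in zc sc pc rc gc lc *.
set P := (A.1.1 ++ C.1.1, wedge x w (root a) :: wedge x w' (root c) :: A.1.2 ++ C.1.2).
have cutE : cut r i b =
    if i is 0 then (([:: lleaf c], [:: wedge x (w' ++ lpath c) (lleaf c)]), P :: A.2 ++ C.2)
    else (P, A.2 ++ C.2) by [].
have subA : {subset bedges a <= bedges b}.
  by move=> f h; rewrite /= !mem_cat h !orbT.
have subC : {subset bedges c <= bedges b}.
  by move=> f h; rewrite /= !mem_cat h !orbT.
have PZ : (size P.1 <= 2 ^ j.+1)%N by rewrite size_cat expnS mul2n -addnn leq_add.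
have PW : ((size P.2).+2 <= 3 * 2 ^ j.+1)%N.
  by rewrite /= size_cat expnS mulnCA mul2n -addnn; move: sa sc; lia.
have Pp p : p \in P.2 -> is_walk (bedges b) p.
  rewrite !inE mem_cat => /or3P[/eqP->|/eqP->|/orP[/pa|/pc]].
  - by apply: wedgeP hw _ => f h; rewrite /= !mem_cat h.
  - by apply: wedgeP hw' _ => f h; rewrite /= !mem_cat h !orbT.
  - exact: is_walk_sub.
  - exact: is_walk_sub.
have Pr z : z \in P.1 -> z \in leaves b /\ lcon P.2 x z.
  have e1 : lcon P.2 x (root a) by apply: (lcon_edge (e := wedge x w (root a))); rewrite mem_head.
  have e2 : lcon P.2 x (root c).
    by apply: (lcon_edge (e := wedge x w' (root c))); rewrite !inE eqxx orbT.
  rewrite !mem_cat => /orP[/ra|/rc] [-> h]; rewrite ?orbT; split=> //.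
    by apply: rst_trans e1 _; apply: lcon_sub h => p pA; rewrite !inE mem_cat pA !orbT.
  by apply: rst_trans e2 _; apply: lcon_sub h => p pA; rewrite !inE mem_cat pA !orbT.
have gh h : h \in A.2 ++ C.2 -> good_hyper (3 * 2 ^ r.+1) b h.
  rewrite mem_cat => /orP[/ga|/gc] [h1 h2 h3 h4 h5]; split=> //.
  - by move=> z /h1; rewrite /= mem_cat => ->.
  - by move=> p /h5; apply: is_walk_sub.
  - by move=> z /h1; rewrite /= mem_cat => ->; rewrite orbT.
  - by move=> p /h5; apply: is_walk_sub.
have Pl l : l \in leaves b -> exists2 z, z \in P.1 & con (hrel (A.2 ++ C.2)) l z.
  rewrite /= mem_cat => /orP[/la|/lc] [z zA h]; exists z; rewrite ?mem_cat ?zA ?orbT //.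
    by apply: con_mono h => u v [k kA uv]; exists k; rewrite ?mem_cat ?kA.
  by apply: con_mono h => u v [k kA uv]; exists k; rewrite ?mem_cat ?kA ?orbT.
have jE : if i is i'.+1 then j = i' else j = r by rewrite /j; case: (i).
clearbody j; case: i cutE jE => [|i] cutE jE; rewrite jE in PZ PW.
  rewrite cutE; split.
  - split=> //= p; rewrite inE => /eqP->; apply: wedgeP.
      exact: cat_walk hw' (lpathP wc).
    by move=> f; rewrite /= !mem_cat => /orP[->|/lpath_sub->]; rewrite !orbT.
  - move=> z; rewrite inE => /eqP->; split; first by rewrite /= mem_cat lleaf_in orbT.
    by apply: (lcon_edge (e := wedge x (w' ++ lpath c) (lleaf c))); rewrite mem_head.
  - move=> h; rewrite inE => /orP[/eqP->|/gh//]; split=> //.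
    + by move=> z /Pr[].
    + by apply: leq_trans PZ _; rewrite leq_pmull.
    + by apply: leq_trans PW; rewrite leqW // leqW.
    + by move=> z z' /Pr[_ h1] /Pr[_ h2]; apply: rst_trans h2; apply: rst_sym.
  - have sub u v : con (hrel (A.2 ++ C.2)) u v -> con (hrel (P :: A.2 ++ C.2)) u v.
      by apply: con_mono => u' v' [k kA uv]; exists k; rewrite ?inE ?kA ?orbT.
    (* The leaf that stands for the cut node also lies below it, so it is linked to the piece [P]
       and thereby joins [P] to the piece above. *)
    have lq : lleaf c \in leaves b by rewrite /= mem_cat lleaf_in orbT.
    move=> l /Pl[z zP /sub lz]; exists (lleaf c); first by rewrite mem_head.
    have [z' z'P /sub lz'] := Pl _ lq; apply: rst_trans lz _.
    apply: rst_trans (rst_sym _ _ _ _ lz'); apply: rst_step; exists P => //.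
    exact: mem_head.
by rewrite cutE; split.
Qed.

(** Averaging: the extra costs of the [r.+1] offsets add up to at most the cost of the tree, so one
    offset is cheap. *)
Lemma borchers_du r b : wf b -> (forall e, e \in bedges b -> 0 <= e.1) ->
  exists D : seq hyper, [/\
    forall h, h \in D -> good_hyper (3 * 2 ^ r.+1) b h,
    forall l l', l \in leaves b -> l' \in leaves b -> con (hrel D) l l' &
    hcost D <= (1 + r.+1%:R^-1) * lcost (bedges b)].
Proof.
move=> wb b0; set c := lcost (bedges b).
have pc : paths_cost b <= c.
  rewrite /c -paths_costE lerDl; apply: lcost_ge0 => e /lpath_sub; exact: b0.
have r0 : 0 < r.+1%:R :> R by rewrite ltr0n.
have [i ir hi] : exists2 i, (i <= r)%N & cut_extra r i b <= r.+1%:R^-1 * c.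
  apply: contrapT => nh; suff : c < paths_cost b by rewrite ltNge pc.
  rewrite -(cut_extra_sum r b).
  have -> : c = \sum_(i < r.+1) r.+1%:R^-1 * c.
    by rewrite sumr_const card_ord -[RHS]mulr_natl mulrA divff ?mul1r // lt0r_neq0.
  apply: ltr_sum => [|i _]; first by apply/hasP; exists ord0; rewrite ?mem_index_enum.
  by rewrite ltNge; apply/negP => le; apply: nh; exists i => //; rewrite -ltnS.
have [[z1 s1 p1] r1 g1 l1] := cutP r i wb.
have cc := cut_cost r i b.
exists ((cut r i b).1 :: (cut r i b).2); split.
- move=> h; rewrite inE => /orP[/eqP->|/g1//]; split=> //.
  + by move=> z /r1[].
  + apply: leq_trans z1 _; apply: (@leq_trans (2 ^ r.+1)); rewrite ?leq_pmull //.
    by rewrite leq_exp2l // leqW.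
  + apply: (@leq_trans (3 * 2 ^ i)); first by apply: leq_trans s1; rewrite leqW // leqW.
    by rewrite leq_mul // leq_exp2l // leqW.
  + by move=> z z' /r1[_ h1] /r1[_ h2]; apply: rst_trans h2; apply: rst_sym.
- have sub u v : con (hrel (cut r i b).2) u v ->
      con (hrel ((cut r i b).1 :: (cut r i b).2)) u v.
    by apply: con_mono => u' v' [k kA uv]; exists k; rewrite ?inE ?kA ?orbT.
  move=> l l' /l1[z zC /sub h] /l1[z' zC' /sub h'].
  apply: rst_trans h (rst_trans _ _ _ _ _ _ (rst_sym _ _ _ _ h')).
  by apply: rst_step; exists (cut r i b).1; rewrite ?mem_head.
- by rewrite /hcost big_cons -/(hcost _) cc mulrDl mul1r lerD2l.
Qed.

End BinaryTrees.
Notation hyper R := (seq nat * seq (gedge R (seq (edge R))))%type.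

(** * Exchanging hyperedges *)

Section Exchange.
Implicit Types (E : nat -> nat -> Prop) (X Z : seq nat).

Definition frel (J : finType) (Zs : J -> seq nat) (D : {set J}) (x y : nat) : Prop :=
  exists2 j, j \in D & x \in Zs j /\ y \in Zs j.
Definition orel E E' (x y : nat) : Prop := E x y \/ E' x y.
Definition block Z (x y : nat) : Prop := x \in Z /\ y \in Z.
Definition spans X E : Prop := forall x y, x \in X -> y \in X -> con E x y.

Lemma spans_sub X X' E E' : {subset X <= X'} -> (forall x y, E x y -> con E' x y) ->
  spans X' E -> spans X E'.
Proof. by move=> s h c x y /s xX /s yX; apply: con_sub (c x y xX yX). Qed.

Lemma rebuild1 (J : finType) (Zs : J -> seq nat) (F : {set J}) X Z E :
  (forall j, j \in F -> {subset Zs j <= X}) ->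
  spans X (orel E (block Z)) -> spans X (orel E (frel Zs F)) ->
  exists F' : {set J}, [/\ F' \subset F, (#|F'| <= size Z)%N
                         & spans X (orel E (frel Zs F'))].
Proof.
move=> FX; have [m] := ubnP (size Z); elim: m Z E => // m IHm Z E szZ hZ hF.
have [hE|nE] := pselect (spans X E).
  exists set0; rewrite sub0set cards0; split=> //.
  by apply: spans_sub hE => // x y xy; apply: rst_step; left.
have [f fF [a [b [aX bX [af bf nab]]]]] : exists2 f, f \in F & exists a b,
    [/\ a \in X, b \in X & [/\ a \in Zs f, b \in Zs f & ~ con E a b]].
  apply: contrapT => nf; apply: nE; apply: spans_sub hF => // x y [xy|[f fF [xf yf]]].
    exact: rst_step.
  apply: contrapT => nxy; apply: nf; exists f => //; exists x, y.
  by split; [exact: FX xf | exact: FX yf |].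
have toZ u v : con (orel E (block Z)) u v -> con E u v \/ exists2 z, z \in Z & con E u z.
  move=> uv; have vu := rst_sym _ _ _ _ uv.
  apply: (con_closed (P := fun u => con E u v \/ exists2 z, z \in Z & con E u z) _ vu);
    last by left; apply: rst_refl.
  move=> c d [cd|[cZ dZ]]; last first.
    by split=> _; right; [exists d | exists c] => //; apply: rst_refl.
  have cd' : con E c d by apply: rst_step.
  split=> -[h|[z zZ h]].
  - by left; apply: rst_trans (rst_sym _ _ _ _ cd') h.
  - by right; exists z => //; apply: rst_trans (rst_sym _ _ _ _ cd') h.
  - by left; apply: rst_trans cd' h.
  - by right; exists z => //; apply: rst_trans cd' h.
have [//|[z zZ az]] := toZ a b (hZ a b aX bX).
have [ba|[z' zZ' bz']] := toZ b a (hZ b a bX aX); first by case: nab; apply: rst_sym.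
have zz' : z != z'.
  by apply/eqP => e; apply: nab; apply: rst_trans az _; rewrite e; apply: rst_sym.
have zin : z \in rem z' Z.
  have := perm_mem (perm_to_rem zZ') z; rewrite zZ inE (negbTE zz') /= => <-.
  by [].
set E1 := orel E (frel Zs [set f]).
have ee1 u v : con E u v -> con E1 u v by apply: con_mono => x y; left.
have zz1 : con E1 z z'.
  apply: rst_trans (ee1 _ _ (rst_sym _ _ _ _ az)) _.
  apply: (rst_trans _ _ _ b); last exact: ee1.
  by apply: rst_step; right; exists f; rewrite ?inE.
have [|||F' [F'F szF' hF']] := IHm (rem z' Z) E1 _ _ _.
- by rewrite size_rem // -ltnS (leq_trans _ szZ) // ltnS prednK //; case: (Z) zZ.
- apply: spans_sub hZ => // x y [xy|[xZ yZ]]; first by apply: rst_step; left; left.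
  (* The dropped vertex [z'] is represented by [z] from now on. *)
  have toz u : u \in Z -> con (orel E1 (block (rem z' Z))) u z.
    move=> uZ; have := uZ; rewrite (perm_mem (perm_to_rem zZ')) inE => /orP[/eqP->|ur].
      by apply: rst_sym; apply: con_mono zz1 => ? ?; left.
    by apply: rst_step; right.
  by apply: rst_trans (toz x xZ) (rst_sym _ _ _ _ (toz y yZ)).
- apply: spans_sub hF => // x y [xy|xy]; apply: rst_step; last by right.
  by left; left.
exists (f |: F'); split.
- by rewrite subUset sub1set fF.
- rewrite (leq_trans (leq_card_setU _ _)) // cards1 add1n.
  by rewrite (leq_ltn_trans szF') // size_rem // prednK //; case: (Z) zZ.
- apply: spans_sub hF' => // x y [[xy|[j jf xyj]]|[j jF xyj]]; apply: rst_step;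
  [by left|right|right].
    by exists j => //; rewrite in_setU1 -in_set1 jf.
  by exists j => //; rewrite in_setU1 jF orbT.
Qed.

(** The members of [D] are replaced one after the other; those still to be replaced, and the
    replacements already chosen, count as part of [E]. *)
Lemma rebuild (J J' : finType) (Zs : J -> seq nat) (Zd : J' -> seq nat)
    (F : {set J}) (D : {set J'}) K X E :
  (forall j, j \in F -> {subset Zs j <= X}) -> (forall j, size (Zd j) <= K)%N ->
  spans X (orel E (frel Zd D)) -> spans X (orel E (frel Zs F)) ->
  exists F' : {set J}, [/\ F' \subset F, (#|F'| <= K * #|D|)%N
                         & spans X (orel E (frel Zs F'))].
Proof.
move=> FX KD; have [m] := ubnP #|D|; elim: m D E => // m IHm D E szD hD hF.
have [D0|[d dD]] := set_0Vmem D.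
  exists set0; rewrite sub0set cards0; split=> //.
  apply: spans_sub hD => // x y [xy|[j]]; first by apply: rst_step; left.
  by rewrite D0 inE.
have cD : #|D| = #|D :\ d|.+1 by rewrite (cardsD1 d) dD.
have [||F1 [F1F szF1 hF1]] := @rebuild1 J Zs F X (Zd d) (orel E (frel Zd (D :\ d))) FX.
- apply: spans_sub hD => // x y [xy|[j jD xyj]]; apply: rst_step; first by left; left.
  have [ej|nj] := eqVneq j d; first by right; rewrite -ej.
  by left; right; exists j; rewrite // !inE nj.
- apply: spans_sub hF => // x y [xy|xy]; apply: rst_step; last by right.
  by left; left.
have [|||F2 [F2F szF2 hF2]] := IHm (D :\ d) (orel E (frel Zs F1)) _ _ _.
- by rewrite -ltnS -cD.
- apply: spans_sub hF1 => // x y [[xy|xy]|xy]; apply: rst_step;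
    [by left; left | by right | by left; right].
- apply: spans_sub hF => // x y [xy|xy]; apply: rst_step; last by right.
  by left; left.
exists (F1 :|: F2); split.
- by rewrite subUset F1F.
- rewrite (leq_trans (leq_card_setU _ _)) // cD mulnS leq_add //.
  exact: leq_trans szF1 (KD d).
- apply: spans_sub hF2 => // x y [[xy|[j jF xyj]]|[j jF xyj]]; apply: rst_step;
    [by left | right | right]; exists j => //; rewrite inE jF ?orbT //.
Qed.

(** [a] and [q] bound the sizes of [Q'] and [Q]. A round merges the two and multiplies the bound on
    [Q'] by [K * K]; the sum over all rounds is valid wherever the chain stops. *)
Fixpoint chain_bound (K r a q : nat) : nat :=
  if r is r'.+1 then (a + q + chain_bound K r' (K * (K * a)) (q + a))%N else (a + q)%N.

Variables (R : realType) (JS JT : finType).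
Variables (ZS : JS -> seq nat) (ZT : JT -> seq nat) (w : JT -> R).
Variables (X U : seq nat) (K : nat) (delta : R).
Hypotheses (delta0 : 0 <= delta) (w0 : forall j, 0 <= w j) (XU : {subset X <= U}).
Hypotheses (ZSX : forall j, {subset ZS j <= X}) (ZTU : forall j, {subset ZT j <= U}).
Hypotheses (KS : forall j, (size (ZS j) <= K)%N) (KT : forall j, (size (ZT j) <= K)%N).
Hypotheses (spanS : spans X (frel ZS setT)) (spanT : spans U (frel ZT setT)).

(* [Q] has been moved from the new tree to the old one in exchange for [P], and
   [Q'] is what the old tree needs next. *)
Definition exchange (P : {set JS}) (Q Q' : {set JT}) : Prop :=
  [/\ Q' \subset ~: Q,
      spans X (orel (frel ZT (~: Q)) (frel ZS P)) &
      spans U (orel (orel (frel ZS (~: P)) (frel ZT Q)) (frel ZT Q'))].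

(** Taking [Q'] out of the new tree is repaired by hyperedges [P'] of the old one, and taking these
    out of the old tree is repaired by hyperedges [Q''] of the new one. Both repairs come from what
    has not been moved yet, so nothing moves twice. *)
Lemma exchange_step P Q Q' : exchange P Q Q' ->
  exists P' Q'', exchange (P :|: P') (Q :|: Q') Q'' /\ (#|Q''| <= K * (K * #|Q'|))%N.
Proof.
move=> [Q'Q hA hB]; set Q1 := Q :|: Q'.
have inQ1 j : j \notin Q -> j \notin Q' -> j \in ~: Q1 by rewrite !inE negb_or => -> ->.
have [||P' [P'P szP' hP']] := @rebuild JS JT ZS ZT (~: P) Q' K X
  (orel (frel ZT (~: Q1)) (frel ZS P)) (fun j _ => @ZSX j) KT.
- apply: spans_sub hA => // x y [[j]|xy]; last by apply: rst_step; left; right.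
  rewrite inE => jQ xyj; apply: rst_step; case jQ': (j \in Q'); first by right; exists j.
  by left; left; exists j => //; apply: inQ1 => //; rewrite jQ'.
- apply: spans_sub spanS => // x y [j _ xyj]; apply: rst_step.
  case jP: (j \in P); first by left; right; exists j.
  by right; exists j; rewrite // inE jP.
set P1 := P :|: P'.
have [||Q'' [QQ szQ hQ]] := @rebuild JT JS ZT ZS (~: Q1) P' K U
  (orel (frel ZS (~: P1)) (frel ZT Q1)) (fun j _ => @ZTU j) KS.
- apply: spans_sub hB => // x y [[[j jP xyj]|[j jQ xyj]]|[j jQ xyj]]; apply: rst_step.
  + case jP': (j \in P'); first by right; exists j.
    by left; left; exists j => //; move: jP; rewrite !inE jP' orbF.
  + by left; right; exists j; rewrite // inE jQ.
  + by left; right; exists j; rewrite // inE jQ orbT.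
- apply: spans_sub spanT => // x y [j _ xyj]; apply: rst_step.
  case jP: (j \in Q1); first by left; right; exists j.
  by right; exists j; rewrite // inE jP.
exists P', Q''; split; last by apply: leq_trans szQ _; rewrite leq_mul.
split=> //; apply: spans_sub hP' => // x y [[xy|[j jP xyj]]|[j jP xyj]]; apply: rst_step.
- by left.
- by right; exists j; rewrite // inE jP.
- by right; exists j; rewrite // inE jP orbT.
Qed.

(** A round with an expensive [Q'] lowers the weight outside [Q] by more than [delta], which drives
    the induction on [r]. For [r = 0] no weight is left, and any [Q'] is cheap. *)
Lemma exchange_chain r P Q Q' a q :
  exchange P Q Q' -> (#|Q'| <= a)%N -> (#|Q| <= q)%N ->
  \sum_(j in ~: Q) w j <= r%:R * delta ->
  exists P1 Q1 Q1', [/\ exchange P1 Q1 Q1', \sum_(j in Q1') w j <= delta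
                      & (#|Q1 :|: Q1'| <= chain_bound K r a q)%N].
Proof.
elim: r P Q Q' a q => [|r IHr] P Q Q' a q hex ha hq hr.
all: have szU : (#|Q :|: Q'| <= a + q)%N
  by rewrite (leq_trans (leq_card_setU _ _)) // addnC leq_add.
all: have [Q'Q _ _] := hex.
all: have sumE : \sum_(j in ~: Q) w j = \sum_(j in Q') w j + \sum_(j in ~: (Q :|: Q')) w j
  by rewrite (big_setID Q') (setIidPr Q'Q) /= setCU setDE.
all: have rest0 : 0 <= \sum_(j in ~: (Q :|: Q')) w j by apply: sumr_ge0.
  by exists P, Q, Q'; split=> //; apply: le_trans delta0; rewrite mul0r sumE in hr;
    apply: le_trans hr; rewrite lerDl.
case: (leP (\sum_(j in Q') w j) delta) => [le|gt].
  by exists P, Q, Q'; split=> //; apply: leq_trans szU (leq_addr _ _).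
have [P' [Q'' [hex' szQ'']]] := exchange_step hex.
have [|||P1 [Q1 [Q1' [h1 h2 h3]]]] := IHr _ _ _ (K * (K * a))%N (q + a)%N hex'.
- by apply: leq_trans szQ'' _; rewrite !leq_mul2l ha !orbT.
- by rewrite addnC.
- by move: hr; rewrite sumE -natr1 mulrDl mul1r; lra.
by exists P1, Q1, Q1'; split=> //; apply: leq_trans h3 (leq_addl _ _).
Qed.

Lemma exchange_exists r t : U =i t :: X ->
  \sum_j w j <= r%:R * delta ->
  exists P Q Q', [/\ exchange P Q Q', \sum_(j in Q') w j <= delta
                   & (#|Q :|: Q'| <= chain_bound K r 2 0)%N].
Proof.
move=> UtX hr.
pose E0 := orel (frel ZS (~: set0)) (frel ZT set0).
have E0S x y : con (frel ZS setT) x y -> con E0 x y.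
  by apply: con_mono => u v [j _ uv]; left; exists j; rewrite // !inE.
have E0T x y : con (frel ZT setT) x y -> con (orel E0 (frel ZT (~: set0))) x y.
  by apply: con_mono => u v [j _ uv]; right; exists j; rewrite // !inE.
(* At the start the old tree only lacks a link between [t] and some old terminal, so two vertices
   have to be joined; this is the [2] in the bound. Without old terminals [head t X] is [t]. *)
have [||Q' [_ szQ' hQ']] := @rebuild1 JT ZT (~: set0) U [:: t; head t X] E0 (fun j _ => @ZTU j).
- have key x : x \in U -> con (orel E0 (block [:: t; head t X])) x t.
    rewrite UtX inE => /orP[/eqP->|xX]; first exact: rst_refl.
    have hX : head t X \in X by case: (X) xX => //= ? ? _; rewrite mem_head.
    apply: (rst_trans _ _ _ (head t X)).
      by apply: con_mono (E0S _ _ (spanS xX hX)) => u v; left.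
    by apply: rst_step; right; rewrite /block !inE !eqxx orbT.
  by move=> x y /key hx /key hy; apply: rst_trans hx (rst_sym _ _ _ _ hy).
- by move=> x y xU yU; apply/E0T/spanT.
apply: (@exchange_chain r set0 set0 Q') => //; last 2 first.
- by rewrite cards0.
- by rewrite (eq_bigl xpredT) // => j; rewrite !inE.
split=> //; first by rewrite setC0 subsetT.
move=> x y /XU xU /XU yU; apply: con_mono (spanT xU yU) => u v [j _ uv].
by left; exists j; rewrite // !inE.
Qed.

End Exchange.

(** * Removing a part of a tree by few edges *)

Section Boundary.
Variable R : realType.
Local Notation gedge X := (gedge R X).
Local Notation edge := (edge R).

Definition del (e : edge) (L : seq edge) : seq edge := [seq f <- L | f != e].

Lemma mem_del e L f : (f \in del e L) = (f != e) && (f \in L).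
Proof. exact: mem_filter. Qed.

Lemma del_sub e L : {subset del e L <= L}.
Proof. by move=> f; rewrite mem_del => /andP[]. Qed.

Lemma lcon_del e L x y : lcon L x y ->
  lcon (del e L) x y \/ (lcon (del e L) y (src e) \/ lcon (del e L) y (dst e)).
Proof.
move=> xy; set M := del e L.
apply: (con_closed (P := fun y => lcon M x y \/ (lcon M y (src e) \/ lcon M y (dst e))) _ xy);
  last by left; apply: rst_refl.
move=> a b [f fL [<- <-]]; have [->|fe] := eqVneq f e.
  by split=> _; right; [right | left]; apply: rst_refl.
have ab : lcon M (src f) (dst f) by apply: lcon_edge; rewrite mem_del fe.
have ba := rst_sym _ _ _ _ ab.
split=> -[h|[h|h]].
- by left; apply: rst_trans h ab.
- by right; left; apply: rst_trans ba h.
- by right; right; apply: rst_trans ba h.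
- by left; apply: rst_trans h ba.
- by right; left; apply: rst_trans ab h.
- by right; right; apply: rst_trans ab h.
Qed.

(** Minimality lets each end of every edge reach an element of [X] without that edge, which is what
    the count of boundary edges rests on. *)
Lemma minimal_edges (L : seq edge) (X : seq nat) : uniq L -> spans X (lrel L) ->
  exists E0, [/\ uniq E0, {subset E0 <= L}, spans X (lrel E0) &
    forall e, e \in E0 -> ~ spans X (lrel (del e E0))].
Proof.
have [m] := ubnP (size L); elim: m L => // m IHm L szL uL hL.
have [[e eL he]|ne] := pselect (exists2 e, e \in L & spans X (lrel (del e L))); last first.
  by exists L; split=> // e eL h; apply: ne; exists e.
have [|E0 [u s h m0]] := IHm (del e L) _ (filter_uniq _ uL) he.
  rewrite -ltnS; apply: leq_trans szL; rewrite ltnS size_filter -(count_predC (pred1 e) L).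
  by rewrite -[X in (X < _)%N]add0n ltn_add2r -has_count has_pred1.
by exists E0; split=> // f /s/del_sub.
Qed.

Definition edge_walk (e : edge) : gedge (seq edge) := mkedge e.1 (src e) (dst e) [:: e].

Section Prune.
Variables (S E0 H : seq edge) (X Z : seq nat).
Hypotheses (uE0 : uniq E0) (E0S : {subset E0 <= S}) (HE0 : {subset H <= E0}).
Hypothesis bridge : forall e, e \in S -> ~ lcon (del e S) (src e) (dst e).
Hypothesis spanE0 : spans X (lrel E0).
Hypothesis minE0 : forall e, e \in E0 -> ~ spans X (lrel (del e E0)).
Hypothesis XZ : forall x, x \in X -> exists2 z, z \in Z & lcon H x z.

Let J := [seq e <- S | e \notin E0].
Let N := H ++ J.

(* [H] is the part of [E0] to be kept and [Z] the set of vertices where new paths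
   are attached; the edges of [J] are superfluous in [S] but cannot be cut off
   cheaply, so they are kept as well. *)
Definition boundary : seq edge :=
  [seq e <- E0 | (e \notin H) &&
     `[< exists2 z, z \in Z & lcon N (src e) z \/ lcon N (dst e) z >]].

Let ends (e : edge) a b := (src e = a /\ dst e = b) \/ (src e = b /\ dst e = a).

(* A boundary edge is determined by a vertex of [Z] in front of it and one behind
   it, because two edges with the same pair would lie on a cycle of [S]. *)
Let code (e : edge) (zz : nat * nat) : Prop :=
  exists a b, [/\ ends e a b, lcon N a zz.1 & lcon (del e S) b zz.2].

Let bridge_ends e a b : e \in S -> ends e a b -> ~ lcon (del e S) a b.
Proof. by move=> /bridge h [[<- <-]|[<- <-]] // /(@rst_sym _ _ _ _). Qed.

(** Two elements of [X] that are separated by the removal of [e] hang on different ends of [e]. *)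
Let side e b : e \in E0 -> b = src e \/ b = dst e ->
  exists2 x, x \in X & lcon (del e E0) b x.
Proof.
move=> eE0 hb; have [x [y [xX yX nxy]]] : exists x y, [/\ x \in X,
  y \in X & ~ lcon (del e E0) x y].
  apply: contrapT => h; apply: (minE0 eE0) => x y xX yX; apply: contrapT => nxy.
  by apply: h; exists x, y.
have [//|hy] := lcon_del e (spanE0 xX yX).
have [/(@rst_sym _ _ _ _)//|hx] := lcon_del e (spanE0 yX xX).
have s u v : lcon (del e E0) u v -> lcon (del e E0) v u by apply: rst_sym.
case: hb => ->.
  case: hy => hy; first by exists y => //; apply: s.
  case: hx => hx; first by exists x => //; apply: s.
  by case: nxy; apply: rst_trans hx (s _ _ hy).
case: hy => hy; last by exists y => //; apply: s.
case: hx => hx; last by exists x => //; apply: s.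
by case: nxy; apply: rst_trans hx (s _ _ hy).
Qed.

Let NS e : e \in E0 -> e \notin H -> {subset N <= del e S}.
Proof.
move=> eE0 eH f; rewrite mem_cat mem_del => /orP[fH|].
  by rewrite E0S ?HE0 // andbT; apply: contraNneq eH => <-.
by rewrite mem_filter => /andP[fE0 ->]; rewrite andbT; apply: contraNneq fE0 => ->.
Qed.

Let code_ex e : e \in boundary -> exists2 zz, zz \in [seq (z, z') | z <- Z, z' <- Z] & code e zz.
Proof.
rewrite mem_filter => /andP[/andP[eH /asboolP[z zZ hz]] eE0].
have [a [b [eab az hb]]] : exists a b, [/\ ends e a b, lcon N a z & b = src e \/ b = dst e].
  by case: hz => h; [exists (src e), (dst e) | exists (dst e), (src e)]; split=> //;
    [left | right | right | left].
have [x xX bx] := side eE0 hb; have [z' zZ' xz'] := XZ xX.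
exists (z, z'); first by apply/allpairsP; exists (z, z').
exists a, b; split=> //; apply: (rst_trans _ _ _ x).
  by apply: lcon_sub bx => f; rewrite !mem_del => /andP[-> /E0S].
by apply: lcon_sub xz' => f fH; apply: (NS eE0 eH); rewrite mem_cat fH.
Qed.

(** [N] links [a1] to [a2] and avoids both edges. If [b1] and [b2] were linked without these edges,
    the detour over [a2] and [b2] would bypass the bridge [e1]. But the common second vertex does
    link them, unless one link meets the other edge, and then a bridge is bypassed as well. *)
Let code_inj e1 e2 zz : e1 \in boundary -> e2 \in boundary ->
  code e1 zz -> code e2 zz -> e1 = e2.
Proof.
rewrite !mem_filter => /andP[/andP[h1 _] i1] /andP[/andP[h2 _] i2].
move=> [a1 [b1 [n1 az1 bz1]]] [a2 [b2 [n2 az2 bz2]]].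
apply: contrapT => /eqP ne; have ne' : e2 != e1 by rewrite eq_sym.
have s (L : seq edge) u v : lcon L u v -> lcon L v u by apply: rst_sym.
pose M := del e2 (del e1 S).
have M1 : {subset M <= del e1 S} by apply: del_sub.
have M2 : {subset M <= del e2 S} by move=> f; rewrite !mem_del => /and3P[-> _ ->].
have ME f : f \in M = (f \in del e1 (del e2 S)) by rewrite !mem_del andbCA.
have aa : lcon M a1 a2.
  have : lcon N a1 a2 by apply: rst_trans az1 (s _ _ _ az2).
  by apply: lcon_sub => f fN; rewrite mem_del (NS i1 h1 fN) andbT; have := NS i2 h2 fN;
    rewrite mem_del => /andP[].
have B1 : ~ lcon (del e1 S) a1 b1 by apply: bridge_ends n1; apply: E0S.
have B2 : ~ lcon (del e2 S) a2 b2 by apply: bridge_ends n2; apply: E0S.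
have e2ab : lcon (del e1 S) a2 b2.
  have := @lcon_edge _ _ (del e1 S) e2; rewrite mem_del ne' E0S // => /(_ isT).
  by case: n2 => -[-> ->] //; apply: s.
have toE u v : ends e2 u v -> forall y, lcon M y (src e2) \/ lcon M y (dst e2) ->
    lcon M y u \/ lcon M y v.
  by move=> [[-> ->]|[-> ->]] y [h|h]; by [left | right].
have nb12 : ~ lcon M b1 b2.
  move=> /(lcon_sub M1) h; apply: B1; apply: rst_trans (lcon_sub M1 aa) _.
  by apply: rst_trans e2ab (s _ _ _ h).
have c1 : lcon M b1 zz.2.
  have [|/(toE _ _ n2)[h|//]] := lcon_del e2 (s _ _ _ bz1); first by apply: rst_sym.
  by case: B1; apply: rst_sym; apply: rst_trans (lcon_sub M1 h) (s _ _ _ (lcon_sub M1 aa)).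
have toE1 u v : ends e1 u v -> forall y, lcon M y (src e1) \/ lcon M y (dst e1) ->
    lcon M y u \/ lcon M y v.
  by move=> [[-> ->]|[-> ->]] y [h|h]; by [left | right].
have eqM u v : lcon (del e1 (del e2 S)) u v -> lcon M u v.
  by apply: lcon_sub => f; rewrite -ME.
have c2 : lcon M b2 zz.2.
  have [/eqM|h] := lcon_del e1 (s _ _ _ bz2); first by apply: rst_sym.
  have [|h'|h'] := toE1 _ _ n1 b2; first by case: h => /eqM; [left | right].
    by case: B2; apply: rst_sym; apply: rst_trans (lcon_sub M2 h') (lcon_sub M2 aa).
  by case: nb12; apply: s.
by apply: nb12; apply: rst_trans c1 (s _ _ _ c2).
Qed.

Lemma size_boundary : (size boundary <= size Z * size Z)%N.
Proof.
pose f e := head (0%N, 0%N) [seq zz <- [seq (z, z') | z <- Z, z' <- Z] | `[< code e zz >]].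
have fP e : e \in boundary -> f e \in [seq (z, z') | z <- Z, z' <- Z] /\ code e (f e).
  move=> /code_ex[zz zzin cz]; rewrite /f.
  set s := [seq _ <- _ | _]; have zs : zz \in s by rewrite mem_filter zzin andbT; apply/asboolP.
  have : head (0%N, 0%N) s \in s by case: (s) zs => //= ? ? _; rewrite mem_head.
  by rewrite mem_filter => /andP[/asboolP].
rewrite -(size_map f) -(size_allpairs pair Z Z); apply: uniq_leq_size.
  rewrite map_inj_in_uniq ?filter_uniq // => e1 e2 b1 b2 e12.
  have [_ c1] := fP _ b1; have [_ c2] := fP _ b2; rewrite -e12 in c2.
  exact: code_inj c1 c2.
by move=> zz /mapP[e /fP[h _] ->].
Qed.

Variables (T : seq edge) (A : seq (gedge (seq edge))) (t : nat).
Hypothesis TS : T =i unoriented S.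
Hypothesis endsS : forall e f, e \in S -> f \in S ->
  src e = src f -> dst e = dst f -> e = f.
Hypothesis ordS : forall e, e \in S -> (src e < dst e)%N.
Hypotheses (tZ : t \in Z) (AZ : forall p, p \in A -> (src p \in Z) && (dst p \in Z)).

Definition removed : seq (nat * nat) := [seq (src e, dst e) | e <- unoriented boundary].
Definition kept : seq (gedge (seq edge)) := A ++ map edge_walk N.
Definition searched : seq (gedge (seq edge)) :=
  A ++ [seq edge_walk e | e <- T & (src e, dst e) \notin removed].

(** Edges are removed by their pairs of ends, in both orientations. As edges of [S] point upwards
    and are determined by their ends, no edge of [N] is hit by accident. *)
Lemma kept_sub : {subset kept <= searched}.
Proof.
move=> p; rewrite !mem_cat => /orP[->//|/mapP[e eN ->]]; apply/orP; right.
have eS : e \in S.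
  by move: eN; rewrite mem_cat => /orP[/HE0/E0S//|]; rewrite mem_filter => /andP[].
apply/mapP; exists e; rewrite // mem_filter TS mem_unoriented eS andbT.
apply/mapP => -[f fB [sf df]].
have bS g : g \in boundary -> g \in S by rewrite mem_filter => /andP[_ /E0S].
move: fB; rewrite mem_unoriented => /orP[fB|/bS/ordS]; last first.
  by move: (ordS eS); rewrite /= sf df => h1 h2; have := ltn_trans h1 h2; rewrite ltnn.
have ef := endsS eS (bS f fB) sf df; rewrite -{}ef in fB.
by move: fB eN; rewrite mem_cat !mem_filter => /andP[/andP[/negbTE-> _] ->].
Qed.

(** All that [t] reaches in [kept] hangs on [Z] through [N], so an edge of [S] that leaves it lies
    on the boundary and has been removed. The rest of the discarded part is still in the search
    list, but out of reach. *)
Lemma kept_reach x : lcon searched t x -> lcon kept t x.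
Proof.
have keptZ y : lcon kept t y -> exists2 z, z \in Z & lcon N y z.
  move=> ty; apply: (con_closed (P := fun y => exists2 z, z \in Z & lcon N y z) _ ty);
    last by exists t => //; apply: rst_refl.
  move=> a b [p]; rewrite mem_cat => /orP[/AZ/andP[sZ dZ] [<- <-]|/mapP[e eN ->] [<- <-]].
    by split=> _; [exists (dst p) | exists (src p)] => //; apply: rst_refl.
  have ee := lcon_edge eN.
  by split=> -[z zZ h]; exists z => //; [apply: rst_trans (rst_sym _ _ _ _ ee) h
    | apply: rst_trans ee h].
move=> tx; apply: (con_closed (P := fun y => lcon kept t y) _ tx); last exact: rst_refl.
have key e : e \in S -> (src e, dst e) \notin removed ->
    lcon kept t (src e) \/ lcon kept t (dst e) -> lcon kept (src e) (dst e).
  move=> eS er hk; suff eN : e \in N.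
    by apply: (lcon_edge (e := edge_walk e)); rewrite mem_cat map_f ?orbT.
  rewrite mem_cat mem_filter eS andbT; case: (boolP (e \in H)) => //= eH.
  apply/negP => eE0; case/mapP: er; exists e => //; rewrite mem_unoriented.
  rewrite mem_filter eE0 eH andbT; apply/orP; left; apply/asboolP.
  by case: hk => /keptZ[z zZ h]; exists z => //; [left | right].
move=> a b [p]; rewrite mem_cat => /orP[pA [<- <-]|].
  have pk : lcon kept (src p) (dst p) by apply: lcon_edge; rewrite mem_cat pA.
  by split=> h; [apply: rst_trans h pk | apply: rst_trans h (rst_sym _ _ _ _ pk)].
case/mapP=> e; rewrite mem_filter TS mem_unoriented => /andP[er eS] -> [<- <-] /=.
have ab : lcon kept t (src e) \/ lcon kept t (dst e) -> lcon kept (src e) (dst e).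
  case/orP: eS => eS hk; first exact: key.
  apply: rst_sym; apply: (key (flip e)) => //; last by case: hk; [right | left].
  apply: contraNN er => /mapP[f fB [sf df]]; apply/mapP; exists (flip f).
    by rewrite mem_unoriented flipK orbC -mem_unoriented.
  by move: sf df; rewrite /flip /mkedge /src /dst /= => -> ->.
split=> h; first exact: rst_trans h (ab (or_introl h)).
exact: rst_trans h (rst_sym _ _ _ _ (ab (or_intror h))).
Qed.

End Prune.
End Boundary.

(** * Graphs and lists of edges *)

Section Trees.
Variable n : nat.
Implicit Types (T : graph n) (u v x y : 'I_n).

Lemma adj_sym T x y : adj T x y = adj T y x.
Proof. by rewrite /adj /= setUC. Qed.

Lemma adj_verts T x y : is_graph T -> adj T x y -> (x \in verts T) && (y \in verts T).
Proof. by move=> gT /gT[_ /subsetP s]; rewrite !s ?inE ?eqxx ?orbT. Qed.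

Lemma adj_neq T x y : is_graph T -> adj T x y -> x != y.
Proof. by move=> gT /gT[]; rewrite cards2; case: eqP. Qed.

Lemma set2_eq x y u v : ([set x; y] == [set u; v]) =
  ((x == u) && (y == v)) || ((y == u) && (x == v)).
Proof.
apply/eqP/idP => [e|/orP[]/andP[/eqP-> /eqP->] //]; last by rewrite setUC.
have hx : (x == u) || (x == v) by rewrite -in_set2 -e !inE eqxx.
have hy : (y == u) || (y == v) by rewrite -in_set2 -e !inE eqxx orbT.
have hu : (x == u) || (y == u) by rewrite ![_ == u]eq_sym -in_set2 e !inE eqxx.
have hv : (x == v) || (y == v) by rewrite ![_ == v]eq_sym -in_set2 e !inE eqxx orbT.
by move: hx hy hu hv; do 4!case: (_ == _).
Qed.

Definition add_leaf T u v : graph n := Graph (v |: verts T) ([set u; v] |: edges T).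

Lemma adj_add_leaf T u v x y :
  adj (add_leaf T u v) x y = ([set x; y] == [set u; v]) || adj T x y.
Proof. by rewrite /adj /= in_setU1. Qed.

Lemma add_leaf_tree T u v :
  is_tree T -> u \in verts T -> v \notin verts T -> is_tree (add_leaf T u v).
Proof.
move=> [gT [nT cT] aT] uT vT.
have uv : u != v by apply: contraNneq vT => <-.
have nv y : adj (add_leaf T u v) v y -> y = u.
  rewrite adj_add_leaf => /orP[/eqP e|/(adj_verts gT)]; last by rewrite (negbTE vT).
  have : u \in [set v; y] by rewrite e !inE eqxx.
  by rewrite !inE (negbTE uv) => /eqP.
split.
- move=> e; rewrite in_setU1 => /orP[/eqP->|/gT[-> s]].
    rewrite cards2 uv; split=> //; apply/subsetP => x; rewrite !inE => /orP[/eqP->|->//].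
    by rewrite uT orbT.
  by split=> //; apply: subset_trans s (subsetUr _ _).
- split; first by apply/set0Pn; exists v; rewrite !inE eqxx.
  have sub x y : connect (adj T) x y -> connect (adj (add_leaf T u v)) x y.
    by apply: connect_sub => a b ab; apply: connect1; rewrite adj_add_leaf ab orbT.
  have ctou x : x \in v |: verts T -> connect (adj (add_leaf T u v)) x u.
    rewrite in_setU1 => /orP[/eqP->|xT]; last exact/sub/cT.
    by apply: connect1; rewrite adj_add_leaf setUC eqxx.
  have csym : connect_sym (adj (add_leaf T u v)).
    by apply: sym_connect_sym => x y; apply: adj_sym.
  by move=> x y /ctou hx /ctou; rewrite csym; apply: connect_trans hx.
- move=> p cp; case: (boolP (v \in p)) => vp; last first.
    apply: aT; case/andP: cp => cp up; apply/andP; split=> //.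
    apply: (sub_in_cycle (P := mem p) (e := adj (add_leaf T u v))) cp; last exact/allP.
    move=> x y xp yp; rewrite adj_add_leaf => /orP[/eqP e|//].
    have : v \in [set x; y] by rewrite e !inE eqxx orbT.
    rewrite !inE => /orP[]/eqP ev.
      by case/negP: vp; rewrite ev; exact: xp.
    by case/negP: vp; rewrite ev; exact: yp.
  (* Turned so as to start at the leaf [v], the cycle visits [u] right after and right before it;
     its vertices being distinct, it has length 2. *)
  have [i q rq] := rot_to vp.
  rewrite -(size_rot i) rq; move: cp; rewrite -(rot_ucycle i) rq.
  case: q {rq} => [//|y q] /andP[/= /andP[/nv ->]].
  rewrite rcons_path => /andP[_]; rewrite adj_sym => /nv lu /and3P[_ uq _].
  case: q lu uq => //= z q lu; rewrite -{1}lu => /negP[].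
  exact: mem_last.
Qed.

End Trees.

Section GraphLists.
Variables (R : realType) (n : nat) (I : stp R n).
Local Notation gedge X := (gedge R X).
Local Notation edge := (edge R).
Local Notation G := (stp_graph I).
Implicit Types (T : graph n) (i j : 'I_n).

Definition gedge_of i j : edge := mkedge (ecost I [set i; j]) i j tt.

Definition is_edge (e : edge) : Prop := exists i j, adj G i j /\ e = gedge_of i j.

Lemma is_edgeP e : is_edge e -> [/\ 0 <= e.1, (src e < n)%N & (dst e < n)%N].
Proof. by move=> [i [j [ij ->]]]; split;
  [exact: (ecost_ge0 (s := I) ij) | exact: (ltn_ord i) | exact: (ltn_ord j)]. Qed.

Definition ends_in (F : seq edge) (u v : nat) : bool :=
  ((u, v) \in [seq (src e, dst e) | e <- F]) || ((v, u) \in [seq (src e, dst e) | e <- F]).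

Lemma ptree_graph r C F : (r < n)%N -> ptree r C F ->
  (forall e, e \in F -> is_edge e) ->
  exists T, [/\ is_tree T, subgraph T G, forall i, (i \in verts T) = ((i : nat) \in C),
    forall i j, adj T i j = ends_in F i j & cost I T = lcost F].
Proof.
move=> rn; elim=> [_|{}C {}F e hC IH eC hF].
  pose r0 := Ordinal rn; exists (Graph [set r0] set0).
  have adj0 i j : adj (Graph [set r0] set0) i j = false by rewrite /adj /= inE.
  split=> //.
  - split; first by move=> e; rewrite inE.
      split; first by apply/set0Pn; exists r0; rewrite inE.
      by move=> x y; rewrite !inE => /eqP-> /eqP->.
    by move=> [|x [|y p]] //; rewrite /ucycle /= adj0.
  - by split; rewrite ?sub0set // stp_verts subsetT.
  - by move=> i; rewrite !inE.
  - by rewrite /cost big_set0 lcost_nil.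
have [|T [tT sT vT aT cT]] := IH; first by move=> f fF; apply: hF; rewrite inE fF orbT.
have [i [j [ij ee]]] := hF e (mem_head _ _).
wlog [u [v [uv uC vC]]] : / exists u v, [/\ [set u; v] = [set i;
  j], (u : nat) \in C & (v : nat) \notin C].
  apply; rewrite ee /src /dst /= in eC; case: (boolP ((i : nat) \in C)) eC => iC /= jC.
    by exists i, j.
  by exists j, i; rewrite setUC.
have memC : forall k, (k \in v |: verts T) = ((k : nat) \in src e :: dst e :: C).
  move=> k; rewrite ee !inE vT /src /dst /=.
  have kij : (k == u) || (k == v) = ((k : nat) == i) || ((k : nat) == j).
    by have := erefl (k \in [set u; v]); rewrite {1}uv !inE -!val_eqE => ->.
  rewrite orbA -kij; case: (k =P u) => [->|_ //]; by rewrite uC !orbT.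
have uT : u \in verts T by rewrite vT.
have vT' : v \notin verts T by rewrite vT.
exists (add_leaf T u v); split=> //.
- exact: add_leaf_tree.
- split; first by rewrite stp_verts subsetT.
  case: sT => _ sT; rewrite subUset sT andbT sub1set uv; exact: ij.
- move=> k l; rewrite adj_add_leaf aT uv /ends_in /= !inE.
  rewrite ee /src /dst /= !xpair_eqE !val_eqE.
  rewrite set2_eq.
  by do 2!case: (_ && _); rewrite ?orbT.
- have nE : [set u; v] \notin edges T.
    apply/negP => uvE; have [gT _ _] := tT; have := adj_verts gT uvE.
    by rewrite (negbTE vT') andbF.
  by rewrite /cost /= big_setU1 //= -/(cost I T) cT lcost_cons uv ee.
Qed.

Definition tree_pairs T : {set 'I_n * 'I_n} :=
  [set p : 'I_n * 'I_n | (p.1 < p.2)%N && adj T p.1 p.2].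

(** Each edge is listed once and oriented upwards, so that costs add up and the ends determine the
    edge. *)
Definition tree_edges T : seq edge := [seq gedge_of p.1 p.2 | p <- enum (tree_pairs T)].

Lemma set2_ord (a b c d : 'I_n) : (a < b)%N -> (c < d)%N ->
  [set a; b] = [set c; d] -> (a, b) = (c, d).
Proof.
move=> ab cd e; have : (a \in [set c; d]) && (b \in [set c; d]) by rewrite -e !inE !eqxx orbT.
rewrite !inE => /andP[/orP[]/eqP ea /orP[]/eqP eb]; subst => //.
- by rewrite ltnn in ab.
- by have := ltn_trans ab cd; rewrite ltnn.
- by rewrite ltnn in ab.
Qed.

Lemma mem_tree_edges T e : reflect
  (exists i j, [/\ (i < j)%N, adj T i j & e = gedge_of i j]) (e \in tree_edges T).
Proof.
apply: (iffP mapP) => [[[i j]]|[i [j [ij aij ->]]]].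
  by rewrite mem_enum inE /= => /andP[ij aij] ->; exists i, j.
by exists (i, j) => //; rewrite mem_enum inE /= ij.
Qed.

Lemma tree_edges_ord T e : e \in tree_edges T -> (src e < dst e)%N.
Proof. by move/mem_tree_edges=> [i [j [ij _ ->]]]. Qed.

Lemma gedge_of_inj i j k l : val i = val k -> val j = val l -> gedge_of i j = gedge_of k l.
Proof. by move=> /val_inj-> /val_inj->. Qed.

Lemma tree_edges_ends T e f : e \in tree_edges T -> f \in tree_edges T ->
  src e = src f -> dst e = dst f -> e = f.
Proof.
by move=> /mem_tree_edges[i [j [_ _ ->]]] /mem_tree_edges[k [l [_ _ ->]]]; apply: gedge_of_inj.
Qed.

Lemma tree_edges_uniq T : uniq (tree_edges T).
Proof.
rewrite map_inj_uniq ?enum_uniq // => -[i j] [k l] e.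
have e1 : val i = val k by have := congr1 src e.
have e2 : val j = val l by have := congr1 dst e.
by rewrite (val_inj e1) (val_inj e2).
Qed.

Lemma flip_gedge_of i j : flip (gedge_of i j) = gedge_of j i.
Proof. by rewrite /flip /gedge_of /mkedge /src /dst /= setUC. Qed.

Lemma mem_tree_unoriented T e : is_graph T -> reflect
  (exists i j, adj T i j /\ e = gedge_of i j) (e \in unoriented (tree_edges T)).
Proof.
move=> gT; apply: (iffP idP); rewrite mem_unoriented.
  case/orP=> /mem_tree_edges[i [j [ij aij ee]]]; first by exists i, j.
  by exists j, i; rewrite adj_sym -[e]flipK ee flip_gedge_of.
move=> [i [j [aij ->]]]; rewrite flip_gedge_of.
have := adj_neq gT aij; rewrite -val_eqE neq_ltn => /orP[ij|ij]; apply/orP; [left|right].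
  by apply/mem_tree_edges; exists i, j.
by apply/mem_tree_edges; exists j, i; rewrite adj_sym.
Qed.

Lemma tree_edges_cost T : is_graph T -> lcost (tree_edges T) = cost I T.
Proof.
move=> gT; rewrite /lcost big_map big_enum /= /cost.
have -> : edges T = [set [set p.1; p.2] | p in tree_pairs T].
  apply/setP => e; apply/idP/imsetP => [eT|[[i j]]]; last first.
    by rewrite inE /= => /andP[_ aij] ->.
  have [eT2 _] := gT e eT; have h2 : #|e| == 2%N by rewrite eT2.
  have [a [b [ab ee]]] := cards2P _ h2.
  have aab : adj T a b by rewrite /adj /= -ee.
  move: ab; rewrite -val_eqE neq_ltn => /orP[ab|ab].
    by exists (a, b); last exact: ee; rewrite inE /= ab aab.
  exists (b, a); last by rewrite ee setUC.
  by rewrite inE /= ab adj_sym aab.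
rewrite big_imset //= => -[a b] [c d]; rewrite !inE /= => /andP[ab _] /andP[cd _].
exact: set2_ord.
Qed.

Lemma tree_edges_lcon T x y : is_graph T -> connect (adj T) x y -> lcon (tree_edges T) x y.
Proof.
move=> gT /connectP[p pp ->]; elim: p x pp => [|z p IHp] x /=; first by move=> _; apply: rst_refl.
case/andP=> xz /IHp; apply: rst_trans.
have /mem_tree_unoriented : exists i j, adj T i j /\ gedge_of x z = gedge_of i j by exists x, z.
move=> /(_ gT); rewrite mem_unoriented flip_gedge_of => /orP[] /lcon_edge //.
exact: rst_sym.
Qed.

Lemma tree_edges_bridge T e : is_tree T -> e \in tree_edges T ->
  ~ lcon (del e (tree_edges T)) (src e) (dst e).
Proof.
move=> [gT _ aT] /mem_tree_edges[a [b [ab aab ->]]].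
pose r : rel 'I_n := [rel x y | adj T x y && ([set x; y] != [set a; b])].
move=> h; have [b' eb cb] : exists2 b' : 'I_n, val b' = b & connect r a b'.
  apply: (con_closed (P := fun z => exists2 b' : 'I_n, val b' = z & connect r a b') _ h);
    last first.
    by exists a => //; apply: connect0.
  move=> x y [f]; rewrite mem_del => /andP[fe /mem_tree_edges[i [j [ij aij ef]]]].
  rewrite ef /src /dst /= => -[<- <-].
  have rij : r i j.
    rewrite /r /= aij; apply: contra fe => /eqP/(set2_ord ij ab) [ei ej].
    by rewrite ef ei ej.
  have rji : r j i by rewrite /r /= adj_sym setUC.
  split=> -[k /val_inj ek ck].
    by exists j => //; apply: connect_trans (connect1 rij); rewrite -ek.
  by exists i => //; apply: connect_trans (connect1 rji); rewrite -ek.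
have eb' : b' = b := val_inj eb; subst b'; case/connectP: cb => p pp lp.
(* A simple path that avoids the edge closes with it to a cycle. Its length is at least 3: the ends
   differ, and a path of one step would be the edge itself. *)
case: (shortenP pp) lp => p' pp' up' _ lp'.
have : ucycle (adj T) (a :: p').
  rewrite /ucycle up' andbT /= rcons_path -lp' (adj_sym T b) aab andbT.
  by apply: sub_path pp' => x y /andP[].
move/aT; case: p' pp' up' lp' => [|c [|d p']] //=.
  by move=> _ _ ba; rewrite ba ltnn in ab.
move=> /andP[/andP[_ nac] _] _ cb.
by move: nac; rewrite -cb eqxx.
Qed.

End GraphLists.

(** * The encoded instance *)

(** There are only finitely many pairs of a vertex set and an edge set. *)
Lemma optimal_exists (R : realType) n (I : stp R n) T :
  steiner_tree I T -> exists OPT, optimal I OPT.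
Proof.
move=> sT; pose G (p : {set 'I_n} * {set {set 'I_n}}) := Graph p.1 p.2.
have p0 : `[< steiner_tree I (G (verts T, edges T)) >] by apply/asboolP; case: (T) sT.
case: (@arg_minP _ _ _ (verts T, edges T) (fun p => `[< steiner_tree I (G p) >])
  (fun p => cost I (G p)) p0) => p /asboolP sp pmin.
exists (G p); split=> // -[V E] sT'; apply: (pmin (V, E)); exact/asboolP.
Qed.

Section Instance.
Variables (R : realType) (n : nat) (I : stp R n) (S : graph n) (t : 'I_n).
Local Notation gedge X := (gedge R X).
Local Notation edge := (edge R).
Local Notation G := (stp_graph I).
Local Notation I' := (add_terminal I t).

Definition bits (A : {set 'I_n}) : seq bool := [seq i \in A | i <- enum 'I_n].
Definition costs : seq (seq (option R)) :=
  [seq [seq (if adj G i j then Some (ecost I [set i; j]) else None) | j <- enum 'I_n]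
  | i <- enum 'I_n].
Definition matrix_of (T : graph n) : seq (seq bool) :=
  [seq [seq adj T i j | j <- enum 'I_n] | i <- enum 'I_n].
Definition inst := ((costs, bits (terminals I)),
  ((bits (verts S), matrix_of S), (costs, bits (terminals I')))).

Lemma enc_matrixE A `{Enc R A} (f : 'I_n -> 'I_n -> A) (g : 'I_n -> 'I_n -> data R) :
  (forall i j, enc (f i j) = g i j) ->
  enc [seq [seq f i j | j <- enum 'I_n] | i <- enum 'I_n] = enc_matrix g.
Proof.
move=> fg; rewrite /enc /enc_seq /enc_matrix -map_comp; congr of_list.
by apply: eq_map => i /=; rewrite /enc -map_comp; congr of_list; apply: eq_map => j; apply: fg.
Qed.

Lemma enc_bits A : enc (bits A) = enc_set R A.
Proof. by rewrite /enc /enc_seq /enc_set -map_comp. Qed.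

Lemma enc_costs : enc costs = enc_matrix (fun i j =>
  if adj G i j then Defs.Num (ecost I [set i; j]) else Defs.Nil).
Proof. by apply: enc_matrixE => i j; case: ifP. Qed.

Lemma enc_graphE T : enc (bits (verts T), matrix_of T) = enc_graph R T.
Proof.
rewrite /enc /enc_pair /= -/(enc (bits _)) enc_bits /enc_graph; congr Defs.Cons.
exact: enc_matrixE.
Qed.

(** The typed input of the algorithm is encoded by exactly the prescribed data, so nothing has to be
    parsed. *)
Lemma enc_inst : enc inst = enc_reopt I S I'.
Proof.
rewrite /enc_reopt /enc_stp -enc_graphE -!enc_bits.
by rewrite -[enc_matrix (fun i j => if adj (stp_graph I') i j then _ else _)]enc_costs.
Qed.

Lemma nth_enum_map A (d : A) (f : 'I_n -> A) (i : 'I_n) :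
  nth d [seq f i | i <- enum 'I_n] i = f i.
Proof. by rewrite (nth_map i) ?size_enum_ord // nth_ord_enum. Qed.

Lemma in_nE : in_n inst = n.
Proof. by rewrite /in_n size_map size_enum_ord. Qed.

Lemma in_vertsE : in_verts inst = [seq nat_of_ord i | i <- enum 'I_n].
Proof. by rewrite /in_verts in_nE val_enum_ord. Qed.

Lemma mem_in_verts u : u \in in_verts inst -> exists i : 'I_n, u = i.
Proof. by rewrite in_vertsE => /mapP[i _ ->]; exists i. Qed.

Lemma ord_in_verts (i : 'I_n) : (i : nat) \in in_verts inst.
Proof. by rewrite in_vertsE map_f // mem_enum. Qed.

Lemma mem_in_terms (i : 'I_n) : ((i : nat) \in in_terms inst) = (i \in t |: terminals I).
Proof. by rewrite mem_filter ord_in_verts andbT [nth _ _ _]nth_enum_map. Qed.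

Lemma in_termsP u : u \in in_terms inst -> exists2 i : 'I_n, u = i & i \in t |: terminals I.
Proof.
move=> uT; have := uT; rewrite mem_filter => /andP[_ /mem_in_verts[i ui]].
by exists i => //; rewrite -mem_in_terms -ui.
Qed.

Lemma in_newE : t \notin terminals I -> in_new inst = t.
Proof.
move=> tI; rewrite /in_new; set s := [seq _ <- _ | _].
have ts : (t : nat) \in s.
  by rewrite mem_filter mem_in_terms setU11 andbT [nth _ _ _]nth_enum_map.
have st u : u \in s -> u = t.
  rewrite mem_filter => /andP[h /in_termsP[i ui]]; rewrite ui [nth _ _ _]nth_enum_map in h.
  by rewrite in_setU1 (negbTE h) orbF ui => /eqP->.
by case: (s) ts st => // u s' _ h; apply: h; rewrite mem_head.
Qed.

Lemma mem_in_edges e : e \in in_edges inst <-> is_edge I e.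
Proof.
split.
  case/flattenP=> _ /mapP[u /mem_in_verts[i ->] ->] /flattenP[_ /mapP[v /mem_in_verts[j ->] ->]].
  rewrite [nth [::] _ _]nth_enum_map nth_enum_map; case: ifP => // ij.
  by rewrite inE => /eqP->; exists i, j.
move=> [i [j [ij ->]]]; apply/flattenP; eexists.
  by apply/mapP; exists (i : nat); first exact: ord_in_verts.
apply/flattenP; eexists.
  by apply/mapP; exists (j : nat); first exact: ord_in_verts.
by rewrite [nth [::] _ _]nth_enum_map nth_enum_map ij mem_head.
Qed.

Lemma mem_in_tree : subgraph S G -> is_graph S -> in_tree inst =i unoriented (tree_edges I S).
Proof.
move=> [_ SG] gS e; apply/idP/(mem_tree_unoriented I e gS).
  rewrite mem_filter => /andP[h /mem_in_edges[i [j [ij ee]]]]; exists i, j; split=> //.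
  by move: h; rewrite ee /src /dst /= [nth [::] _ _]nth_enum_map nth_enum_map.
move=> [i [j [ij ->]]]; rewrite mem_filter.
rewrite /src /dst /= [nth [::] _ _]nth_enum_map nth_enum_map ij; apply/mem_in_edges.
by exists i, j; split=> //; apply: (subsetP SG).
Qed.

Lemma out_treeE T (U : seq nat * seq edge) :
  (forall i : 'I_n, (i \in verts T) = ((i : nat) \in U.1)) ->
  (forall i j : 'I_n, adj T i j = ends_in U.2 i j) ->
  enc (out_tree inst U) = enc_graph R T.
Proof.
move=> hV hE; rewrite -enc_graphE; congr enc; rewrite /out_tree in_vertsE; congr pair.
  by rewrite -map_comp; apply: eq_map => i /=; rewrite hV.
rewrite -map_comp; apply: eq_map => i /=; rewrite -map_comp; apply: eq_map => j /=.
by rewrite hE.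
Qed.

End Instance.

(** * Selections that the search can find *)

Section Selection.
Variable R : realType.
Local Notation gedge X := (gedge R X).
Local Notation edge := (edge R).
Local Notation hyper := (hyper R).

Lemma mem_tuples (A : eqType) (l s : seq A) m :
  (s \in tuples l m) = (size s == m) && all (mem l) s.
Proof.
elim: m s => [|m IHm] s /=; first by rewrite inE; case: s.
apply/allpairsPdep/andP => [[x [w [xl]]]|].
  by rewrite IHm => /andP[/eqP <- wl] -> /=; rewrite eqxx xl.
by case: s => [[]//|x w [sz /= /andP[xl wl]]]; exists x, w; rewrite IHm -eqSS sz xl.
Qed.

Lemma hyper_decomp (L : seq edge) (X : seq nat) r :
  (forall e, e \in L -> 0 <= e.1) -> spans X (lrel L) ->
  exists D : seq hyper, [/\
    forall h, h \in D -> [/\ {subset h.1 <= X}, (size h.1 <= 3 * 2 ^ r.+1)%N,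
      (size h.2 <= 3 * 2 ^ r.+1)%N,
      forall z z', z \in h.1 -> z' \in h.1 -> lcon h.2 z z' &
      forall p, p \in h.2 -> is_walk (unoriented L) p],
    spans X (hrel D) & hcost D <= (1 + r.+1%:R^-1) * lcost L].
Proof.
move=> L0 hX; have L00 := lcost_ge0 L0.
have r0 : 0 < 1 + r.+1%:R^-1 :> R by rewrite ltr_wpDr // invr_ge0 ler0n.
case: X hX => [_|x X hX].
  by exists [::]; split=> //; rewrite /hcost big_nil mulr_ge0 // ltW.
have [h|[w [b [/andP[_ wb] bX Xb cb sb]]]] := bt_of_edges (x :: X) x L0.
  by case: (h x); rewrite ?mem_head //; apply: rst_refl.
have subb : {subset bedges b <= unoriented L} by move=> e eb; apply: sb; rewrite mem_cat eb orbT.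
have u0 e : e \in unoriented L -> 0 <= e.1 by rewrite mem_unoriented => /orP[/L0|/L0].
have [|D [gD sD cD]] := borchers_du r wb; first by move=> e /subb/u0.
have w0 : 0 <= lcost w by apply: lcost_ge0 => e ew; apply/u0/sb; rewrite mem_cat ew.
exists D; split.
- move=> h /gD[h1 h2 h3 h4 h5]; split=> //; first by move=> z /h1/bX.
  by move=> p /h5; apply: is_walk_sub.
- by move=> y z yX zX; apply: sD; apply: Xb => //; apply: hX; rewrite ?mem_head.
- by apply: le_trans cD _; rewrite ler_pM2l //; move: cb; rewrite lcost_cat; lra.
Qed.

(** Shortest paths with the same ends cost no more than the given walks. This is how a search over
    shortest paths simulates the hyperedges of an unknown tree. *)
Lemma select_paths (E : seq edge) (V : seq nat) n (W : seq (gedge (seq edge))) :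
  (forall e, e \in E -> (src e \in V) && (dst e \in V)) ->
  (forall e, e \in E -> 0 <= e.1) -> V =i iota 0 n ->
  (forall p, p \in W -> is_walk E p /\ src p \in V) ->
  exists A, [/\ size A = size W, {subset A <= paths E V n}, lcost A <= lcost W,
    forall p, p \in A -> exists2 q, q \in W & src q = src p /\ dst q = dst p &
    forall q, q \in W -> exists2 p, p \in A & src p = src q /\ dst p = dst q].
Proof.
move=> EV E0 Vn; elim: W => [_|q W IHW hW]; first by exists [::]; split.
have [|A [sA AP cA AW WA]] := IHW; first by move=> p pW; apply: hW; rewrite inE pW orbT.
have [[wq qc qE] sq] := hW q (mem_head _ _).
have [p [pP sp dp pc]] := in_paths_le EV E0 Vn qE sq wq.
exists (p :: A); split.
- by rewrite /= sA.
- by move=> f; rewrite inE => /orP[/eqP->|/AP].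
- by rewrite !lcost_cons lerD // qc.
- move=> f; rewrite inE => /orP[/eqP->|/AW[g gW fg]]; first by exists q; rewrite ?mem_head.
  by exists g; rewrite // inE gW orbT.
- move=> f; rewrite inE => /orP[/eqP->|/WA[g gW fg]]; first by exists p; rewrite ?mem_head.
  by exists g; rewrite // inE gW orbT.
Qed.

Lemma used_edges (E W : seq edge) : (forall e, e \in E -> 0 <= e.1) ->
  {subset W <= unoriented E} ->
  exists H, [/\ {subset H <= E}, {subset W <= unoriented H} & lcost H <= lcost W].
Proof.
move=> E0; elim: W => [_|e W IHW hW]; first by exists [::]; split.
have [|H [HE WH cH]] := IHW; first by move=> f fW; apply: hW; rewrite inE fW orbT.
have [f [fE fc ef]] : exists f, [/\ f \in E, f.1 = e.1 & f = e \/ f = flip e].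
  by have := hW e (mem_head _ _); rewrite mem_unoriented => /orP[]; [exists e | exists (flip e)];
    split=> //; [left | right].
have fe : e \in unoriented (f :: H).
  by rewrite mem_unoriented !inE; case: ef => ->; rewrite eqxx ?orbT.
exists (f :: H); split.
- by move=> g; rewrite inE => /orP[/eqP->|/HE].
- move=> g; rewrite inE => /orP[/eqP->//|/WH].
  by apply: unoriented_sub => k kH; rewrite inE kH orbT.
- by rewrite !lcost_cons fc lerD2l.
Qed.

Lemma unoriented_lcon (L : seq edge) x y : lcon (unoriented L) x y -> lcon L x y.
Proof.
apply: con_sub => a b [e]; rewrite mem_unoriented => /orP[/lcon_edge eL|/lcon_edge eL] [<- <-] //.
exact: rst_sym.
Qed.

(** A candidate is correct whatever selection produced it: selections that fail to span the
    terminals are rejected by the test in [finish]. *)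
Lemma finish_sound (E : seq edge) r n Z (L : seq (gedge (seq edge))) y :
  (forall p, p \in L -> {subset pay p <= E}) -> y \in finish r n Z L ->
  [/\ y.1 = lcost y.2.2, ptree r y.2.1 y.2.2, {subset y.2.2 <= E} & {subset Z <= y.2.1}].
Proof.
move=> LE; rewrite /finish.
set D := flatten _; case: ifP => // /allP hZ; rewrite inE => /eqP-> /=.
have [hK KL] := pstate_ptree L r n; rewrite /pstate -/(prim L r n) in hK KL.
have [hT TD] := pstate_ptree D r n; rewrite /pstate -/(prim D r n) in hT TD.
split=> // e /TD/flattenP[_ /mapP[p /KL pL ->]]; exact: LE.
Qed.

End Selection.

Section Instance.
Variables (R : realType) (n : nat) (I : stp R n).
Local Notation gedge X := (gedge R X).
Local Notation edge := (edge R).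
Local Notation G := (stp_graph I).

Lemma tree_of_edges (L : seq edge) (r : 'I_n) :
  (forall e, e \in L -> is_edge I e) ->
  exists T, [/\ is_tree T, subgraph T G, cost I T <= lcost L &
    forall i : 'I_n, lcon L r i -> i \in verts T].
Proof.
move=> hL; have [hp pL] := pstate_ptree L r n.
have [|T [tT sT vT _ cT]] := ptree_graph (I := I) (ltn_ord r) hp.
  by move=> e /pL/hL.
exists T; split=> //.
  by rewrite cT; apply: prim_le => // e /hL/is_edgeP[].
move=> i ri; rewrite vT; apply: prim_reach ri => // e /hL/is_edgeP[_ -> ->] //.
Qed.

Definition terms : seq nat := [seq nat_of_ord i | i <- enum (terminals I)].

Lemma mem_terms (i : 'I_n) : ((i : nat) \in terms) = (i \in terminals I).
Proof. by rewrite mem_map ?mem_enum //; apply: ord_inj. Qed.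

Lemma termsP u : u \in terms -> exists2 i : 'I_n, u = i & i \in terminals I.
Proof. by case/mapP=> i; rewrite mem_enum => iT ->; exists i. Qed.

Lemma steiner_spans T : steiner_tree I T -> spans terms (lrel (tree_edges I T)).
Proof.
move=> [[gT [_ cT] _] _ /subsetP sT] x y /termsP[i -> iT] /termsP[j -> jT].
by apply: tree_edges_lcon => //; apply: cT; apply: sT.
Qed.

Lemma tree_edges_is_edge T e : subgraph T G -> e \in tree_edges I T -> is_edge I e.
Proof.
move=> [_ /subsetP sE] /mem_tree_edges[i [j [_ ij ->]]]; exists i, j; split=> //.
exact: sE.
Qed.

Lemma is_edge_flip e : is_edge I e -> is_edge I (flip e).
Proof. by move=> [i [j [ij ->]]]; exists j, i; rewrite flip_gedge_of adj_sym. Qed.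

Lemma unoriented_is_edge L e : (forall e, e \in L -> is_edge I e) ->
  e \in unoriented L -> is_edge I e.
Proof.
move=> hL; rewrite mem_unoriented => /orP[/hL//|/hL/is_edge_flip]; by rewrite flipK.
Qed.

Lemma optimal_le OPT (L : seq edge) (r : 'I_n) : optimal I OPT ->
  (forall e, e \in L -> is_edge I e) -> spans terms (lrel L) -> cost I OPT <= lcost L.
Proof.
move=> [_ hO] hL hX.
(* If there are no terminals, any vertex serves as the root. *)
pose r0 := if [pick i in terminals I] is Some i then i else r.
have [T [tT sT cT vT]] := tree_of_edges r0 hL.
apply: le_trans cT; apply: hO; split=> //; apply/subsetP => i iT; apply: vT.
apply: hX; rewrite mem_terms // /r0; case: pickP => [j //|/(_ i)]; by rewrite iT.
Qed.

End Instance.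

(** * The cost of the computed tree *)

Section Families.
Variables (R : realType) (D : seq (hyper R)).
Local Notation edge := (edge R).

Definition fam (j : 'I_(size D)) : hyper R := tnth (in_tuple D) j.

Lemma fam_in j : fam j \in D.
Proof. exact: mem_tnth. Qed.

Lemma fam_spans X : spans X (hrel D) -> spans X (frel (fun j => (fam j).1) setT).
Proof.
apply: spans_sub => // x y [h /(tnthP (in_tuple D))[j ->] xy].
by apply: rst_step; exists j.
Qed.

Lemma fam_cost : \sum_j lcost (fam j).2 = hcost D.
Proof. by rewrite /hcost [RHS]big_tnth. Qed.

Definition fam_walks (P : {set 'I_(size D)}) := flatten [seq (fam j).2 | j <- enum P].

Lemma fam_walks_cost P : lcost (fam_walks P) = \sum_(j in P) lcost (fam j).2.
Proof.
rewrite /fam_walks -big_enum /=; elim: (enum _) => [|j s IHs] /=.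
  by rewrite big_nil lcost_nil.
by rewrite lcost_cat IHs big_cons.
Qed.

Lemma mem_fam_walks (P : {set 'I_(size D)}) p : reflect (exists2 j,
  j \in P & p \in (fam j).2) (p \in fam_walks P).
Proof.
apply: (iffP flattenP) => [[_ /mapP[j + ->]]|[j jP pj]]; first by rewrite mem_enum; exists j.
by exists (fam j).2 => //; apply: map_f; rewrite mem_enum.
Qed.

Lemma size_flatten_enum (A : eqType) (f : 'I_(size D) -> seq A) (P : {set 'I_(size D)}) K :
  (forall j, size (f j) <= K)%N -> (size (flatten [seq f j | j <- enum P]) <= #|P| * K)%N.
Proof.
move=> fK; rewrite cardE; elim: (enum _) => //= j s IHs.
by rewrite size_cat mulSn leq_add.
Qed.

Definition pays (W : seq (gedge R (seq edge))) : seq edge := flatten [seq pay p | p <- W].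

End Families.

Section Pays.
Variable R : realType.
Local Notation edge := (edge R).
Implicit Type W : seq (gedge R (seq edge)).

Lemma pays_cost W (L : seq edge) : (forall p, p \in W -> is_walk L p) -> lcost (pays W) = lcost W.
Proof.
rewrite /pays; elim: W => [|p W IHW] hW; first by rewrite !lcost_nil.
rewrite /= lcost_cat lcost_cons IHW; last by move=> q qW; apply: hW; rewrite inE qW orbT.
by have [_ -> _] := hW p (mem_head _ _).
Qed.

Lemma pays_sub W (L : seq edge) : (forall p, p \in W -> is_walk L p) -> {subset pays W <= L}.
Proof. by move=> hW e /flattenP[_ /mapP[p /hW[_ _ s] ->] /s]. Qed.

Lemma pays_lcon W (L : seq edge) x y : (forall p, p \in W -> is_walk L p) ->
  lcon W x y -> lcon (pays W) x y.
Proof.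
move=> hW; apply: con_sub => a b [p pW [<- <-]].
have [/walk_lcon h _ _] := hW p pW; apply: lcon_sub h => e ep.
by apply/flattenP; exists (pay p) => //; apply: map_f.
Qed.

End Pays.

Section Main.
Variables (R : realType) (eps : R).
Hypothesis eps0 : 0 < eps.

(** With [q = r.+1%:R^-1] and [rho <= 2], the rounding errors in [swap_arith] sum to at most
    [6 * q * cT], which has to stay below [eps / 2 * cT]; hence 12. The hyperedges of the new tree
    weigh at most [2 * cT], and [m] portions of [eps / 2 * cT] cover this; hence 4. *)
Let r := Num.bound (12 / eps).
Let m := Num.bound (4 / eps).
Let K := (3 * 2 ^ r.+1)%N.
Let M := chain_bound K m 2 0.
(** At most [M] hyperedges are moved, each with at most [K] terminals and [K] walks. Attachment
    vertices are [t], their terminals and both ends of each added path. Boundary edges correspond to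
    pairs of attachment vertices and are removed in two orientations. *)
Let zmax := ((M * K + 2 * (M * K)).+1)%N.
Definition n_added := (M * K)%N.
Definition n_removed := (2 * (zmax * zmax))%N.

Lemma r_small : r.+1%:R^-1 <= eps / 12.
Proof.
have h : 12 / eps < r%:R by apply: archi_boundP; rewrite divr_ge0 // ltW.
have r0 : 0 < r.+1%:R :> R by rewrite ltr0n.
rewrite -[_ / 12]invrK invf_div lef_pV2 ?posrE ?divr_gt0 //.
by apply: le_trans (ltW h) _; rewrite ler_nat.
Qed.

Lemma m_large : 2 <= m%:R * (eps / 2).
Proof.
have h : 4 / eps < m%:R by apply: archi_boundP; rewrite divr_ge0 // ltW.
have e2 : 4 / eps * (eps / 2) = 2 by field; rewrite gt_eqF.
by rewrite -[leLHS]e2 ler_pM2r ?divr_gt0 // ltW.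
Qed.

Lemma swap_arith q rho cT cO cS A a a' b p p' f J H :
  0 <= q -> q <= 1 -> q <= eps / 12 -> 1 <= rho -> rho <= 2 -> 0 <= cT ->
  cO <= cT -> cS <= rho * cO -> 0 <= J -> J + f = cS ->
  A <= a + a' -> a' <= eps / 2 * cT -> p + p' <= (1 + q) * f -> H <= p' ->
  cO <= b + p -> a + b <= (1 + q) * cT ->
  A + (H + J) <= (rho + eps) * cT.
Proof.
move=> q0 q1 qe rho1 rho2 cT0 OT SO J0 Jf Aa a'e pf Hp Ob ab.
have qcT : q * cT <= eps / 12 * cT by rewrite ler_wpM2r.
have qcT0 : 0 <= q * cT by rewrite mulr_ge0.
have rq2 : rho * (q * cT) <= 2 * (q * cT) by rewrite ler_wpM2r.
have qJ : 0 <= q * J by rewrite mulr_ge0.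
have main : A + (H + J) <= a - p + eps / 2 * cT + (1 + q) * cS.
  by rewrite -Jf; move: pf qJ; rewrite !mulrDl !mulrDr; lra.
apply: le_trans main _; case: (leP a p) => [le|lt].
  have : (1 + q) * cS <= (1 + q) * (rho * cT).
    rewrite ler_wpM2l ?addr_ge0 //; apply: le_trans SO _; rewrite ler_wpM2l //.
    exact: le_trans rho1.
  have -> : (1 + q) * (rho * cT) = rho * cT + rho * (q * cT) by ring.
  by move: qcT rq2; rewrite mulrDl; lra.
have h1 : (1 + q) * cS <= (1 + q) * (rho * ((1 + q) * cT - (a - p))).
  rewrite ler_wpM2l ?addr_ge0 //; apply: le_trans SO _; rewrite ler_wpM2l //.
    exact: le_trans rho1.
  by lra.
have h2 : 1 * (a - p) <= (1 + q) * rho * (a - p).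
  have qr : 0 <= q * rho by rewrite mulr_ge0 // (le_trans _ rho1).
  have ap : 0 <= a - p by rewrite subr_ge0 ltW.
  by apply: (ler_wpM2r ap); rewrite mulrDl mul1r; lra.
have qq : q * (q * cT) <= 1 * (q * cT) by rewrite ler_wpM2r.
have rqq : rho * (q * (q * cT)) <= 2 * (q * (q * cT)).
  by rewrite ler_wpM2r // mulr_ge0.
have e1 : (1 + q) * (rho * ((1 + q) * cT - (a - p))) =
  rho * cT + 2 * (rho * (q * cT)) + rho * (q * (q * cT)) - (1 + q) * rho * (a - p) by ring.
by move: h1 h2 qcT rq2 qq rqq; rewrite e1 !mul1r [(rho + eps) * _]mulrDl; lra.
Qed.

Variables (n : nat) (I : stp R n) (S : graph n) (t : 'I_n) (rho : R).
Variables (OPT OPT' : graph n).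
Local Notation I' := (add_terminal I t).
Local Notation x := (inst I S t).
Hypotheses (stS : steiner_tree I S) (tI : t \notin terminals I).
Hypotheses (optI : optimal I OPT) (optI' : optimal I' OPT').
Hypothesis Srho : cost I S <= rho * cost I OPT.
Hypothesis rho1 : 1 <= rho.

Lemma opt_le : cost I OPT <= cost I OPT'.
Proof.
have [_ hO] := optI; have [[tT sT uT] _] := optI'; apply: hO; split=> //.
exact: subset_trans (subsetUr _ _) uT.
Qed.

Lemma terms_add : terms I' =i (t : nat) :: terms I.
Proof.
move=> u; rewrite inE; apply/idP/orP => [/termsP[i -> ]|[/eqP->|/termsP[i -> iI]]].
- by rewrite in_setU1 => /orP[/eqP->|iI]; [left | right; rewrite mem_terms].
- by rewrite (mem_terms I' t) setU11.
- by rewrite (mem_terms I' i) in_setU1 iI orbT.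
Qed.

Lemma in_terms_terms : in_terms x =i terms I'.
Proof.
move=> u; apply/idP/idP => [/in_termsP[i -> iT]|/termsP[i -> iT]].
  by rewrite (mem_terms I' i).
by rewrite mem_in_terms.
Qed.

Let E := in_edges x.
Let V := in_verts x.

Let EI e : e \in E <-> is_edge I e. Proof. exact: mem_in_edges. Qed.
Let E0 e : e \in E -> 0 <= e.1. Proof. by move=> /EI/is_edgeP[]. Qed.
Let Vn : V =i iota 0 n. Proof. by move=> u; rewrite /V /in_verts in_nE. Qed.
Let EV e : e \in E -> (src e \in V) && (dst e \in V).
Proof. by move=> /EI[i [j [_ ->]]]; rewrite /src /dst /= !ord_in_verts. Qed.

Let pathsP p : p \in in_paths x -> [/\ valid E p, src p \in V & dst p \in V].
Proof. exact: paths_valid. Qed.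

Let Vlt u : u \in V -> (u < n)%N. Proof. by rewrite Vn mem_iota. Qed.

Let pathsE p : p \in in_paths x -> [/\ valid E p, (src p < n)%N & (dst p < n)%N].
Proof. by move=> /pathsP[h /Vlt s /Vlt d]. Qed.

Let walks_in T p : subgraph T (stp_graph I) ->
  is_walk (unoriented (tree_edges I T)) p -> is_walk E p.
Proof.
move=> sT; apply: is_walk_sub => e /(unoriented_is_edge (fun e => tree_edges_is_edge sT))/EI.
by [].
Qed.

Let tree_ge0 T : subgraph T (stp_graph I) -> forall e, e \in tree_edges I T -> 0 <= e.1.
Proof. by move=> sT e /(tree_edges_is_edge sT)/is_edgeP[]. Qed.

Let steiner_spans' : spans (terms I') (lrel (tree_edges I OPT')).
Proof. by have [sT _] := optI'; apply: (steiner_spans sT). Qed.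

(** The tour around an optimal tree, with its links replaced by shortest paths, is a competitor in
    the metric closure of the terminals. *)
Lemma mst_cand_cost : exists T, mst_cand x = [:: (lcost T.2, T)] /\
  lcost T.2 <= 2 * cost I OPT'.
Proof.
have [[tT sT uT] _] := optI'; have gT : is_graph OPT' by case: tT.
have tU : (t : nat) \in terms I' by rewrite terms_add mem_head.
have [h|[w [b [/andP[_ wb] bU Ub cb sb]]]] :=
    bt_of_edges (terms I') t (tree_ge0 sT).
  by case: (h t tU); apply: rst_refl.
have [W [WP Wc Wcost]] := tour wb.
have subb : {subset unoriented (bedges b) <= unoriented (tree_edges I OPT')}.
  have sb' e : e \in bedges b -> e \in unoriented (tree_edges I OPT').
    by move=> eb; apply: sb; rewrite mem_cat eb orbT.
  move=> e; rewrite mem_unoriented => /orP[/sb'//|/sb'].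
  by rewrite !mem_unoriented flipK orbC.
have UV u : u \in terms I' -> u \in V by move=> /termsP[i -> _]; apply: ord_in_verts.
have [|A [_ AP cA AW WA]] := @select_paths R E V n W EV E0 Vn.
  move=> p /WP[h s _]; split; last by apply/UV/bU.
  by apply: (walks_in sT); apply: is_walk_sub subb h.
set L := [seq p <- in_paths x | (src p \in in_terms x) && (dst p \in in_terms x)].
have AL : {subset A <= L}.
  move=> p pA; have [q /WP[_ sq dq] [es ed]] := AW p pA.
  rewrite mem_filter !in_terms_terms -es -ed bU // bU //=.
  by have := AP p pA; rewrite /in_paths in_nE.
have Wcon u : u \in terms I' -> lcon A t u.
  have all u' : u' \in leaves b -> lcon A (lleaf b) u'.
    move=> /Wc; apply: con_sub => a c [q /WA[p pA [<- <-]] [<- <-]]; exact: lcon_edge.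
  have con' u' : u' \in terms I' -> u' \in leaves b.
    by move=> uU; apply: Ub => //; apply: steiner_spans'.
  by move=> /con'/all; apply: rst_trans; apply/rst_sym/all/con'.
have [|||||T [mT _ _ _ Tc]] := @finishP R E n t (in_terms x) L A (ltn_ord t).
- by move=> e /EI/is_edgeP.
- by move=> p; rewrite mem_filter => /andP[_ /pathsE].
- exact: AL.
- move=> u tu; apply: Wcon.
  apply: (con_closed (P := fun u => u \in terms I') _ tu) => //.
  move=> c d [p]; rewrite mem_filter !in_terms_terms => /andP[/andP[sU dU] _] [<- <-].
  by split.
- move=> z; rewrite in_terms_terms => /Wcon; exact: lcon_sub.
exists T; split; first by rewrite /mst_cand in_newE // in_nE.
apply: le_trans Tc (le_trans cA _).
have wc : 0 <= lcost w + lcost (lpath b) + lcost (rpath b).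
  have u0 e : e \in w ++ bedges b -> 0 <= e.1.
    by move=> /sb; rewrite mem_unoriented => /orP[]/(tree_ge0 sT).
  rewrite !addr_ge0 //; apply: lcost_ge0 => e h; apply: u0; rewrite mem_cat ?h //.
    by rewrite lpath_sub ?orbT.
  by rewrite rpath_sub ?orbT.
rewrite -(tree_edges_cost I gT); move: cb Wcost wc; rewrite lcost_cat mulr2n.
have w0 : 0 <= lcost w.
  apply: lcost_ge0 => e h; have := sb e; rewrite mem_cat h => /(_ isT).
  by rewrite mem_unoriented => /orP[]/(tree_ge0 sT).
by lra.
Qed.

Lemma swap_cand_cost : rho <= 2 -> exists A D T, [/\
  A \in tuples (in_paths x) n_added, D \in tuples (in_pairs x) n_removed,
  swap_cand x A D = [:: (lcost T.2, T)] &
  lcost T.2 <= (rho + eps) * cost I OPT'].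
Proof.
move=> rho2; have [treeS sS _] := stS; have [gS _ _] := treeS.
have [[treeT sT _] _] := optI'; have [gT _ _] := treeT.
set X := terms I; set U := terms I'; set LS := tree_edges I S; set LT := tree_edges I OPT'.
have UtX : U =i (t : nat) :: X := terms_add.
have XU : {subset X <= U} by move=> u uX; rewrite UtX inE uX orbT.
have LS0 e : e \in LS -> 0 <= e.1 by apply: tree_ge0.
have [F0 [uF0 F0S spanF0 minF0]] :=
  minimal_edges (tree_edges_uniq I S) (steiner_spans stS).
rewrite -/LS in F0S; have F00 e : e \in F0 -> 0 <= e.1 by move=> /F0S/LS0.
have F0in : {subset unoriented F0 <= unoriented LS} by apply: unoriented_sub.
have [DS [gDS spanDS cDS]] := hyper_decomp r F00 spanF0.
have [DT [gDT spanDT cDT]] := hyper_decomp r (tree_ge0 sT) steiner_spans'.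
rewrite -/U in gDT spanDT; rewrite -/X in gDS spanDS; rewrite -/LT in gDT cDT.
have walkS j p : p \in (fam (D := DS) j).2 -> is_walk (unoriented F0) p.
  by move=> pj; have [_ _ _ _ h] := gDS _ (fam_in j); apply: h.
have walkT j p : p \in (fam (D := DT) j).2 -> is_walk E p.
  by move=> pj; have [_ _ _ _ h] := gDT _ (fam_in j); apply: (walks_in sT); apply: h.
have walkSE p : is_walk (unoriented F0) p -> is_walk E p.
  by move=> pw; apply: (walks_in sS); apply: is_walk_sub pw.
have cost0 p : is_walk E p -> 0 <= p.1.
  by move=> [_ -> s]; apply: lcost_ge0 => e /s; apply: E0.
set cT := cost I OPT'.
have cTE : lcost LT = cT by apply: tree_edges_cost.
have cT0 : 0 <= cT by rewrite -cTE; apply/lcost_ge0/tree_ge0.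
pose delta := eps / 2 * cT.
have delta0 : 0 <= delta by rewrite mulr_ge0 // divr_ge0 // ltW.
have r1 : 0 <= (r.+1%:R^-1 : R) <= 1 by rewrite invr_ge0 ler0n invf_le1 ?ltr0n // ler1n.
have totT : \sum_j lcost (fam (D := DT) j).2 <= (1 + r.+1%:R^-1) * cT.
  by rewrite fam_cost -cTE.
have totTm : \sum_j lcost (fam (D := DT) j).2 <= m%:R * delta.
  apply: le_trans totT _; rewrite /delta mulrA ler_wpM2r //.
  by apply: le_trans m_large; rewrite -[2]/(1 + 1) lerD2l; case/andP: r1.
have w0 j : 0 <= lcost (fam (D := DT) j).2.
  by apply: lcost_ge0 => p /walkT/cost0.
have [j|j|j|j|||P [Q [Q' [hex Q'd szQ]]]] := @exchange_exists R _ _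
    (fun j => (fam (D := DS) j).1) (fun j => (fam (D := DT) j).1)
    (fun j => lcost (fam (D := DT) j).2) X U K delta delta0 w0 XU _ _ _ _ _ _ m t UtX totTm.
- by have [h _ _ _ _] := gDS _ (fam_in j).
- by have [h _ _ _ _] := gDT _ (fam_in j).
- by have [_ h _ _ _] := gDS _ (fam_in j).
- by have [_ h _ _ _] := gDT _ (fam_in j).
- exact: fam_spans.
- exact: fam_spans.
have [Q'Q hA hB] := hex; set QQ := Q :|: Q' in szQ.
pose W0 := fam_walks QQ.
have W0E p : p \in W0 -> is_walk E p by case/mem_fam_walks=> j _; apply: walkT.
(* An empty walk may sit at a number that is no vertex. Such walks connect nothing and are
   dropped. *)
pose W1 := [seq p <- W0 | src p \in V].
have szW1 : (size W1 <= M * K)%N.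
  rewrite (leq_trans (_ : _ <= size W0)%N) ?size_filter ?count_size //.
  apply: leq_trans (size_flatten_enum (K := K) _ _) _; last by rewrite leq_mul2r szQ orbT.
  by move=> j; have [_ _ h _ _] := gDT _ (fam_in j).
have W01 u v : lcon W0 u v -> lcon W1 u v.
  apply: con_sub => c d [p pW [<- <-]]; have [pV|pV] := boolP (src p \in V).
    by apply: lcon_edge; rewrite mem_filter pV.
  have [+ _ s] := W0E p pW; case: (pay p) s => [_ /eqP->|e w s /andP[/eqP es _]].
    exact: rst_refl.
  have /EV/andP[+ _] : e \in E by apply: s; rewrite mem_head.
  by rewrite es (negbTE pV).
have [|A [szA AP cA AW WA]] := @select_paths R E V n W1 EV E0 Vn.
  by move=> p; rewrite mem_filter => /andP[pV /W0E].
have tV : (t : nat) \in V := ord_in_verts _ _ _ _.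
(* A trivial path at [t], of cost at most 0, fills the selection up to its exact length. *)
have [|q0 [q0P sq0 dq0 cq0]] := @in_paths_le R E V EV n [::] t t E0 Vn _ tV (eqxx _) => //.
have pathsn : in_paths x = paths E V n by rewrite /in_paths in_nE.
pose A1 := A ++ nseq (n_added - size A) q0.
have szA1 : size A1 = n_added by rewrite size_cat size_nseq subnKC // szA.
have A1P : {subset A1 <= in_paths x}.
  by move=> p; rewrite pathsn mem_cat => /orP[/AP//|/nseqP[-> _]].
have cA1 : lcost A1 <= lcost W1.
  apply: le_trans cA; rewrite lcost_cat gerDl; elim: (n_added - _)%N => [|k IHk] /=.
    by rewrite lcost_nil.
  rewrite lcost_cons -[leRHS]addr0 lerD //; by rewrite lcost_nil in cq0.
pose Ws := fam_walks (~: P).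
have WsF p : p \in Ws -> is_walk (unoriented F0) p by case/mem_fam_walks=> j _; apply: walkS.
have [H [HF0 WsH cH]] := used_edges F00 (pays_sub WsF).
rewrite (pays_cost WsF) fam_walks_cost in cH.
pose Z := (t : nat) :: flatten [seq (fam j).1 | j <- enum QQ] ++ map src A ++ map dst A.
have szZ : (size Z <= zmax)%N.
  rewrite /= ltnS !size_cat !size_map szA addnn -mul2n leq_add ?leq_mul //.
  apply: leq_trans (size_flatten_enum (K := K) _ _) _; last by rewrite leq_mul2r szQ orbT.
  by move=> j; have [_ h _ _ _] := gDT _ (fam_in j).
have inZ j u : j \in QQ -> u \in (fam j).1 -> u \in Z.
  move=> jQ ju; rewrite inE mem_cat; apply/or3P/Or32/flattenP.
  by exists (fam j).1 => //; apply: map_f; rewrite mem_enum.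
have AZ p : p \in A1 -> (src p \in Z) && (dst p \in Z).
  rewrite mem_cat => /orP[pA|/nseqP[-> _]]; last by rewrite sq0 dq0 mem_head.
  by rewrite !inE !mem_cat !map_f ?orbT.
have conH j u v : j \notin P -> u \in (fam j).1 -> v \in (fam j).1 -> lcon H u v.
  move=> jP ju jv; have [_ _ _ h _] := gDS _ (fam_in j).
  apply/unoriented_lcon; apply: lcon_sub WsH _; apply: (pays_lcon WsF).
  apply: lcon_sub (h u v ju jv) => p pj; apply/mem_fam_walks.
  by exists j; rewrite // inE.
have conA j u v : j \in QQ -> u \in (fam j).1 -> v \in (fam j).1 -> lcon A1 u v.
  move=> jQ ju jv; have [_ _ _ h _] := gDT _ (fam_in j).
  have : lcon W1 u v.
    apply: W01; apply: lcon_sub (h u v ju jv) => p pj; apply/mem_fam_walks; by exists j.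
  apply: con_sub => c d [q /WA[p pA [sp dp]] [<- <-]]; rewrite -sp -dp.
  by apply: lcon_edge; rewrite mem_cat pA.
(* On the way from [t] to [u] each step is a hyperedge of [S] outside [P], whose walks use edges of
   [H], or a member of [QQ], whose terminals all belong to [Z]. *)
have XZ u : u \in X -> exists2 z, z \in Z & lcon H u z.
  move=> uX; have tu := hB t u _ (XU u uX).
  apply: (con_closed (P := fun u => exists2 z, z \in Z & lcon H u z) _ (tu _)); last 2 first.
  - by rewrite UtX mem_head.
  - by exists (t : nat); rewrite ?mem_head //; apply: rst_refl.
  have inQ c d j : j \in QQ -> c \in (fam j).1 /\ d \in (fam j).1 ->
      (exists2 z, z \in Z & lcon H c z) <-> (exists2 z, z \in Z & lcon H d z).
    move=> jQ [/(inZ _ _ jQ) cZ /(inZ _ _ jQ) dZ].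
    by split=> _; [exists d | exists c] => //; apply: rst_refl.
  move=> c d [[[j jP [cj dj]]|[j jQ cd]]|[j jQ cd]].
  - have cd : lcon H c d by apply: (conH j) => //; move: jP; rewrite inE.
    by split=> -[z zZ h]; exists z => //; [apply: rst_trans (rst_sym _ _ _ _ cd) h
      | apply: rst_trans cd h].
  - by apply: inQ cd; rewrite inE jQ.
  - by apply: inQ cd; rewrite inE jQ orbT.
have bridge e : e \in LS -> ~ lcon (del e LS) (src e) (dst e) by apply: tree_edges_bridge.
have TS : in_tree x =i unoriented LS by apply: mem_in_tree.
have endsS := @tree_edges_ends R n I S; have ordS := @tree_edges_ord R n I S.
have tZ : (t : nat) \in Z by rewrite mem_head.
pose D := removed LS F0 H Z.
have szD : (size D <= n_removed)%N.
  rewrite size_map size_cat size_map addnn -mul2n leq_mul2l /=.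
  have := size_boundary uF0 F0S HF0 bridge spanF0 minF0 XZ.
  by move/leq_trans; apply; apply: leq_mul.
(* The padding is a pair of equal vertices, which matches no edge. *)
pose D1 := D ++ nseq (n_removed - size D) ((t : nat), (t : nat)).
have szD1 : size D1 = n_removed by rewrite size_cat size_nseq subnKC.
have ES e : e \in unoriented LS -> is_edge I e.
  by apply: unoriented_is_edge => f; apply: tree_edges_is_edge.
have D1P : {subset D1 <= in_pairs x}.
  have pairP u v : u \in V -> v \in V -> (u, v) \in in_pairs x.
    by move=> uV vV; apply/allpairsP; exists (u, v).
  move=> uv; rewrite mem_cat => /orP[/mapP[e eB ->]|/nseqP[-> _]]; last exact: pairP.
  have /ES/EI/EV/andP[] : e \in unoriented LS; last exact: pairP.
  by apply: unoriented_sub eB => f; rewrite mem_filter => /andP[_ /F0S].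
pose L := searched LS F0 H Z (in_tree x) A1; pose F := kept LS F0 H A1.
have swapE : swap_cand x A1 D1 = finish t n (in_terms x) L.
  rewrite /swap_cand in_newE // in_nE /L /searched; congr (finish _ _ _ (_ ++ map _ _)).
  apply: eq_in_filter => e; rewrite TS => /ES[i [j [ij ee]]].
  rewrite mem_cat negb_or; case: (boolP (_ \in D)) => //= _; apply/nseqP => -[[si sj] _].
  have gG := stp_is_graph (s := I); have := adj_neq gG ij.
  move: si sj; rewrite ee /src /dst /= => si sj.
  by rewrite -val_eqE /= si sj eqxx.
have FL : {subset F <= L} by apply: kept_sub.
have liftP e : is_edge I e -> [/\ valid E (edge_walk e), (src e < n)%N & (dst e < n)%N].
  move=> ie; have [_ s d] := is_edgeP ie; split=> //; split.
  - by apply: lcon_edge; rewrite mem_head.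
  - by rewrite lcost_cons lcost_nil addr0.
  - by move=> f; rewrite inE => /eqP->; apply/EI.
have LP p : p \in L -> [/\ valid E p, (src p < n)%N & (dst p < n)%N].
  rewrite mem_cat => /orP[/A1P/pathsE//|/mapP[e]].
  rewrite mem_filter TS => /andP[_ /ES ie] ->; exact: liftP.
have LF u : lcon L t u -> lcon F t u.
  by apply: kept_reach.
have LZ z : z \in in_terms x -> lcon L t z.
  rewrite in_terms_terms => zU; apply: lcon_sub FL _.
  have NF c d : lcon H c d -> lcon F c d.
    apply: con_sub => c' d' [e eH [<- <-]]; apply: (lcon_edge (e := edge_walk e)).
    by rewrite mem_cat map_f ?orbT // mem_cat eH.
  have AF c d : lcon A1 c d -> lcon F c d by apply: lcon_sub => p pA; rewrite mem_cat pA.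
  have := hB t z; rewrite UtX mem_head => /(_ isT zU); apply: con_sub.
  move=> c d [[[j jP [cj dj]]|[j jQ [cj dj]]]|[j jQ [cj dj]]].
  - by apply: NF; apply: (conH j) => //; move: jP; rewrite inE.
  - by apply: AF; apply: (conA j) => //; rewrite inE jQ.
  - by apply: AF; apply: (conA j) => //; rewrite inE jQ orbT.
have [|T [finE _ _ _ cTF]] := finishP (ltn_ord t) _ LP FL LF LZ.
  by move=> e /EI/is_edgeP.
exists A1, D1, T; split.
- by rewrite mem_tuples szA1 eqxx; apply/allP.
- by rewrite mem_tuples szD1 eqxx; apply/allP.
- by rewrite swapE.
apply: le_trans cTF _.
pose J := [seq e <- LS | e \notin F0].
have cJ : lcost J + lcost F0 = cost I S.
  rewrite -(tree_edges_cost I gS) -/LS -lcost_cat; apply: perm_lcost.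
  have /permPl pf := perm_filterC (fun e => e \notin F0) LS.
  apply: perm_trans pf; rewrite perm_cat2l; apply: uniq_perm => //.
    by rewrite filter_uniq // tree_edges_uniq.
  move=> e; rewrite mem_filter /= negbK; case: (boolP (e \in F0)) => //= eF.
  by rewrite F0S.
have cF : lcost F = lcost A1 + (lcost H + lcost J).
  by rewrite /F /kept lcost_cat -(lcost_cat H); congr (_ + _); rewrite /lcost big_map.
have cW : lcost W1 <= \sum_(j in QQ) lcost (fam j).2.
  rewrite -fam_walks_cost /W1 -/W0.
  have /permPl pf := perm_filterC (fun p => src p \in V) W0.
  rewrite -(perm_lcost pf) lcost_cat lerDl.
  by apply: lcost_ge0 => p; rewrite mem_filter => /andP[_ /W0E/cost0].
have sQQ : \sum_(j in QQ) lcost (fam j).2 =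
    \sum_(j in Q) lcost (fam j).2 + \sum_(j in Q') lcost (fam j).2.
  rewrite (big_setID Q) (setIidPr (subsetUl Q Q')) /=; congr (_ + _).
  apply: eq_bigl => j; have := subsetP Q'Q j; rewrite !inE.
  by case: (j \in Q) => /= [h|_ //]; apply/esym/negP => /h.
have splitT : \sum_j lcost (fam (D := DT) j).2 =
    \sum_(j in Q) lcost (fam j).2 + \sum_(j in ~: Q) lcost (fam j).2.
  by rewrite (bigID (mem Q)) /=; congr (_ + _); apply: eq_bigl => j; rewrite inE.
have splitS : \sum_j lcost (fam (D := DS) j).2 =
    \sum_(j in P) lcost (fam j).2 + \sum_(j in ~: P) lcost (fam j).2.
  by rewrite (bigID (mem P)) /=; congr (_ + _); apply: eq_bigl => j; rewrite inE.
have totS : \sum_j lcost (fam (D := DS) j).2 <= (1 + r.+1%:R^-1) * lcost F0.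
  by rewrite fam_cost.
(* The other half of [exchange]: the new tree with [P] in place of [Q] spans the old terminals. *)
have cOPT : cost I OPT <= \sum_(j in ~: Q) lcost (fam j).2 + \sum_(j in P) lcost (fam j).2.
  pose Wo := fam_walks (~: Q) ++ fam_walks P.
  have WoE p : p \in Wo -> is_walk E p.
    rewrite mem_cat => /orP[] /mem_fam_walks[j _]; first exact: walkT.
    by move=> /walkS/walkSE.
  rewrite -!fam_walks_cost -lcost_cat -(pays_cost WoE).
  apply: (optimal_le t optI) => [e /(pays_sub WoE)/EI //|].
  apply: spans_sub hA => // c d [[j jQ [cj dj]]|[j jP [cj dj]]]; apply: (pays_lcon WoE).
    have [_ _ _ h _] := gDT _ (fam_in j); apply: lcon_sub (h c d cj dj) => p pj.
    by rewrite mem_cat; apply/orP; left; apply/mem_fam_walks; exists j.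
  have [_ _ _ h _] := gDS _ (fam_in j); apply: lcon_sub (h c d cj dj) => p pj.
  by rewrite mem_cat; apply/orP; right; apply/mem_fam_walks; exists j.
have F0c : 0 <= lcost F0 by apply: lcost_ge0.
have J0 : 0 <= lcost J by apply: lcost_ge0 => e; rewrite mem_filter => /andP[_ /LS0].
have optT := opt_le.
rewrite -/cT in optT; rewrite cF.
have /andP[rr0 rr1] := r1.
apply: (@swap_arith (r.+1%:R^-1) rho cT (cost I OPT) (cost I S) (lcost A1)
  (\sum_(j in Q) lcost (fam j).2) (\sum_(j in Q') lcost (fam j).2)
  (\sum_(j in ~: Q) lcost (fam j).2) (\sum_(j in P) lcost (fam j).2)
  (\sum_(j in ~: P) lcost (fam j).2) (lcost F0) (lcost J) (lcost H)) => //.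
- exact: r_small.
- by rewrite -sQQ; apply: le_trans cA1 cW.
- by rewrite -splitS.
- by rewrite -splitT.
Qed.

End Main.

(** * Every candidate is a Steiner tree *)

Section Best.
Variables (R : realType) (n : nat) (I : stp R n) (S : graph n) (t : 'I_n).
Hypothesis tI : t \notin terminals I.
Local Notation I' := (add_terminal I t).
Local Notation x := (inst I S t).

Lemma steiner_exists : exists T, steiner_tree I' T.
Proof.
have [_ cG] := stp_connected I; have gG := stp_is_graph (s := I).
have [|T [tT sT _ vT]] := @tree_of_edges R n I (tree_edges I (stp_graph I)) t.
  by move=> e; apply: tree_edges_is_edge.
exists T; split=> //; apply/subsetP => i _; apply: vT; apply: tree_edges_lcon => //.
by apply: cG; rewrite stp_verts inE.
Qed.

Lemma in_paths_sub p : p \in in_paths x -> {subset pay p <= in_edges x}.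
Proof.
have EV e : e \in in_edges x -> (src e \in in_verts x) && (dst e \in in_verts x).
  by move=> /mem_in_edges[i [j [_ ->]]]; rewrite /src /dst /= !ord_in_verts.
by move=> /(paths_valid EV)[[_ _ s] _ _].
Qed.

Lemma finish_steiner (L : seq (gedge R (seq (edge R)))) y : (forall p,
  p \in L -> {subset pay p <= in_edges x}) ->
  y \in finish (in_new x) (in_n x) (in_terms x) L ->
  exists T, [/\ steiner_tree I' T, cost I' T = y.1 & enc (out_tree x y.2) = enc_graph R T].
Proof.
move=> LE /(finish_sound LE)[y1 hp yE yZ]; rewrite in_newE // in hp.
have [|T [tT sT vT aT cT]] := ptree_graph (I := I) (ltn_ord t) hp.
  by move=> e /yE/mem_in_edges.
exists T; split; [|by rewrite y1 -cT|exact: out_treeE].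
split=> //; apply/subsetP => i iT; rewrite vT; apply: yZ.
by rewrite mem_in_terms.
Qed.

Lemma cands_steiner a d y :
  y \in mst_cand x ++ flatten [seq flatten [seq swap_cand x A D | D <- tuples (in_pairs x) d]
            | A <- tuples (in_paths x) a] ->
  exists T, [/\ steiner_tree I' T, cost I' T = y.1 & enc (out_tree x y.2) = enc_graph R T].
Proof.
rewrite mem_cat => /orP[|/flattenP[_ /mapP[A + ->] /flattenP[_ /mapP[D _ ->]]]].
  by apply: finish_steiner => p; rewrite mem_filter => /andP[_ /in_paths_sub].
rewrite mem_tuples => /andP[_ /allP AP]; apply: finish_steiner => p.
rewrite mem_cat => /orP[/AP/in_paths_sub//|/mapP[e + ->]].
by rewrite !mem_filter => /andP[_ /andP[_ eE]] f; rewrite inE => /eqP->.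
Qed.

Lemma best_steiner a d y : y \in mst_cand x ++
    flatten [seq flatten [seq swap_cand x A D | D <- tuples (in_pairs x) d]
            | A <- tuples (in_paths x) a] ->
  exists T, [/\ steiner_tree I' T, cost I' T <= y.1 & enc (algo a d x) = enc_graph R T].
Proof.
move=> yin; rewrite /algo /best.
set s := _ ++ _ in yin *; case: (pickminP s) => [[s0 _]|[c [-> cs cmin]]].
  by rewrite s0 in yin.
have [T [sT cT eT]] := cands_steiner cs.
by exists T; split=> //; rewrite cT; apply: cmin.
Qed.

End Best.

Theorem theorem6 (R : realType) (eps : R) (heps : 0 < eps) :
  exists (P : prog) (p : {poly nat}),
    forall (n : nat) (I : stp R n) (S : graph n) (t : 'I_n) (rho : R),
      1 <= rho ->
      approximate rho I S ->
      t \notin terminals I ->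
      exists (T : graph n) (k : nat),
        [/\ runs P (enc_reopt I S (add_terminal I t)) k (enc_graph R T),
            (k <= p.[data_size (enc_reopt I S (add_terminal I t))])%N
          & approximate (rho + eps) (add_terminal I t) T].
Proof.
have [P [k hP]] := fp_runs (fp_algo R (n_added eps) (n_removed eps)).
exists P, (('X + 1%:P) ^+ k) => n I S t rho rho1 [stS [OPT [optI Srho]]] tI.
have [T0 /optimal_exists[OPT' optI']] := steiner_exists I t.
have cT0 : 0 <= cost I OPT'.
  have [[_ [_ /subsetP sE] _] _] := optI'.
  by apply: sumr_ge0 => e /sE; apply: ecost_ge0.
have [y yin ycost] : exists2 y, y \in mst_cand (inst I S t) ++
    flatten [seq flatten [seq swap_cand (inst I S t) A D
                         | D <- tuples (in_pairs (inst I S t)) (n_removed eps)]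
            | A <- tuples (in_paths (inst I S t)) (n_added eps)] &
    y.1 <= (rho + eps) * cost I OPT'.
  have [rho2|rho2] := leP rho 2.
    have [A [D [T [AP DP swapE cT]]]] := swap_cand_cost heps stS tI optI optI' Srho rho1 rho2.
    exists (lcost T.2, T) => //; rewrite mem_cat; apply/orP; right.
    apply/flattenP; eexists; first by apply/mapP; exists A.
    apply/flattenP; exists (swap_cand (inst I S t) A D); last by rewrite swapE mem_head.
    by apply/mapP; exists D.
  have [T [mstE cT]] := mst_cand_cost S tI optI'.
  exists (lcost T.2, T); first by rewrite mem_cat mstE mem_head.
  by apply: le_trans cT _; rewrite ler_wpM2r //; lra.
have [T [sT cT eT]] := best_steiner tI yin.
have [s rs sk] := hP (inst I S t); rewrite enc_inst eT in rs.
exists T, s; split=> //.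
  by rewrite /esz enc_inst in sk; rewrite !hornerE natrXE natrDE addn1.
split=> //; exists OPT'; split=> //.
exact: le_trans cT ycost.
Qed.
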